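(* There is an absolute constant $c>0$ and, for every integer $d\ge 2$, a constant $C_d>0$ such that for all integers $p\ge q>d$: (i) if $d\ge 3$, then $\mathrm{HD}_d(p,q)\le C_d\, p^{d\cdot\frac{q-1}{q-d}}\,(\log p)^{c\,d^3\log d}$; (ii) if $d=2$, then $\mathrm{HD}_2(p,q)\le C_2\, p^{2\cdot\frac{q-1}{q-2}}$.
   Context: A family $\mathcal F$ of sets satisfies the $(p,q)$-property (for integers $p\ge q\ge 1$) if $|\mathcal F|\ge p$, no member of $\mathcal F$ is empty, and among any $p$ members of $\mathcal F$ there are $q$ with a common point. A set $T$ is a transversal of $\mathcal F$ if $T$ meets every member of $\mathcal F$. For integers $p\ge q\ge d+1$, $\mathrm{HD}_d(p,q)$ denotes the smallest integer $s$ such that every family of compact convex sets in $\mathbb R^d$ satisfying the $(p,q)$-property has a transversal of size at most $s$ (this is known to be finite). Logarithms are taken as $\max\{1,\log x\}$ to avoid degenerate values. *)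

(* Defs.v *)
From Stdlib Require Fin.
From Stdlib Require Import Reals List.
Open Scope R_scope.

Definition pt (d : nat) : Type := Fin.t d -> R.

Definition rset (d : nat) : Type := pt d -> Prop.

Definition family (d : nat) : Type := rset d -> Prop.

Definition convex {d : nat} (K : rset d) : Prop :=
  forall x y : pt d, K x -> K y -> forall t : R, 0 <= t <= 1 ->
    K (fun i => t * x i + (1 - t) * y i).

Definition bounded {d : nat} (K : rset d) : Prop :=
  exists M : R, forall x : pt d, K x -> forall i, Rabs (x i) <= M.

(* closed: complement is open (w.r.t. the sup-norm metric, equivalent to
   the Euclidean one in R^d). *)
Definition closed {d : nat} (K : rset d) : Prop :=
  forall y : pt d, ~ K y ->
    exists eps : R, 0 < eps /\
      forall x : pt d, (forall i, Rabs (x i - y i) < eps) -> ~ K x.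

(* Compact subsets of R^d (Heine–Borel: closed and bounded). *)
Definition compact {d : nat} (K : rset d) : Prop := closed K /\ bounded K.

Definition nonempty {d : nat} (K : rset d) : Prop := exists x, K x.

Definition same_set {d : nat} (A B : rset d) : Prop := forall x, A x <-> B x.

Definition distinct_sets {d : nat} (S : list (rset d)) : Prop :=
  forall i j : nat, (i < length S)%nat -> (j < length S)%nat -> i <> j ->
    forall A B, nth_error S i = Some A -> nth_error S j = Some B ->
      ~ same_set A B.

Definition members {d : nat} (F : family d) (k : nat) (S : list (rset d)) : Prop :=
  length S = k /\ distinct_sets S /\ Forall F S.

Definition pq_property {d : nat} (p q : nat) (F : family d) : Prop :=
  (exists S, members F p S) /\
  (forall K, F K -> nonempty K) /\
  (forall S, members F p S ->
     exists S', members F q S' /\ incl S' S /\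
       exists x : pt d, Forall (fun K => K x) S').

Definition transversal {d : nat} (F : family d) (T : list (pt d)) : Prop :=
  forall K, F K -> exists x, In x T /\ K x.

(* HD_d(p,q) <= s  (HD_d(p,q) is the least integer with this property, so
   for real s this is equivalent to HD_d(p,q) <= s). *)
Definition HD_le (d p q : nat) (s : R) : Prop :=
  forall F : family d,
    (forall K, F K -> compact K /\ convex K) ->
    pq_property p q F ->
    exists T : list (pt d), transversal F T /\ INR (length T) <= s.

(* log convention: max{1, log x} *)
Definition logm (x : R) : R := Rmax 1 (ln x).

(* Main.v *)
Require Import Defs.
From Stdlib Require Import Reals Lra Lia.
Open Scope R_scope.

(* Following Alon and Kleitman, the [(p,q)]-property is turned into a weighted fractional Helly
   statement.  In a random sequence of [2 P] members of a finite subfamily, [P = (q-1)(p-1)+1], at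
   least [P] of the [q]-subsets meet, and each of these contains [d] sets whose lexicographically
   minimal common point lies in the other [q - d].  Hence some point has a fraction of the weight
   of order [p^(-(q-1)/(q-d))] for every weighting.  Multiplicative weights then yield a multiset of
   points of which every set contains such a fraction, and a weak epsilon-net pierces the subfamily.
   Ultrafilter convergence passes to infinite families.

   It remains to find weak epsilon-nets of size about [epsilon^(-d)].  For [d = 2] one halves the
   points by vertical lines.  For [d >= 3] the points are split into [k^d] classes of equal size so
   that every hyperplane crosses [O(k^(d-1))] of them (a partition in the style of Matousek, obtained
   by random sampling and multiplicative weights).  A convex set holding a fraction [epsilon] of the
   points is either [k/C] times denser in one class, or meets so many classes that it contains a
   center of representatives of them; the centers are taken from a set of size depending only on
   [k] and [d].  Solving this recursion with [k = epsilon^(-1/d^2)] costs a factor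
   [(log (1/epsilon))^(28 d^3 log d)]. *)

Module Piercing.

From mathcomp Require Import Rstruct Rstruct_topology.
From mathcomp Require Import boolp classical_sets functions reals filter topology normedtype derive sequences exp.
From mathcomp Require Import all_boot all_order all_algebra.
From mathcomp Require Import ring lra zify.
Set Implicit Arguments. Unset Strict Implicit. Unset Printing Implicit Defensive.
Import Order.TTheory GRing.Theory Num.Theory numFieldNormedType.Exports.
Local Close Scope R_scope.
Local Open Scope ring_scope.

(** * Convexity and linear inequalities *)

(** The exponent [(q-1)/(q-d)] comes from balancing [P <= C(2P,q) C(q,d) b^(q-d)] with [P] about
    [p q]: one factor [P] cancels, and [q - 1] of them remain against [q - d] independent hits. The
    powers of [q] cancel against [q!] up to [16^q], whose [(q-d)]-th root is at most [16^(d+1)]; so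
    the constant does not depend on [q].

    For the partition, hyperplanes are replaced by finitely many tests, whose number has a logarithm
    of order [k^2]. This is at most [k^(d-1)] only for [d >= 3], so the plane needs its own
    argument. There the recursion [f(b) <= 2 f(2b/3) + O(b^2)] loses no logarithm, because
    [2 (2/3)^2 < 1].

    For [d >= 3] the candidates for centers number about [k^(d^3)], which must stay below [b^d] for
    [b = 1/epsilon]; this forces [k^(d^2) <= b]. A level of the recursion costs a factor [C^d] with
    [C = (d+1) kappa d] and multiplies [log b] by at most [1 - 1/(2 d^2)]. A power of [log b] of
    order [d^2 * d log C] therefore pays for all levels, and [log C] is of order [log d]. *)

Definition cvx (R : realFieldType) m (P : set 'rV[R]_m) :=
  forall x y t, 0 <= t <= 1 -> P x -> P y -> P (t *: x + (1 - t) *: y).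

Lemma cvx_sum (R : realFieldType) m (P : set 'rV[R]_m) (I : finType)
    (A : {set I}) (l : I -> R) (p : I -> 'rV[R]_m) :
  cvx P -> (forall i, i \in A -> 0 <= l i) -> \sum_(i in A) l i = 1 ->
  (forall i, i \in A -> 0 < l i -> P (p i)) ->
  P (\sum_(i in A) l i *: p i).
Proof.
move=> cP l0 l1 Pp.
(* The induction carries the normalized partial combination; the first alternative covers prefixes
   whose weights all vanish. *)
suff H (s : seq I) : {subset s <= A} ->
    let L := \sum_(i <- s) l i in let V := \sum_(i <- s) l i *: p i in
    (L = 0 /\ V = 0) \/ (0 < L /\ P (L^-1 *: V)).
  have /H : {subset enum A <= A} by move=> i; rewrite mem_enum.
  rewrite /= !big_enum l1 => -[[/eqP]|[_]]; first by rewrite oner_eq0.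
  by rewrite invr1 scale1r.
elim: s => [|a s IH] sA; first by left; rewrite !big_nil.
have aA : a \in A by apply: sA; rewrite mem_head.
have {IH} := IH (fun i si => sA i (mem_behead (s := a :: s) si)).
rewrite /= !big_cons; set L := \sum_(_ <- s) _; set V := \sum_(_ <- s) _.
have := l0 _ aA; rewrite le_eqVlt => /predU1P[<-|la].
  by rewrite !scale0r !add0r.
case=> [[-> ->]|[L0 PV]]; right; rewrite ?addr0.
  by split=> //; rewrite scalerK ?gt_eqF//; apply: Pp.
have sum0 : 0 < l a + L by rewrite addr_gt0.
split=> //.
have -> : (l a + L)^-1 *: (l a *: p a + V) =
  (l a / (l a + L)) *: p a + (1 - l a / (l a + L)) *: (L^-1 *: V).
  rewrite scalerDr !scalerA; congr (_ *: _ + _ *: _); field; first by rewrite gt_eqF.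
  by rewrite !gt_eqF.
apply: cP => //; last exact: Pp.
by rewrite divr_ge0 ?(ltW la) ?(ltW sum0)//= ler_pdivrMr// mul1r lerDl ltW.
Qed.

Lemma lin_dep (R : fieldType) m (I : finType) (A : {set I}) (p : I -> 'rV[R]_m) :
  (m < #|A|)%N ->
  exists2 l : I -> R, exists2 i, i \in A & l i != 0 & \sum_(i in A) l i *: p i = 0.
Proof.
move=> mA; pose M := \matrix_(k < #|A|) p (enum_val k).
have kerM : kermx M != 0.
  by rewrite kermx_eq0 -row_leq_rank -ltnNge (leq_ltn_trans (rank_leq_col M)).
pose v := nz_row (kermx M).
have v0 : v != 0 by rewrite nz_row_eq0.
have vM : v *m M = 0 by apply/eqP; rewrite -sub_kermx nz_row_sub.
pose l i := \sum_k v 0 k *+ (enum_val k == i).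
have lE k : l (enum_val k) = v 0 k.
  rewrite /l (bigD1 k)//= eqxx big1 ?addr0// => j jk.
  by rewrite (inj_eq enum_val_inj) (negPf jk).
exists l.
  have /rV0Pn[k vk] := v0.
  by exists (enum_val k); rewrite ?enum_valP ?lE.
rewrite big_enum_val -[RHS]vM mulmx_sum_row.
by apply: eq_bigr => k _; rewrite lE rowK.
Qed.

Lemma aff_dep (R : fieldType) m (I : finType) (A : {set I}) (p : I -> 'rV[R]_m) :
  (m.+1 < #|A|)%N ->
  exists l : I -> R, [/\ exists2 i, i \in A & l i != 0,
    \sum_(i in A) l i = 0 & \sum_(i in A) l i *: p i = 0].
Proof.
rewrite -addn1 => mA.
have [l l0 H] := lin_dep (fun i => row_mx (p i) (1%:M : 'rV_1)) mA.
exists l; split=> //.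
  have := congr1 (fun v => rsubmx v 0 0) H.
  rewrite (linear_sum (@rsubmx _ _ _ _)) summxE linear0 mxE => /= E.
  rewrite -[RHS]E; apply: eq_bigr => i _.
  by rewrite linearZ/= row_mxKr !mxE eqxx mulr1.
have := congr1 lsubmx H; rewrite linear_sum linear0 => E.
rewrite -[RHS]E; apply: eq_bigr => i _.
by rewrite linearZ/= row_mxKl.
Qed.

(** Radon's argument: points [p i] lying in all sets except perhaps [K i] are affinely dependent,
    and the point shared by the hulls of the positive and the negative part lies in every set. *)
Lemma helly (R : realFieldType) m (I : finType) (K : I -> set 'rV[R]_m) (A : {set I}) :
  (forall i, i \in A -> cvx (K i)) ->
  (forall B : {set I}, B \subset A -> (#|B| <= m.+1)%N ->
     exists x, forall i, i \in B -> K i x) ->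
  exists x, forall i, i \in A -> K i x.
Proof.
move=> cK hB; have [n nA] := ubnP #|A|.
elim: n A nA cK hB => // n IH A nA cK hB.
have [Am|mA] := leqP #|A| m.+1; first exact: hB.
have px i : exists x, i \in A -> forall j, j \in A :\ i -> K j x.
  have [iA|_] := boolP (i \in A); last by exists 0.
  have [||B BA|x xP] := IH (A :\ i); last by exists x.
  - by move: nA; rewrite (cardsD1 i A) iA.
  - by move=> j /setD1P[_]; apply: cK.
  - by move=> Bm; apply: hB => //; exact: subset_trans BA (subD1set _ _).
have [p pP] := choice px.
have [l [[i0 i0A l0] s0 sp0]] := aff_dep p mA.
pose P := [set i in A | 0 < l i]; pose N := [set i in A | l i < 0].
have splitA (V : zmodType) (f : I -> V) : (forall i, l i = 0 -> f i = 0) ->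
    \sum_(i in A) f i = \sum_(i in P) f i + \sum_(i in N) f i.
  move=> f0; rewrite (bigID (fun i => 0 < l i))/=; congr (_ + _).
    by apply: eq_bigl => i; rewrite inE.
  rewrite (bigID (fun i => l i < 0))/= [X in _ + X]big1 ?addr0.
    apply: eq_bigl => i; rewrite inE; case: (i \in A) => //=.
    by case: ltgtP.
  by move=> i /andP[/andP[_]]; rewrite -!leNgt => h1 h2; apply/f0/le_anti/andP.
have LE : \sum_(i in P) l i = - \sum_(i in N) l i.
  by apply/eqP; rewrite -addr_eq0 -splitA ?s0.
have VE : \sum_(i in P) l i *: p i = - \sum_(i in N) l i *: p i.
  by apply/eqP; rewrite -addr_eq0 -splitA ?sp0// => i ->; rewrite scale0r.
pose L := \sum_(i in P) l i.
have L0 : 0 < L.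
  rewrite lt_neqAle sumr_ge0 ?andbT; last by move=> i; rewrite inE => /andP[_ /ltW].
  apply/eqP => L0; have /eqP := l0; apply.
  have [li|li|//] := ltgtP (l i0) 0.
    have E : \sum_(i in N) - l i = 0 by rewrite sumrN -LE -/L L0.
    have /psumr_eq0P/(_ E i0) : forall i, i \in N -> 0 <= - l i.
      by move=> i; rewrite inE oppr_ge0 => /andP[_ /ltW].
    by rewrite inE i0A li => /(_ isT)/eqP; rewrite oppr_eq0 => /eqP.
  have /psumr_eq0P/(_ (esym L0) i0) : forall i, i \in P -> 0 <= l i.
    by move=> i; rewrite inE => /andP[_ /ltW].
  by rewrite inE i0A li => /(_ isT).
exists (L^-1 *: \sum_(i in P) l i *: p i) => j jA.
have [jP|jP] := boolP (j \in P).
  rewrite VE -scaleN1r scalerA scaler_sumr.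
  under eq_bigr do rewrite scalerA.
  apply: cvx_sum; first exact: cK.
  - move=> i; rewrite inE => /andP[_ li].
    by rewrite mulrN1 mulNr -mulrN mulr_ge0 ?invr_ge0 ?oppr_ge0 ?ltW.
  - by rewrite -mulr_sumr mulrN1 mulNr -mulrN -LE mulVf ?gt_eqF.
  - move=> i; rewrite inE => /andP[iA li] _; apply: pP => //.
    rewrite in_setD1 jA andbT; apply: contraTneq jP => ->.
    by rewrite inE iA/= -leNgt ltW.
rewrite scaler_sumr; under eq_bigr do rewrite scalerA.
apply: cvx_sum; first exact: cK.
- move=> i; rewrite inE => /andP[_ li].
  by rewrite mulr_ge0 ?invr_ge0 ?ltW.
- by rewrite -mulr_sumr mulVf ?gt_eqF.
- move=> i iP _; move: (iP); rewrite inE => /andP[iA li]; apply: pP => //.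
  by rewrite in_setD1 jA andbT; apply: contraNneq jP => ->.
Qed.

Definition dot (R : pzRingType) m (u v : 'rV[R]_m) := \sum_i u 0 i * v 0 i.

(** Affine functionals become vectors [h] acting by [dot h (hom x)]. By symmetry a point [x] is also
    the hyperplane of the [h] vanishing at it; this is the duality behind the test hyperplanes. *)
Definition hom (R : pzRingType) m (x : 'rV[R]_m) : 'rV[R]_(1 + m) :=
  row_mx 1%:M x.

Definition hull (R : realFieldType) m (I : finType) (A : {set I})
    (p : I -> 'rV[R]_m) : set 'rV[R]_m :=
  [set x | exists l : I -> R, [/\ forall i, i \in A -> 0 <= l i,
     \sum_(i in A) l i = 1 & x = \sum_(i in A) l i *: p i]]%classic.

Section Dot.
Context (R : comPzRingType) (m : nat).
Implicit Types u v w : 'rV[R]_m.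

Lemma dotC u v : dot u v = dot v u.
Proof. by apply: eq_bigr => i _; rewrite mulrC. Qed.

Lemma dotDr u v w : dot u (v + w) = dot u v + dot u w.
Proof. by rewrite -big_split; apply: eq_bigr => i _; rewrite mxE mulrDr. Qed.

Lemma dotZr u a v : dot u (a *: v) = a * dot u v.
Proof. by rewrite big_distrr; apply: eq_bigr => i _; rewrite mxE mulrCA. Qed.

Lemma dotNr u v : dot u (- v) = - dot u v.
Proof. by rewrite -scaleN1r dotZr mulN1r. Qed.

Lemma dotBr u v w : dot u (v - w) = dot u v - dot u w.
Proof. by rewrite dotDr dotNr. Qed.

Lemma dotDl u v w : dot (u + v) w = dot u w + dot v w.
Proof. by rewrite dotC dotDr !(dotC w). Qed.

Lemma dotZl a u v : dot (a *: u) v = a * dot u v.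
Proof. by rewrite dotC dotZr dotC. Qed.

Lemma dotNl u v : dot (- u) v = - dot u v.
Proof. by rewrite dotC dotNr dotC. Qed.

Lemma dotBl u v w : dot (u - v) w = dot u w - dot v w.
Proof. by rewrite dotDl dotNl. Qed.

Lemma dot0r u : dot u 0 = 0.
Proof. by rewrite /dot big1// => i _; rewrite mxE mulr0. Qed.

Lemma dot0l u : dot 0 u = 0.
Proof. by rewrite dotC dot0r. Qed.

Lemma dot_sumr u (I : finType) (P : pred I) (F : I -> 'rV[R]_m) :
  dot u (\sum_(i | P i) F i) = \sum_(i | P i) dot u (F i).
Proof.
apply: (big_morph (dot u)); first exact: dotDr.
exact: dot0r.
Qed.

Lemma dot_suml u (I : finType) (P : pred I) (F : I -> 'rV[R]_m) :
  dot (\sum_(i | P i) F i) u = \sum_(i | P i) dot (F i) u.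
Proof. by rewrite dotC dot_sumr; apply: eq_bigr => i _; rewrite dotC. Qed.

Lemma dot_delta u i : dot u (delta_mx 0 i) = u 0 i.
Proof.
rewrite /dot (bigD1 i)//= big1 ?addr0 ?mxE ?eqxx ?mulr1// => j ji.
by rewrite mxE (negPf ji) andbF mulr0.
Qed.

End Dot.

Lemma dot_row_mx (R : pzRingType) m1 m2 (u1 v1 : 'rV[R]_m1) (u2 v2 : 'rV[R]_m2) :
  dot (row_mx u1 u2) (row_mx v1 v2) = dot u1 v1 + dot u2 v2.
Proof.
rewrite /dot big_split_ord/=; congr (_ + _); apply: eq_bigr => i _.
  by rewrite !row_mxEl.
by rewrite !row_mxEr.
Qed.

Lemma dot_rV1 (R : pzRingType) (u v : 'rV[R]_1) : dot u v = u 0 0 * v 0 0.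
Proof. by rewrite /dot big_ord1. Qed.

Lemma dot_hom (R : comPzRingType) m (h : 'rV[R]_(1 + m)) x :
  dot h (hom x) = lsubmx h 0 0 + dot (rsubmx h) x.
Proof. by rewrite -[in LHS](hsubmxK h) dot_row_mx dot_rV1 !mxE mulr1. Qed.

Lemma dotvv_ge0 (R : realDomainType) m (u : 'rV[R]_m) : 0 <= dot u u.
Proof. by apply: sumr_ge0 => i _; rewrite -expr2 sqr_ge0. Qed.

Lemma dotvv_eq0 (R : realDomainType) m (u : 'rV[R]_m) : (dot u u == 0) = (u == 0).
Proof.
apply/eqP/eqP => [|->]; last exact: dot0l.
move=> /psumr_eq0P H; apply/rowP => i; rewrite mxE; apply/eqP.
by rewrite -sqrf_eq0 expr2 H// => j _; rewrite -expr2 sqr_ge0.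
Qed.

Lemma hull_cvx (R : realFieldType) m (P : set 'rV[R]_m) (I : finType)
    (A : {set I}) (p : I -> 'rV[R]_m) x :
  cvx P -> (forall i, i \in A -> P (p i)) -> hull A p x -> P x.
Proof.
by move=> cP pP [l [l0 l1 ->]]; apply: cvx_sum => // i /pP.
Qed.

(* Bartl's algebraic induction on the number of inequalities. *)
Lemma farkas_ord (R : realFieldType) k n (a : 'I_n -> 'rV[R]_k) (b : 'rV[R]_k) :
  (forall x, (forall i, dot (a i) x <= 0) -> dot b x <= 0) ->
  exists2 l : 'I_n -> R, forall i, 0 <= l i & b = \sum_i l i *: a i.
Proof.
elim: n a b => [|n IH] a b H.
  exists (fun=> 0) => //; rewrite big_ord0; apply/eqP.
  by rewrite -dotvv_eq0 eq_le dotvv_ge0 andbT H// => -[].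
pose a0 i := a (widen_ord (leqnSn n) i); pose z := a ord_max.
have [H0|/existsNP[y /not_implyP[ay by0]]] :=
    pselect (forall x, (forall i, dot (a0 i) x <= 0) -> dot b x <= 0).
  have [l l0 ->] := IH _ _ H0.
  exists (fun i => if unlift ord_max i is Some j then l j else 0).
    by move=> i; case: unlift.
  rewrite big_ord_recr/= unlift_none scale0r addr0; apply: eq_bigr => i _.
  have -> : widen_ord (leqnSn n) i = lift ord_max i.
    by apply: val_inj; rewrite /= /bump leqNgt ltn_ord.
  rewrite liftK /a0; congr (_ *: a _).
  by apply: val_inj; rewrite /= /bump leqNgt ltn_ord.
have {}by0 : 0 < dot b y by rewrite ltNge; apply/negP.
have zy : 0 < dot z y.
  rewrite ltNge; apply/negP => zy; have : dot b y <= 0.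
    apply: H => i; have [j ->|->] := unliftP ord_max i; last exact: zy.
    suff -> : lift ord_max j = widen_ord (leqnSn n) j by exact: ay.
    by apply: val_inj; rewrite /= /bump leqNgt ltn_ord.
  by rewrite leNgt by0.
pose red w := w - (dot w y / dot z y) *: z.
have redE w x : dot (red w) x = dot w (x - (dot z x / dot z y) *: y).
  by rewrite dotBl dotZl dotBr dotZr; field; rewrite gt_eqF.
have [|l l0 E] := IH (fun i => red (a0 i)) (red b).
  move=> x ax; rewrite redE; apply: H => i.
  have [j ->|->] := unliftP ord_max i.
    have -> : lift ord_max j = widen_ord (leqnSn n) j.
      by apply: val_inj; rewrite /= /bump leqNgt ltn_ord.
    by rewrite -/(a0 j) -redE; exact: ax.
  by rewrite dotBr dotZr -/z divfK ?gt_eqF// subrr.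
exists (fun i => if unlift ord_max i is Some j then l j else
    (dot b y - \sum_j l j * dot (a0 j) y) / dot z y).
  move=> i; case: unlift => [j|]; first exact: l0.
  rewrite divr_ge0 ?ltW// subr_gt0; apply: le_lt_trans by0.
  by apply: sumr_le0 => j _; rewrite mulr_ge0_le0.
rewrite big_ord_recr/= unlift_none.
transitivity (\sum_i l i *: a0 i + ((dot b y - \sum_j l j * dot (a0 j) y) / dot z y) *: z).
  rewrite -[LHS](subrK ((dot b y / dot z y) *: z)) -/(red b) E mulrBl scalerBl.
  rewrite addrA addrAC; congr (_ + _).
  rewrite mulr_suml scaler_suml -sumrB; apply: eq_bigr => j _.
  by rewrite scalerBr scalerA mulrA.
congr (_ + _); apply: eq_bigr => i _.
have -> : widen_ord (leqnSn n) i = lift ord_max i.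
  by apply: val_inj; rewrite /= /bump leqNgt ltn_ord.
rewrite liftK /a0; congr (_ *: a _).
by apply: val_inj; rewrite /= /bump leqNgt ltn_ord.
Qed.

Lemma farkas (R : realFieldType) k (I : finType) (A : {set I}) (a : I -> 'rV[R]_k) b :
  (forall x, (forall i, i \in A -> dot (a i) x <= 0) -> dot b x <= 0) ->
  exists2 l : I -> R, forall i, i \in A -> 0 <= l i & b = \sum_(i in A) l i *: a i.
Proof.
move=> H; have [|l l0 ->] := @farkas_ord R k #|A| (fun k => a (enum_val k)) b.
  move=> x ax; apply: H => i iA.
  by have := ax (enum_rank_in iA i); rewrite enum_rankK_in.
pose l' i := \sum_k l k *+ (enum_val k == i).
have lE j : l' (enum_val j) = l j.
  rewrite /l' (bigD1 j)//= eqxx big1 ?addr0// => j' jj.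
  by rewrite (inj_eq enum_val_inj) (negPf jj).
exists l'; first by move=> i _; apply: sumr_ge0 => j _; rewrite mulrn_wge0.
by rewrite [RHS]big_enum_val; apply: eq_bigr => j _; rewrite lE.
Qed.

(** Otherwise Farkas' lemma writes [hom c] as a nonnegative combination of the [hom (p i)], and the
    leading coordinates force the weights to sum to 1. *)
Lemma separation (R : realFieldType) m (I : finType) (A : {set I})
    (p : I -> 'rV[R]_m) c : ~ hull A p c ->
  exists2 h : 'rV[R]_(1 + m), forall i, i \in A -> 0 < dot h (hom (p i))
    & dot h (hom c) < 0.
Proof.
move=> nc.
have [H|/existsNP[x /not_implyP[ax bx]]] := pselect (forall x,
    (forall i, i \in A -> dot (hom (p i)) x <= 0) -> dot (hom c) x <= 0).
  case: nc; have [l l0 E] := farkas H; exists l; split=> //.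
    have <- : lsubmx (hom c) 0 0 = 1 by rewrite row_mxKl mxE eqxx.
    rewrite E linear_sum summxE; apply: eq_bigr => i _.
    by rewrite linearZ/= row_mxKl !mxE eqxx mulr1.
  have := congr1 rsubmx E; rewrite row_mxKr linear_sum => ->.
  by apply: eq_bigr => i _; rewrite linearZ/= row_mxKr.
have {}bx : 0 < dot (hom c) x by rewrite ltNge; apply/negP.
pose e : 'rV[R]_(1 + m) := row_mx 1%:M 0.
have eE y : dot e (hom y) = 1.
  by rewrite dot_hom row_mxKl row_mxKr dot0l mxE eqxx addr0.
(* Half of the value at [c] lies strictly between the value at [c] and those at the points. *)
exists ((dot (hom c) x / 2) *: e - x).
  move=> i iA; have := ax _ iA; rewrite dotBl dotZl eE (dotC x) => h.
  by lra.
by rewrite dotBl dotZl eE (dotC x); lra.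
Qed.

(** Take a feasible [g] with the most tight constraints: if a solution of its tight equations
    violated a constraint, moving from [g] towards it would make a further constraint tight. By the
    last clause [g] may be replaced by any solution chosen from [T] alone, which makes finite
    enumerations possible. *)
Lemma basic_solution (R : realFieldType) k (I : finType) (A : {set I})
    (a : I -> 'rV[R]_k) (b : I -> R) g0 :
  (forall i, i \in A -> b i <= dot (a i) g0) ->
  exists T : {set I}, [/\ T \subset A, (#|T| <= k)%N,
    (exists g, forall i, i \in T -> dot (a i) g = b i) &
    forall g, (forall i, i \in T -> dot (a i) g = b i) ->
      forall i, i \in A -> b i <= dot (a i) g].
Proof.
move=> g0A.
pose feas g := forall i, i \in A -> b i <= dot (a i) g.
pose Z g := [set i in A | dot (a i) g == b i].
pose Q n := `[< exists2 g, feas g & #|Z g| = n >].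
have exQ : exists n, Q n by exists #|Z g0|; apply/asboolP; exists g0.
have Qb n : Q n -> (n <= #|A|)%N.
  by move=> /asboolP[g _ <-]; apply/subset_leq_card/subsetP => i; rewrite inE => /andP[].
case: (ex_maxnP exQ Qb) => n /asboolP[g fg Zg] nmax.
have feasZ g' : (forall i, i \in Z g -> dot (a i) g' = b i) -> feas g'.
  move=> g'Z; apply: contrapT => /existsNP[j /not_implyP[jA /negP]].
  rewrite -ltNge => jlt.
  pose viol := [pred i | (i \in A) && (dot (a i) g' < b i)].
  pose lam i := (dot (a i) g - b i) / (dot (a i) g - dot (a i) g').
  have vj : viol j by rewrite /= jA.
  case: (arg_minP lam vj) => s /andP[sA slt] smin.
  have lam0 i : viol i -> 0 <= lam i.
    move=> /andP[iA ilt]; have := fg _ iA => bg.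
    by rewrite divr_ge0 ?subr_ge0//; apply: ltW (lt_le_trans ilt bg).
  have den i : viol i -> 0 < dot (a i) g - dot (a i) g'.
    by move=> /andP[iA ilt]; rewrite subr_gt0 (lt_le_trans ilt (fg _ iA)).
  have lam1 : lam s <= 1.
    rewrite ler_pdivrMr ?den//= ?sA// mul1r lerD2l lerN2; exact: ltW.
  pose gs := g + lam s *: (g' - g).
  have gsE i : dot (a i) gs = dot (a i) g - lam s * (dot (a i) g - dot (a i) g').
    by rewrite dotDr dotZr dotBr; ring.
  have fgs : feas gs.
    move=> i iA; rewrite gsE; have [vi|nvi] := boolP (viol i).
      have := smin _ vi; rewrite /lam -/(lam s) ler_pdivlMr ?den//; lra.
    have ge : b i <= dot (a i) g' by move: nvi; rewrite /= iA/= -leNgt.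
    have := fg _ iA => ge2; have := lam0 s; rewrite /= sA slt => /(_ isT) l0.
    have : 0 <= lam s * (dot (a i) g' - b i) by rewrite mulr_ge0// subr_ge0.
    have : 0 <= (1 - lam s) * (dot (a i) g - b i) by rewrite mulr_ge0// subr_ge0.
    lra.
  have sub : Z g \subset Z gs.
    apply/subsetP => i iZ; move: (iZ); rewrite !inE => /andP[-> /eqP E]/=.
    by rewrite gsE E (g'Z _ iZ) subrr mulr0 subr0.
  have sgs : s \in Z gs.
    rewrite inE sA gsE /lam; apply/eqP; rewrite divfK; first by ring.
    by rewrite gt_eqF// den//= sA.
  have sg : s \notin Z g.
    by apply: contraL slt => sZ; rewrite -leNgt g'Z.
  have : (n < #|Z gs|)%N.
    rewrite -Zg; apply: proper_card; apply/properP; split=> //; by exists s.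
  rewrite ltnNge nmax//; apply/asboolP; by exists gs.
(* [T] will be minimal among the subsets whose equations imply all tight ones. Minimality yields
   vectors [u i] dual to the [a i] up to nonzero factors, hence independent. *)
pose PT (T : {set I}) := (T \subset Z g) &&
  `[< forall g', (forall i, i \in T -> dot (a i) g' = b i) ->
        forall i, i \in Z g -> dot (a i) g' = b i >].
have PZ : PT (Z g) by rewrite /PT subxx; apply/asboolP.
have [T /minsetP[/andP[TZ /asboolP TP] Tmin] _] := minset_exists PZ.
have gT i : i \in T -> dot (a i) g = b i.
  by move=> /(subsetP TZ); rewrite inE => /andP[_ /eqP].
exists T; split.
- by apply: subset_trans TZ _; apply/subsetP => i; rewrite inE => /andP[].
- rewrite leqNgt; apply/negP => kT.
  have ui i : exists u, i \in T ->
     (forall j, j \in T :\ i -> dot (a j) u = 0) /\ dot (a i) u != 0.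
    have [iT|_] := boolP (i \in T); last by exists 0.
    have : ~~ PT (T :\ i).
      apply/negP => /(Tmin _)/(_ (subD1set _ _)) E.
      by move: iT; rewrite -E !inE eqxx.
    rewrite negb_and (subset_trans (subD1set _ _) TZ)/=.
    move=> /asboolPn/existsNP[g' /not_implyP[g'T]].
    move=> /existsNP[j /not_implyP[jZ nj]].
    exists (g' - g) => _; split=> [l lT|].
      by rewrite dotBr g'T// gT ?subrr//; move: lT; rewrite !inE => /andP[].
    rewrite dotBr gT// subr_eq0; apply/eqP => E; apply: nj; apply: TP jZ => l lT.
    by have [->//|li] := eqVneq l i; apply: g'T; rewrite !inE li.
  have [u uP] := choice ui.
  have [l [i iT li]] := lin_dep u kT.
  move/(congr1 (dot (a i))); rewrite dot0r dot_sumr (bigD1 i)//= big1 ?addr0.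
    move/eqP; rewrite dotZr mulf_eq0 (negPf li)/=.
    by have [_ /negPf->] := uP i iT.
  move=> j /andP[jT ji]; rewrite dotZr; have [/(_ i) H _] := uP j jT.
  by rewrite H ?mulr0// !inE iT eq_sym ji.
- by exists g.
- by move=> g' /TP/feasZ.
Qed.

(** * Lexicographic minima of convex sets *)

Definition ltlex (R : realFieldType) m (u v : 'rV[R]_m) :=
  exists2 i : 'I_m, forall j : 'I_m, (j < i)%N -> u 0 j = v 0 j & u 0 i < v 0 i.

Definition is_lexmin (R : realFieldType) m (A : set 'rV[R]_m) v :=
  A v /\ forall z, A z -> ~ ltlex z v.

Definition lexmin (R : realFieldType) m (A : set 'rV[R]_m) :=
  xget 0 (is_lexmin A).

Lemma ltlex_total (R : realFieldType) m (u v : 'rV[R]_m) :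
  u != v -> ltlex u v \/ ltlex v u.
Proof.
move=> uv; have /existsP[i0 Pi0] : [exists i, u 0 i != v 0 i].
  apply: contraNT uv => /existsPn H; apply/eqP/rowP => i.
  by apply/eqP; have := H i; rewrite negbK.
case: (@arg_minnP _ i0 (fun i => u 0 i != v 0 i) (@nat_of_ord m) Pi0) => i ui imin.
have E (j : 'I_m) : (j < i)%N -> u 0 j = v 0 j.
  by move=> ji; apply/eqP; apply: contraLR ji => /imin; rewrite -leqNgt.
have [l|l|/eqP] := ltgtP (u 0 i) (v 0 i); last by rewrite (negPf ui).
  by left; exists i.
by right; exists i => // j /E.
Qed.

Lemma lexminE (R : realFieldType) m (A : set 'rV[R]_m) v :
  is_lexmin A v -> lexmin A = v.
Proof.
move=> vA; have [uA um] : is_lexmin A (lexmin A) by apply: xgetPex; exists v.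
have [//|/ltlex_total[uv|vu]] := eqVneq (lexmin A) v.
  by case: vA => _ /(_ _ uA).
by case: (um v) => //; case: vA.
Qed.

Lemma cvx_ltlex (R : realFieldType) m (v : 'rV[R]_m) : cvx [set y | ltlex y v]%classic.
Proof.
move=> x y t /andP[]; rewrite le_eqVlt => /predU1P[<- _ _ yv|t0].
  by rewrite scale0r add0r subr0 scale1r.
rewrite le_eqVlt => /predU1P[-> xv _|t1].
  by rewrite subrr scale0r addr0 scale1r.
move=> [i xi li] [j yj lj].
pose k := if (i <= j)%N then i else j.
have ki : (k <= i)%N by rewrite /k; case: (leqP i j) => // h; exact: ltnW.
have kj : (k <= j)%N by rewrite /k; case: (leqP i j).
have xle : x 0 k <= v 0 k.
  move: ki; rewrite leq_eqVlt => /predU1P[/val_inj ->|/xi ->//]; exact: ltW.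
have yle : y 0 k <= v 0 k.
  move: kj; rewrite leq_eqVlt => /predU1P[/val_inj ->|/yj ->//]; exact: ltW.
exists k.
  move=> l lk; rewrite !mxE (xi l (leq_trans lk ki)) (yj l (leq_trans lk kj)); ring.
rewrite !mxE; have : x 0 k < v 0 k \/ y 0 k < v 0 k.
  by rewrite /k; case: (leqP i j); [left|right].
case=> h.
  have : 0 < t * (v 0 k - x 0 k) by rewrite mulr_gt0// subr_gt0.
  have : 0 <= (1 - t) * (v 0 k - y 0 k) by rewrite mulr_ge0 ?subr_ge0 ?(ltW t1).
  lra.
have : 0 <= t * (v 0 k - x 0 k) by rewrite mulr_ge0 ?subr_ge0 ?(ltW t0).
have : 0 < (1 - t) * (v 0 k - y 0 k) by rewrite mulr_gt0 ?subr_gt0.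
lra.
Qed.

Lemma ltlex_seg (R : realFieldType) m (u v : 'rV[R]_m) e :
  0 < e -> ltlex (v + u) v -> ltlex (v + e *: u) v.
Proof.
move=> e0 [i ui li]; exists i.
  move=> j /ui; rewrite !mxE => E; suff -> : u 0 j = 0 by rewrite mulr0 addr0.
  by move: E; rewrite -[RHS]addr0 => /addrI.
move: li; rewrite !mxE gtrDl => ui0.
by rewrite gtrDl pmulr_rlt0.
Qed.

Lemma ltlex_opp (R : realFieldType) m (u v : 'rV[R]_m) :
  u != 0 -> ltlex (v + u) v \/ ltlex (v - u) v.
Proof.
move=> u0; have /ltlex_total[[i ui li]|[i ui li]] : v + u != v.
- by rewrite -subr_eq0 addrC addKr.
- by left; exists i.
right; exists i => [j /ui|]; first by rewrite !mxE => E; lra.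
by move: li; rewrite !mxE => E; lra.
Qed.

(** Helly's theorem for the [K i] together with the convex set of points below [v]: they have no
    common point, and a subfamily of at most [m + 1] sets without one must contain the extra set,
    since [v] lies in all the others. *)
Lemma lexmin_basis (R : realFieldType) m (I : finType) (A : {set I})
    (K : I -> set 'rV[R]_m) v :
  (forall i, i \in A -> cvx (K i)) -> (forall i, i \in A -> K i v) ->
  (forall z, (forall i, i \in A -> K i z) -> ~ ltlex z v) ->
  exists B : {set I}, [/\ B \subset A, (#|B| <= m)%N &
    forall z, (forall i, i \in B -> K i z) -> ~ ltlex z v].
Proof.
move=> cK vA vmin; apply: contrapT => nB.
pose K' (i : option I) := if i is Some j then K j else [set y | ltlex y v]%classic.
pose A' := None |: (Some @: A).
have sA i : (Some i \in A') = (i \in A) by rewrite !inE/= mem_imset// => ? ? [].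
have [||z zP] := @helly _ m _ K' A'.
- by case=> [i|_]; [rewrite sA; apply: cK|apply: cvx_ltlex].
- move=> B' B'A B'm.
  have [NB|NB] := boolP (None \in B'); last first.
    exists v => -[i iB|]; last by rewrite (negPf NB).
    by apply: vA; rewrite -sA; apply: (subsetP B'A).
  apply: contrapT => nz; apply: nB; exists [set i | Some i \in B']; split.
  + by apply/subsetP => i; rewrite inE -sA => /(subsetP B'A).
  + have Sinj : injective (@Some I) by move=> ? ? [].
    rewrite -(card_imset _ Sinj).
    move: B'm; rewrite (cardsD1 None) NB add1n ltnS; apply: leq_trans.
    apply/subset_leq_card/subsetP => _ /imsetP[i + ->].
    by rewrite !inE.
  + move=> z zB lz; apply: nz; exists z => -[i iB|_]; last exact: lz.
    by apply: zB; rewrite inE.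
- apply: (vmin z); last by apply: (zP None); rewrite !inE.
  by move=> i; rewrite -sA => /zP.
Qed.

(** Coordinates are minimized one after another; [B] collects the points of [A] whose first [k]
    coordinates are lexicographically least. *)
Lemma lexmin_exists (R : realType) m (A : set 'rV[R]_m) :
  compact A -> (A !=set0)%classic -> is_lexmin A (lexmin A).
Proof.
move=> cA A0; apply: xgetPex.
suff H k : (k <= m)%N -> exists B : set 'rV[R]_m, [/\ (B `<=` A)%classic,
    compact B, (B !=set0)%classic,
    forall z w, A z -> B w -> forall i : 'I_m, (i < k)%N ->
      (forall j : 'I_m, (j < i)%N -> z 0 j = w 0 j) -> w 0 i <= z 0 i &
    forall z w, A z -> B w ->
      (forall j : 'I_m, (j < k)%N -> z 0 j = w 0 j) -> B z].
  have [B [BA _ [v Bv] BP _]] := H m (leqnn m).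
  exists v; split; first exact: BA.
  by move=> z Az [i ij]; rewrite ltNge => /negP; apply; apply: BP.
elim: k => [_|k IH km]; first by exists A; split.
have [B [BA cB B0 BP BQ]] := IH (ltnW km); pose i0 := Ordinal km.
have [|c cB' cmin] := @EVT_min_rV R m (fun x => x 0 i0) B B0 cB.
  by apply: continuous_subspaceT => x; apply: coord_continuous.
rewrite in_setE in cB'.
exists (B `&` (fun x : 'rV[R]_m => x 0 i0) @^-1` [set y | y = c 0 i0])%classic; split.
- by move=> x [/BA].
- apply: compact_closedI => //.
  apply: preimage_closed; last exact: closed_eq.
  by move=> x _; apply: coord_continuous.
- by exists c.
- move=> z w Az [Bw wc] i; rewrite ltnS leq_eqVlt => /predU1P[ik|ik] ij.
    have E : i = i0 by apply: val_inj.
    rewrite E wc; apply: cmin; rewrite in_setE; apply: (BQ _ w) => // j jk.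
    by apply: ij; rewrite ik.
  exact: BP.
- move=> z w Az [Bw wc] zw; split; last by rewrite /= -wc; apply: zw.
  by apply: (BQ _ w) => // j jk; apply: zw; rewrite ltnS ltnW.
Qed.

(** * The fractional Helly step *)

Section ProductWeight.
Context (R : realFieldType) (I T : finType) (w : T -> R) (B : {set I}) (t0 : T).
Context (Q : {ffun I -> T} -> T -> R).
Hypothesis Qdep : forall f f' : {ffun I -> T},
  (forall i, i \notin B -> f i = f' i) -> Q f = Q f'.

Let base (g : {ffun I -> T}) := [forall i in B, g i == t0].

Lemma product_weight_fiber (g : {ffun I -> T}) :
  \sum_(f : {ffun I -> T} | [forall i in ~: B, f i == g i])
     (\prod_i w (f i)) * \prod_(i in B) Q f (f i) =
  \prod_(i in ~: B) w (g i) * (\sum_t w t * Q g t) ^+ #|B|.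
Proof.
pose D i : pred T := if i \in B then predT else pred1 (g i).
pose F i t := if i \in B then w t * Q g t else w t.
transitivity (\prod_i \sum_(t | D i t) F i t); last first.
  rewrite (bigID (mem B))/= mulrC; congr (_ * _).
    rewrite [RHS](eq_bigl (fun i => i \notin B)); last by move=> i; rewrite inE.
    by apply: eq_bigr => i iB; rewrite /D /F (negPf iB) big_pred1_eq.
  rewrite -prodr_const; apply: eq_bigr => i iB.
  by rewrite /D /F iB.
have fam f : (f \in family D) = [forall i in ~: B, f i == g i].
  by apply: eq_forallb => i; rewrite /D /finfun.fmem inE; case: (i \in B).
rewrite bigA_distr_big_dep; apply: eq_big => [f|f]; first by rewrite -fam.
move=> /forallP fg.
rewrite [RHS](bigID (mem B))/= [X in X * _](bigID (mem B))/=.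
rewrite mulrAC -big_split/=; congr (_ * _); apply: eq_bigr => i iB; rewrite /F.
  rewrite iB (@Qdep f g)// => j jB; apply/eqP.
  by have := fg j; rewrite inE jB.
by rewrite (negPf iB).
Qed.

Lemma product_weight_split :
  \sum_(f : {ffun I -> T}) (\prod_i w (f i)) * \prod_(i in B) Q f (f i) =
  \sum_(g | base g) \prod_(i in ~: B) w (g i) * (\sum_t w t * Q g t) ^+ #|B|.
Proof.
pose res (f : {ffun I -> T}) := [ffun i => if i \in B then t0 else f i].
rewrite (partition_big res base)/=; last first.
  by move=> f _; apply/forallP => i; apply/implyP => iB; rewrite ffunE iB.
apply: eq_bigr => g /forallP bg; rewrite -product_weight_fiber.
apply: eq_bigl => f; apply/eqP/forallP => [<- i|H].
  by rewrite inE ffunE; case: (i \in B) => //=; rewrite eqxx.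
apply/ffunP => i; rewrite ffunE; have := H i; have := bg i; rewrite inE.
by case: (i \in B) => /= [/eqP->|_ /eqP].
Qed.

Lemma product_weight_base :
  \sum_(g | base g) \prod_(i in ~: B) w (g i) = (\sum_t w t) ^+ #|~: B|.
Proof.
pose D i : pred T := if i \in B then pred1 t0 else predT.
pose F i t := if i \in B then 1 else w t.
transitivity (\prod_i \sum_(t | D i t) F i t); last first.
  rewrite (bigID (mem B))/= [X in X * _]big1 ?mul1r.
    rewrite -prodr_const [RHS](eq_bigl (fun i => i \notin B)); last by move=> i; rewrite inE.
    by apply: eq_bigr => i iB; rewrite /D /F (negPf iB).
  by move=> i iB; rewrite /D /F iB big_pred1_eq.
have fam f : (f \in family D) = base f.
  by apply: eq_forallb => i; rewrite /D /finfun.fmem; case: (i \in B).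
rewrite bigA_distr_big_dep; apply: eq_big => [f|f]; first by rewrite -fam.
move=> /forallP fg.
rewrite [RHS](bigID (mem B))/= [X in _ = X * _]big1 ?mul1r.
  rewrite (eq_bigl (fun i => i \notin B)); last by move=> i; rewrite inE.
  by apply: eq_bigr => i iB; rewrite /F (negPf iB).
by move=> i iB; rewrite /F iB.
Qed.

Hypothesis w0 : forall t, 0 <= w t.

Lemma product_weight_le b :
  (forall f t, 0 <= Q f t) -> (forall f, \sum_t w t * Q f t <= b) ->
  \sum_(f : {ffun I -> T}) (\prod_i w (f i)) * \prod_(i in B) Q f (f i)
    <= (\sum_t w t) ^+ #|~: B| * b ^+ #|B|.
Proof.
move=> Q0 Qb; rewrite product_weight_split -product_weight_base mulr_suml.
apply: ler_sum => g _; apply: ler_wpM2l; first exact: prodr_ge0.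
apply: lerXn2r => //; rewrite nnegrE.
  by apply: sumr_ge0 => t _; rewrite mulr_ge0.
by apply: le_trans (Qb g); apply: sumr_ge0 => t _; rewrite mulr_ge0.
Qed.

Lemma product_weight_ge b :
  0 <= b -> (forall f, b <= \sum_t w t * Q f t) ->
  (\sum_t w t) ^+ #|~: B| * b ^+ #|B| <=
  \sum_(f : {ffun I -> T}) (\prod_i w (f i)) * \prod_(i in B) Q f (f i).
Proof.
move=> b0 Qb; rewrite product_weight_split -product_weight_base mulr_suml.
apply: ler_sum => g _; apply: ler_wpM2l; first exact: prodr_ge0.
by apply: lerXn2r => //; rewrite nnegrE// (le_trans b0).
Qed.

End ProductWeight.

Lemma product_weight_total (R : realFieldType) (I T : finType) (w : T -> R) :
  \sum_(f : {ffun I -> T}) \prod_i w (f i) = (\sum_t w t) ^+ #|I|.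
Proof.
rewrite -(bigA_distr_bigA (fun _ : I => w)) prodr_const.
by rewrite cardT -cardE.
Qed.

Lemma subset_of_card (T : finType) (B A : {set T}) k :
  B \subset A -> (#|B| <= k <= #|A|)%N ->
  exists J : {set T}, [/\ B \subset J, J \subset A & #|J| = k].
Proof.
move=> BA /andP[Bk kA].
have /card_geqP[s [us ss sA]] : (k - #|B| <= #|A :\: B|)%N.
  by rewrite cardsD (setIidPr BA) leq_sub2r.
exists (B :|: [set x in s]); split.
- exact: subsetUl.
- rewrite subUset BA; apply/subsetP => x; rewrite inE => /sA.
  by rewrite inE => /andP[].
- rewrite cardsU disjoint_setI0 ?cards0 ?subn0.
    by rewrite [X in (_ + X)%N]cardsE (card_uniqP us) ss subnKC.
  rewrite disjoint_sym disjoints_subset; apply/subsetP => x.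
  by rewrite !inE => /sA; rewrite inE => /andP[].
Qed.

Section Fractional.
Context (R : realType) (d : nat) (T : finType) (K : T -> set 'rV[R]_d).
Context (p q : nat).
Hypothesis Kcompact : forall t, compact (K t).
Hypothesis Kclosed : forall t, topology_structure.closed (K t).
Hypothesis Kcvx : forall t, cvx (K t).
Hypothesis K0 : forall t, (K t !=set0)%classic.
Hypotheses (dq : (d < q)%N) (qp : (q <= p)%N).
Hypothesis pq : forall A : {set T}, #|A| = p -> exists B : {set T},
  [/\ B \subset A, #|B| = q & exists x, forall t, t \in B -> K t x].

(* By pigeonhole, [P] indices of a sequence of sets include [q] indices of one set or
   [p] indices of distinct sets. *)
Let P := (q.-1 * p.-1).+1.

Definition meeting n (f : {ffun 'I_n -> T}) (I : {set 'I_n}) :=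
  `[< exists x, forall i, i \in I -> K (f i) x >].

Lemma meeting_exists n (f : {ffun 'I_n -> T}) (A : {set 'I_n}) :
  (P <= #|A|)%N -> exists I : {set 'I_n}, [/\ I \subset A, #|I| = q & meeting f I].
Proof.
move=> PA.
have [/existsP[t ht]|/existsPn hsmall] :=
    boolP [exists t, (q <= #|[set i in A | f i == t]|)%N].
  have [|I [_ IA Iq]] := @subset_of_card _ set0 [set i in A | f i == t] q (sub0set _).
    by rewrite cards0.
  exists I; split=> //.
    by apply: subset_trans IA _; apply/subsetP => i; rewrite inE => /andP[].
  have [x xK] := K0 t; apply/asboolP; exists x => i /(subsetP IA).
  by rewrite inE => /andP[_ /eqP->].
have pim : (p <= #|f @: A|)%N.
  rewrite leqNgt; apply/negP => him.
  have : (#|A| <= \sum_(t in f @: A) q.-1)%N.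
    rewrite -sum1_card (partition_big f (mem (f @: A)))/=; last first.
      by move=> i iA; rewrite imset_f.
    apply: leq_sum => t _; have := hsmall t; rewrite -ltnNge.
    rewrite -sum1_card => h; rewrite -ltnS prednK; last by lia.
    by apply: leq_trans h; rewrite ltnS; apply: eq_leq; apply: eq_bigl => i; rewrite inE.
  rewrite sum_nat_const mulnC => /(leq_trans PA); rewrite ltnNge leq_mul2l => /negP; apply.
  by apply/orP; right; lia.
have [|A' [_ A'A A'p]] := @subset_of_card _ set0 (f @: A) p (sub0set _).
  by rewrite cards0.
have [B [BA' Bq [x xB]]] := pq A'p.
have gex t : exists i, t \in B -> i \in A /\ f i = t.
  have [tB|_] := boolP (t \in B).
    have /imsetP[i iA ->] := subsetP A'A _ (subsetP BA' _ tB).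
    by exists i.
  have /card_gt0P[i _] : (0 < #|A|)%N by apply: leq_trans PA.
  by exists i.
have [g gP] := choice gex.
exists (g @: B); split.
- by apply/subsetP => _ /imsetP[t tB ->]; case: (gP t tB).
- rewrite card_in_imset// => t u tB uB E.
  by case: (gP t tB) => _ <-; case: (gP u uB) => _ <-; rewrite E.
- apply/asboolP; exists x => _ /imsetP[t tB ->].
  by case: (gP t tB) => _ ->; apply: xB.
Qed.

(** Deleting an index of a meeting [q]-subset destroys that subset, and there is one as long as [P]
    indices remain. *)
Lemma meeting_count n (f : {ffun 'I_n -> T}) (A : {set 'I_n}) :
  (#|A| < P + #|[set I : {set 'I_n} | [&& I \subset A, #|I| == q & meeting f I]]|)%N.
Proof.
have [k kA] := ubnP #|A|; elim: k A kA => // k IH A kA.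
have [AP|PA] := ltnP #|A| P; first exact: leq_trans AP (leq_addr _ _).
have [I0 [I0A I0q I0m]] := meeting_exists f PA.
have /card_gt0P[i iI] : (0 < #|I0|)%N by rewrite I0q; lia.
have iA := subsetP I0A _ iI.
have := IH (A :\ i); rewrite (cardsD1 i A) iA in kA * => /(_ kA) h.
rewrite add1n; apply: (leq_ltn_trans h); rewrite ltn_add2l; apply: proper_card.
apply/properP; split.
  apply/subsetP => J; rewrite !inE => /and3P[JA -> ->]; rewrite !andbT.
  exact: subset_trans JA (subD1set _ _).
exists I0; rewrite !inE ?I0A ?I0q ?eqxx ?I0m//=.
rewrite negb_and; apply/orP; left; apply/negP => /subsetP/(_ _ iI).
by rewrite !inE eqxx.
Qed.

Definition meet_lexmin n (f : {ffun 'I_n -> T}) (J : {set 'I_n}) :=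
  lexmin (\bigcap_(i in [set` J]) K (f i))%classic.

(** The at most [d] sets that determine the minimum over [I] are padded to [d], which does not
    change the minimum. The point then depends on [f] only through [J]. *)
Lemma meeting_lexmin n (f : {ffun 'I_n -> T}) (I : {set 'I_n}) :
  #|I| = q -> meeting f I -> exists J : {set 'I_n}, [/\ J \subset I, #|J| = d &
    forall i, i \in I -> K (f i) (meet_lexmin f J)].
Proof.
move=> Iq /asboolP[x xI].
pose S := (\bigcap_(i in [set` I]) K (f i))%classic.
have /card_gt0P[i0 i0I] : (0 < #|I|)%N by rewrite Iq; lia.
have Sc : compact S.
  apply: (subclosed_compact _ (@Kcompact (f i0))); first exact: closed_bigI.
  by move=> y; apply.
have [SL Smin] : is_lexmin S (lexmin S).
  by apply: lexmin_exists => //; exists x => i; apply: xI.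
have [|||B [BI Bd Bmin]] := @lexmin_basis _ _ _ I (fun i => K (f i)) (lexmin S).
- by move=> i _; apply: Kcvx.
- by move=> i iI; apply: SL.
- by move=> z zI; apply: Smin => i; apply: zI.
have [|J [BJ JI Jd]] := @subset_of_card _ B I d BI.
  by rewrite Bd Iq ltnW.
exists J; split=> // i iI.
suff -> : meet_lexmin f J = lexmin S by exact: SL.
apply: lexminE; split.
  by move=> j jJ; apply: SL; apply: (subsetP JI).
by move=> z zJ; apply: Bmin => j jB; apply: zJ; apply: (subsetP BJ).
Qed.

Context (w : T -> R).
Hypothesis w0 : forall t, 0 <= w t.
Hypothesis w_gt0 : 0 < \sum_t w t.

(** For fixed [I] and [J], the other [q - d] members of a random sequence are independent of the
    point determined by [J], and each contains it with probability at most [b]. *)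
Lemma fractional_helly b : 0 <= b ->
  (forall x, \sum_t w t * (`[< K t x >])%:R <= b * \sum_t w t) ->
  P%:R <= ('C(P.*2, q) * 'C(q, d))%:R * b ^+ (q - d) :> R.
Proof.
move=> b0 hb; set W := \sum_t w t.
have [m mE] : exists m, m = P.*2 by exists P.*2.
rewrite -mE.
have [t0 _] : exists t0 : T, true.
  have [t0|T0] := pickP (fun _ : T => true); first by exists t0.
  by exfalso; move: w_gt0; rewrite big1 ?ltxx// => t; have := T0 t.
pose bad (f : {ffun 'I_m -> T}) (I J : {set 'I_m}) : R :=
  \prod_(i in I :\: J) (`[< K (f i) (meet_lexmin f J) >])%:R.
have pw0 (f : {ffun 'I_m -> T}) : 0 <= \prod_i w (f i) by apply: prodr_ge0.
have bad0 f I J : 0 <= bad f I J by apply: prodr_ge0.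
have countf (f : {ffun 'I_m -> T}) : P%:R <=
    \sum_(I : {set 'I_m} | #|I| == q) \sum_(J : {set 'I_m} | (J \subset I) && (#|J| == d)) bad f I J.
  have := meeting_count f [set: 'I_m].
  rewrite [X in (X < _)%N](_ : _ = P + P)%N; last by rewrite cardsT card_ord mE addnn.
  rewrite ltn_add2l.
  rewrite -(ltr_nat R) => /ltW/le_trans; apply.
  rewrite -sum1_card natr_sum (bigID (fun I : {set 'I_m} => #|I| == q))/=.
  rewrite [X in _ + X]big1 ?addr0; last first.
    by move=> I; rewrite inE => /andP[/and3P[_ ->]].
  rewrite [leRHS](bigID (fun I => meeting f I))/= -[leLHS]addr0 lerD//; last first.
    by apply: sumr_ge0 => I _; apply: sumr_ge0.
  rewrite (eq_bigl (fun I : {set 'I_m} => (#|I| == q) && meeting f I)); last first.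
    by move=> I; rewrite inE subsetT/=; case: (_ == _); rewrite ?andbT ?andbF.
  apply: ler_sum => I /andP[/eqP Iq /(meeting_lexmin Iq)[J [JI Jd JK]]].
  rewrite (bigD1 J)/=; last by rewrite JI Jd eqxx.
  rewrite -[leLHS]addr0 lerD ?sumr_ge0// /bad big1// => i.
  by rewrite inE => /andP[_ iI]; rewrite asboolT//; apply: JK.
have boundIJ (I J : {set 'I_m}) : #|I| = q -> J \subset I -> #|J| = d ->
    \sum_(f : {ffun 'I_m -> T}) (\prod_i w (f i)) * bad f I J <= W ^+ m * b ^+ (q - d).
  move=> Iq JI Jd.
  have cardIJ : #|I :\: J| = (q - d)%N by rewrite cardsD (setIidPr JI) Iq Jd.
  apply: le_trans (product_weight_le (b := b * W)
    (Q := fun f t => (`[< K t (meet_lexmin f J) >])%:R) t0 _ w0 _ _) _.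
  - move=> f f' ff'; rewrite /meet_lexmin.
    suff -> : (\bigcap_(i in [set` J]) K (f i) = \bigcap_(i in [set` J]) K (f' i))%classic by [].
    apply: eq_bigcapr => i iJ; rewrite ff'// !inE negb_and negbK.
    by apply/orP; left.
  - by move=> f t.
  - by move=> f; apply: hb.
  - have E : (#|~: (I :\: J)| + (q - d))%N = m by rewrite -cardIJ addnC cardsC card_ord.
    by rewrite cardIJ exprMn mulrCA [leLHS]mulrC -exprD E.
have step : P%:R * W ^+ m <= ('C(m, q) * 'C(q, d))%:R * (W ^+ m * b ^+ (q - d)).
  have -> : P%:R * W ^+ m = \sum_(f : {ffun 'I_m -> T}) (\prod_i w (f i)) * P%:R.
    by rewrite -mulr_suml product_weight_total card_ord mulrC.
  apply: (@le_trans _ _ (\sum_(f : {ffun 'I_m -> T}) \sum_(I : {set 'I_m} | #|I| == q)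
    \sum_(J : {set 'I_m} | (J \subset I) && (#|J| == d)) (\prod_i w (f i)) * bad f I J)).
    apply: ler_sum => f _; apply: le_trans (ler_wpM2l (pw0 f) (countf f)) _.
    rewrite mulr_sumr; apply: ler_sum => I _; by rewrite mulr_sumr.
  rewrite exchange_big/=.
  apply: (@le_trans _ _ (\sum_(I : {set 'I_m} | #|I| == q) 'C(q, d)%:R * (W ^+ m * b ^+ (q - d)))).
    apply: ler_sum => I /eqP Iq; rewrite exchange_big/=.
    apply: (@le_trans _ _ (\sum_(J : {set 'I_m} | (J \subset I) && (#|J| == d)) (W ^+ m * b ^+ (q - d)))).
      by apply: ler_sum => J /andP[JI /eqP Jd]; apply: boundIJ.
    rewrite (eq_bigl (fun J => J \in [set J : {set 'I_m} | J \subset I & #|J| == d])).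
      by rewrite sumr_const cards_draws Iq mulr_natl.
    by move=> J; rewrite inE.
  rewrite (eq_bigl (fun I => I \in [set I : {set 'I_m} | #|I| == q])).
    by rewrite sumr_const card_draws card_ord natrM -mulrA [leRHS]mulr_natl.
  by move=> J; rewrite inE.
have Wm : 0 < W ^+ m by rewrite exprn_gt0.
by rewrite (mulrC (W ^+ m)) mulrA ler_pM2r in step.
Qed.

End Fractional.

(** * Multiplicative weights *)

(** [X] is a sequence because multiplicative weights may choose a point repeatedly. *)
Definition weak_net (R : realType) d (e : R) (N : nat) :=
  forall X : seq 'rV[R]_d, (0 < size X)%N ->
  exists2 Y : seq 'rV[R]_d, (size Y <= N)%N &
    forall C : set 'rV[R]_d, cvx C ->
      e * (size X)%:R <= (count (fun x => `[< C x >]) X)%:R ->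
      exists2 y, y \in Y & C y.

Lemma bernoulli (R : realFieldType) (x : R) n : 0 <= x -> 1 + n%:R * x <= (1 + x) ^+ n.
Proof.
move=> x0; elim: n => [|n IH]; first by rewrite mul0r addr0.
rewrite exprSr; apply: (@le_trans _ _ ((1 + n%:R * x) * (1 + x))).
  rewrite -natr1; have : 0 <= n%:R * x * x by rewrite !mulr_ge0.
  lra.
by rewrite ler_wpM2r// addr_ge0.
Qed.

Lemma one_sub_inv_exp (R : realFieldType) k : (0 < k)%N ->
  (1 - k%:R^-1) ^+ k <= 2^-1 :> R.
Proof.
case: k => [//|[|k _]]; first by rewrite expr1 invr1 subrr invr_ge0 ler0n.
have k0 : 0 < k.+1%:R :> R by rewrite ltr0n.
have -> : 1 - k.+2%:R^-1 = (1 + k.+1%:R^-1)^-1 :> R.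
  have -> : k.+2%:R = k.+1%:R + 1 :> R by rewrite natr1.
  move: (_%:R) k0 => a a0; have a1 : 0 < a + 1 by rewrite addr_gt0.
  by field; rewrite !gt_eqF// addrC.
rewrite exprVn lef_pV2 ?posrE ?exprn_gt0 ?addr_gt0 ?invr_gt0//.
have i0 : 0 < k.+1%:R^-1 :> R by rewrite invr_gt0.
apply: le_trans (bernoulli k.+2 (ltW i0)).
rewrite -(@natr1 _ k.+1) mulrDl mul1r mulfV ?gt_eqF//.
by move: (_^-1) i0 => a a0; lra.
Qed.

Section MultiplicativeWeights.
Context (R : realType) (d : nat) (T : finType) (K : T -> set 'rV[R]_d) (B : nat).
Hypothesis B0 : (0 < B)%N.
Hypothesis heavy_point : forall w : T -> R, (forall t, 0 <= w t) ->
  0 < \sum_t w t ->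
  exists x, \sum_t w t <= B%:R * \sum_t w t * (`[< K t x >])%:R.

Let hits (X : seq 'rV[R]_d) t := count (fun x => `[< K t x >]) X.

(* A point of weight at least [W / B] is added at each step, and the sets it hits have their weight
   halved. *)
Lemma potential_decrease n : exists2 X : seq 'rV[R]_d, size X = n &
  \sum_t 2^-1 ^+ hits X t <= #|T|%:R * (1 - (2 * B)%:R^-1) ^+ n :> R.
Proof.
elim: n => [|n [X <- IH]].
  exists [::] => //; rewrite expr0 mulr1.
  rewrite (eq_bigr (fun=> 1)) ?sumr_const ?cardT ?cardE//.
have [/eqP T0|T0] := boolP (#|T| == 0%N).
  exists (0 :: X) => //; rewrite T0 mul0r big_pred0// => t.
  by have := card0_eq T0 t.
have h0 t : 0 < 2^-1 ^+ hits X t :> R by rewrite exprn_gt0 ?invr_gt0.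
have [t1 _] : exists t1 : T, true.
  by have /existsP[t1 _] : [exists t : T, true]; [apply/existsP; move: T0; rewrite -lt0n => /card_gt0P[t _]; exists t|exists t1].
have [t||x hx] := heavy_point (w := fun t => 2^-1 ^+ hits X t); first exact: ltW.
  rewrite (bigD1 t1)//= ltr_wpDr//; apply: sumr_ge0 => t _; exact: ltW.
exists (x :: X) => //; rewrite exprSr mulrA.
have B0' : 0 < B%:R :> R by rewrite ltr0n.
have c0 : 0 <= 1 - (2 * B)%:R^-1 :> R.
  rewrite subr_ge0 invf_le1 ?ler1n ?ltr0n; lia.
apply: (le_trans _ (ler_wpM2r c0 IH)).
rewrite mulr_suml (eq_bigr (fun t => 2^-1 ^+ hits X t - 2^-1 * (2^-1 ^+ hits X t * (`[< K t x >])%:R))); last first.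
  by move=> t _; rewrite /hits/= exprD -/(hits X t); move: (2^-1 ^+ hits X t) => a; case: asbool; rewrite /= ?expr1 ?expr0; lra.
rewrite sumrB -mulr_sumr -mulr_suml mulrBr mulr1 lerD2l lerN2.
rewrite natrM invfM mulrCA ler_wpM2l ?invr_ge0//.
by rewrite ler_pdivrMr// mulrC.
Qed.

Lemma fractional_packing : exists2 X : seq 'rV[R]_d, (0 < size X)%N &
  forall t, (size X <= 4 * B * hits X t)%N.
Proof.
(* Each block of [2 B] steps at least halves the potential, so after [2 c] blocks it is at most
   [#|T| * 2^(-2c)], less than [2^(-c)]. Every set is then hit at least [c] times by the [4 B c]
   points. *)
pose c := #|T|.+1; have [X sX hX] := potential_decrease (2 * B * (2 * c)).
exists X => [|t]; first by rewrite sX /c; lia.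
rewrite sX; suff : (c <= hits X t)%N by move=> h; have := leq_mul (leqnn (4 * B)%N) h; lia.
have : 2^-1 ^+ hits X t <= #|T|%:R * 2^-1 ^+ (2 * c) :> R.
  apply: (le_trans (le_trans _ hX)).
    by rewrite (bigD1 t)//= lerDl; apply: sumr_ge0 => s _; rewrite exprn_ge0 ?invr_ge0.
  rewrite exprM ler_wpM2l// lerXn2r ?nnegrE ?exprn_ge0 ?invr_ge0//.
    by rewrite subr_ge0 invf_le1 ?ler1n ?ltr0n; lia.
  by apply: one_sub_inv_exp; lia.
rewrite !exprVn ler_pdivlMr ?exprn_gt0// mulrC -ler_pdivlMr ?invr_gt0 ?exprn_gt0// invrK.
rewrite -!natrX -natrM ler_nat => h.
have : (2 ^ (2 * c) < 2 ^ (c + hits X t))%N.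
  apply: leq_ltn_trans h _; rewrite expnD ltn_pmul2r ?expn_gt0//.
  exact: leq_trans (ltn_expl _ (ltnSn 1)) (leq_pexp2l _ (leqnSn _)).
by rewrite ltn_exp2l//; lia.
Qed.

Lemma finite_transversal N : weak_net d ((4 * B)%:R^-1 : R) N -> (forall t, cvx (K t)) ->
  exists2 Y : seq 'rV[R]_d, (size Y <= N)%N & forall t, exists2 y, y \in Y & K t y.
Proof.
move=> net Kc; have [X X0 hX] := fractional_packing.
have [Y YN hY] := net X X0; exists Y => // t; apply: hY => //.
rewrite mulrC ler_pdivrMr ?ltr0n; last by lia.
by rewrite -natrM ler_nat mulnC hX.
Qed.

End MultiplicativeWeights.

(** * Point location in hyperplane arrangements *)

Lemma small_scale (R : realFieldType) (I : finType) (f g : I -> R) :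
  (forall i, 0 < f i) -> exists2 e, 0 < e & forall i, e * g i <= f i.
Proof.
move=> f0; pose s := 1 + \sum_i `|g i| / f i.
have h0 i : 0 <= `|g i| / f i by rewrite divr_ge0// ltW.
have s0 : 0 < s by rewrite ltr_pwDl// sumr_ge0.
exists s^-1; rewrite ?invr_gt0// => i; rewrite mulrC ler_pdivrMr//.
apply: le_trans (ler_norm _) _; rewrite mulrC -ler_pdivrMr//.
rewrite /s (bigD1 i)//= addrCA lerDl addr_ge0//.
by apply: sumr_ge0.
Qed.

Lemma ohead_filter_sub (T : Type) (P Q : pred T) (s : seq T) x :
  {in Q, forall y, P y} -> ohead (filter P s) = Some x -> Q x ->
  ohead (filter Q s) = Some x.
Proof.
move=> QP; elim: s => //= y s IH; case: ifPn => [Py /= [<-] ->//|nP /IH h Qx].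
by case: ifPn => [Qy|_]; [rewrite QP in nP|apply: h].
Qed.

(** Ties between gates are broken by [pick], and they must be broken in the same way after faces are
    deleted. *)
Lemma pick_sub (T : finType) (P Q : pred T) x :
  (forall y, Q y -> P y) -> [pick y | P y] = Some x -> Q x -> [pick y | Q y] = Some x.
Proof. move=> QP; exact: ohead_filter_sub. Qed.

Definition sgnd (R : pzRingType) (s : bool) (r : R) := if s then - r else r.

Lemma sgndM (R : pzRingType) s (r t : R) : sgnd s (r * t) = r * sgnd s t.
Proof. by case: s; rewrite /sgnd ?mulrN. Qed.

Lemma sgndD (R : pzRingType) s (r t : R) : sgnd s (r + t) = sgnd s r + sgnd s t.
Proof. by case: s; rewrite /sgnd ?opprD. Qed.

Lemma continuous_dot (R : realType) m (a : 'rV[R]_m) : continuous (dot a : 'rV[R]_m -> R).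
Proof.
apply: (@continuous_big R 'I_m +%R 0 xpredT _ _ _ (fun i (y : 'rV[R]_m) => a 0 i * y 0 i)).
  exact: add_continuous.
move=> i _ x; apply: (@continuousM R 'rV[R]_m (fun=> a 0 i) (fun y => y 0 i) x).
  exact: cst_continuous.
exact: coord_continuous.
Qed.

(* The ray from the lexicographic minimum [v] of the cell of [x] through [x] leaves the cell at a
   gate, and the walk continues from the exit point inside the hyperplane of the gate: [x] is a convex
   combination of the successive minima.  The constraints in [Bx] bound a box, so that cells are
   compact. *)
Section Location.
Context (R : realType) (m : nat) (I : finType) (a : I -> 'rV[R]_m) (b : I -> R).
Context (Bx : {set I}) (M : R).

Definition affv i (y : 'rV[R]_m) := dot (a i) y + b i.

Hypothesis M0 : 0 <= M.
Hypothesis box : forall y, (forall i, i \in Bx -> 0 <= affv i y) ->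
  forall j, `|y 0 j| <= M.

Implicit Types (S G : {set I}) (s : I -> bool) (x y v : 'rV[R]_m).

Definition cell S s G : set 'rV[R]_m :=
  [set y | (forall i, i \in S -> 0 <= sgnd (s i) (affv i y)) /\
           (forall i, i \in G -> affv i y = 0)]%classic.

Definition decr s v x i := sgnd (s i) (affv i x) < sgnd (s i) (affv i v).

(** The zero of [affv i] on the line that is at [v] at time 0 and at [x] at time 1. *)
Definition exit_time v x i := affv i v / (affv i v - affv i x).

Definition exit_gate S s v x := [pick i | [&& i \in S, decr s v x i &
  [forall j, (j \in S) && decr s v x j ==> (exit_time v x i <= exit_time v x j)]]].

Definition exit_point v x i := v + exit_time v x i *: (x - v).

Fixpoint gates k S s G x : seq I :=
  if k is k'.+1 then
    let v := lexmin (cell S s G) in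
    if x == v then [::]
    else if exit_gate S s v x is Some g then g :: gates k' S s (g |: G) (exit_point v x g)
    else [::]
  else [::].

(** Computed from signs and gates without [x], so that points with the same signs and gates share a
    simplex. *)
Fixpoint vertices S s G (gs : seq I) : seq 'rV[R]_m :=
  lexmin (cell S s G) ::
  if gs is g :: gs' then vertices S s (g |: G) gs' else [::].

Lemma affv_line i v x t : affv i (v + t *: (x - v)) = affv i v + t * (affv i x - affv i v).
Proof. by rewrite /affv dotDr dotZr dotBr; ring. Qed.

Lemma cell_compact S s G : Bx \subset S -> (forall i, i \in Bx -> s i = false) ->
  compact (cell S s G).
Proof.
move=> BS sB; apply: bounded_closed_compact.
  exists M; split; first exact: num_real.
  move=> M' MM' y [yS _]; apply/ltW; apply: le_lt_trans MM'.
  have hy j : `|y 0 j| <= M.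
    apply: box => i iB; have := yS i (subsetP BS _ iB).
    by rewrite /sgnd sB.
  rewrite [leLHS]/Num.norm/=; have [->//|/mx_norm_neq0[j ->]] := eqVneq (mx_norm y) 0.
  by rewrite ord1 hy.
have cl i (D : set R) : topology_structure.closed D -> topology_structure.closed (affv i @^-1` D)%classic.
  move=> cD; apply: preimage_closed => // y _.
  apply: (@continuousD R R 'rV[R]_m (dot (a i)) (fun=> b i) y).
    exact: continuous_dot.
  exact: cst_continuous.
rewrite (_ : cell S s G = (\bigcap_(i in [set` S]) (affv i @^-1` [set r | 0 <= sgnd (s i) r]) `&`
   \bigcap_(i in [set` G]) (affv i @^-1` [set 0]))%classic); last first.
  by [].
apply: closedI; apply: closed_bigI => i _; apply: cl.
  case: (s i); rewrite /sgnd/=.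
    rewrite (_ : [set r | _]%classic = [set r | r <= 0]%classic); first exact: closed_le.
    by apply/seteqP; split => r /=; rewrite oppr_ge0.
  exact: closed_ge.
rewrite (_ : [set 0]%classic = [set r | r = 0 :> R]%classic)//; exact: closed_eq.
Qed.

Section Ray.
Context S s G x.
Hypotheses (BS : Bx \subset S) (sB : forall i, i \in Bx -> s i = false).
Hypothesis xC : cell S s G x.
Let v := lexmin (cell S s G).

Lemma lexmin_cell : is_lexmin (cell S s G) v.
Proof. by apply: lexmin_exists; [apply: cell_compact|exists x]. Qed.

Lemma exit_time_ge1 i : i \in S -> decr s v x i -> 1 <= exit_time v x i.
Proof.
move=> iS; have [vC _] := lexmin_cell; have := xC.1 i iS; have := vC.1 i iS.
rewrite /decr /exit_time; move: (affv i v) (affv i x) => p r.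
case: (s i); rewrite /sgnd => h1 h2 h3.
  by rewrite ler_ndivlMr ?mul1r; lra.
by rewrite ler_pdivlMr ?mul1r; lra.
Qed.

Lemma exit_gate_exists : x != v -> exists g, exit_gate S s v x = Some g.
Proof.
move=> xv; rewrite /exit_gate; case: pickP => [g _|nopick]; first by exists g.
exfalso.
have nodecr i : i \in S -> ~~ decr s v x i.
  move=> iS; apply/negP => di.
  pose Pd := [pred i | (i \in S) && decr s v x i].
  have Pi : Pd i by rewrite /= iS.
  case: (arg_minP (exit_time v x) Pi) => j /andP[jS dj] jmin.
  have := nopick j; rewrite jS dj/= => /negP; apply.
  by apply/forallP => l; apply/implyP => /jmin.
have [vC _] := lexmin_cell.
have ray t : 0 <= t -> forall j, `|(v + t *: (x - v)) 0 j| <= M.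
  move=> t0; apply: box => i iB; have iS := subsetP BS _ iB.
  have := nodecr _ iS; rewrite -leNgt affv_line; have := vC.1 i iS.
  rewrite /sgnd sB// => h1 h2; rewrite addr_ge0// mulr_ge0// subr_ge0//.
have [j vj] : exists j, (x - v) 0 j != 0.
  apply/existsP; apply: contraNT xv => /existsPn H; rewrite -subr_eq0; apply/eqP/rowP => j.
  by have := H j; rewrite negbK !mxE => /eqP.
have c0 : 0 < `|(x - v) 0 j| by rewrite normr_gt0.
(* Without a gate the ray never leaves the box, but at this time it has moved coordinate [j] by
   [2 M + 1], more than the width of the box. *)
have t0 : 0 <= (2 * M + 1) / `|(x - v) 0 j|.
  by apply: divr_ge0 => //; move: M0; lra.
have := ray _ t0 j; have := ray 0 (lexx 0) j; rewrite scale0r addr0.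
move: t0; set t := _ / _ => t0 h1 h2.
have : `|(t *: (x - v)) 0 j| <= 2 * M.
  have -> : (t *: (x - v)) 0 j = (v + t *: (x - v)) 0 j - v 0 j by rewrite !mxE; ring.
  apply: le_trans (ler_normB _ _) _; lra.
by rewrite mxE normrM (ger0_norm t0) divfK ?gt_eqF//; lra.
Qed.

Lemma exit_point_cell g : exit_gate S s v x = Some g ->
  [/\ g \in S, affv g v != 0, affv g (exit_point v x g) = 0 &
      cell S s (g |: G) (exit_point v x g)].
Proof.
rewrite /exit_gate; case: pickP => // g' /and3P[gS dg /forallP gmin] [E].
rewrite {g'}E in gS dg gmin *.
have [vC _] := lexmin_cell.
have neq : affv g v - affv g x != 0.
  rewrite subr_eq0; apply: contraTneq dg => E; by rewrite /decr E ltxx.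
have gx0 : affv g (exit_point v x g) = 0.
  by rewrite affv_line /exit_time; field.
have ge1 := exit_time_ge1 gS dg.
split=> //.
  move: dg (xC.1 g gS); rewrite /decr; case: (s g); rewrite /sgnd => h1 h2; lra.
split=> i; last first.
  by rewrite !inE => /predU1P[->//|iG]; rewrite affv_line vC.2// xC.2// subrr mulr0 addr0.
move=> iS; rewrite affv_line; have [di|ndi] := boolP (decr s v x i); last first.
  move: ndi (vC.1 i iS) ge1; rewrite /decr -leNgt /sgnd.
  move: (exit_time v x g) (affv i x) (affv i v) => t p r.
  case: (s i) => h1 h2 h3.
    have : 0 <= t * (r - p) by rewrite mulr_ge0; lra.
    lra.
  have : 0 <= t * (p - r) by rewrite mulr_ge0; lra.
  lra.
have := gmin i; rewrite iS di/=; move: di (vC.1 i iS).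
rewrite {2}/exit_time /decr /sgnd; move: (exit_time v x g) (affv i x) (affv i v) => t p r.
case: (s i) => h1 h2.
  by rewrite ler_ndivlMr; lra.
by rewrite ler_pdivlMr; lra.
Qed.

End Ray.

Definition normals G := (\sum_(i in G) <<a i>>)%MS.

Lemma normals_orth G u : (forall i, i \in G -> dot (a i) u = 0) ->
  (normals G <= kermx u^T)%MS.
Proof.
move=> H; apply/sumsmx_subP => i iG; rewrite genmxE; apply/sub_kermxP.
apply/matrixP => j k; rewrite !ord1 mxE [RHS]mxE -[RHS](H i iG).
by apply: eq_bigr => l _; rewrite !mxE.
Qed.

(** Inside the flat of [G], the function of a new gate goes from a nonzero value at [v] to 0 at the
    exit point, so its normal is not in the span of the earlier ones. The rank grows with each gate,
    and at full rank the cell is a single point. *)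
Lemma gates_hull k S s G x : Bx \subset S -> (forall i, i \in Bx -> s i = false) ->
  cell S s G x -> (m <= k + \rank (normals G))%N ->
  forall P : set 'rV[R]_m, cvx P ->
    (forall v, v \in vertices S s G (gates k S s G x) -> P v) -> P x.
Proof.
move=> BS sB; elim: k G x => [|k IH] G x xC rk P cP PV; have [vC vmin] := lexmin_cell BS sB xC.
  suff -> : x = lexmin (cell S s G) by apply: PV; rewrite inE eqxx.
  apply/eqP; rewrite -subr_eq0; set u := x - _.
  have ker : (normals G <= kermx u^T)%MS.
    by apply: normals_orth => i iG; rewrite dotBr; have := xC.2 i iG; have := vC.2 i iG;
      rewrite /affv; lra.
  have : row_full (kermx u^T).
    rewrite -col_leq_rank; apply: leq_trans rk _; rewrite add0n; exact: mxrankS.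
  rewrite -sub1mx sub_kermx mul1mx => /eqP/(congr1 trmx).
  by rewrite trmxK trmx0 => ->.
move: PV => /=; case: eqVneq => [->|xv] PV.
  by apply: PV; rewrite inE eqxx.
have [g gE] := exit_gate_exists BS sB xC xv.
rewrite gE in PV.
have [gS gv gx x'C] := exit_point_cell BS sB xC gE.
have Px' : P (exit_point (lexmin (cell S s G)) x g).
  apply: (IH (g |: G)) => //; last by move=> v vV; apply: PV; rewrite inE vV orbT.
  apply: leq_trans rk _; rewrite addSnnS leq_add2l.
  have sub : (normals G <= normals (g |: G))%MS.
    by apply/sumsmx_subP => i iG; apply: (sumsmx_sup i); rewrite ?inE ?iG ?orbT.
  rewrite ltnNge; apply/negP => rle.
  have := mxrank_leqif_sup sub; rewrite /leqif => -[_ h].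
  have eqr : \rank (normals G) == \rank (normals (g |: G)).
    by rewrite eqn_leq mxrankS.
  rewrite h in eqr.
  pose u := exit_point (lexmin (cell S s G)) x g - lexmin (cell S s G).
  have ker : (normals G <= kermx u^T)%MS.
    apply: normals_orth => i iG; rewrite dotBr; have := x'C.2 i (setU1r _ iG).
    by have := vC.2 i iG; rewrite /affv; lra.
  have : (a g <= kermx u^T)%MS.
    apply: submx_trans ker; apply: submx_trans eqr.
    by apply: (sumsmx_sup g); rewrite ?inE ?eqxx// genmxE.
  move=> /sub_kermxP/matrixP/(_ 0 0); rewrite mxE [RHS]mxE => E.
  have : dot (a g) u = 0 by rewrite -[RHS]E; apply: eq_bigr => i _; rewrite !mxE.
  rewrite dotBr => E2; move/eqP: gv; apply; move: gx; rewrite /affv; lra.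
have t1 := exit_time_ge1 BS sB xC gS.
have dg : decr s (lexmin (cell S s G)) x g.
  by move: gE; rewrite /exit_gate; case: pickP => // g' /and3P[_ + _] [<-].
have {}t1 := t1 dg.
have t0 : 0 < exit_time (lexmin (cell S s G)) x g by apply: lt_le_trans t1.
set v := lexmin _ in Px' t0 t1 PV *; set t := exit_time v x g in t0 t1.
have -> : x = t^-1 *: exit_point v x g + (1 - t^-1) *: v.
  apply/rowP => j; rewrite !mxE -/t; move: (x 0 j) (v 0 j) => p r.
  by field; rewrite gt_eqF.
apply: cP => //; last by apply: PV; rewrite inE eqxx.
by rewrite invr_ge0 ltW//= invf_le1.
Qed.

Lemma vertices_cell k S s G x : Bx \subset S -> (forall i, i \in Bx -> s i = false) ->
  cell S s G x -> forall v, v \in vertices S s G (gates k S s G x) ->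
  forall i, i \in S -> 0 <= sgnd (s i) (affv i v).
Proof.
move=> BS sB; elim: k G x => [|k IH] G x xC v; have [vC vmin] := lexmin_cell BS sB xC.
  by rewrite inE => /eqP-> i; apply: vC.1.
rewrite /=; case: eqVneq => xv; first by rewrite inE => /eqP-> i; apply: vC.1.
have [g gE] := exit_gate_exists BS sB xC xv.
have [gS gv gx x'C] := exit_point_cell BS sB xC gE.
by rewrite gE inE => /predU1P[->|]; [exact: vC.1|exact: IH].
Qed.

Lemma size_gates k S s G x : (size (gates k S s G x) <= k)%N.
Proof.
elim: k G x => //= k IH G x; case: eqVneq => // xv.
by case: exit_gate => //= g; rewrite ltnS.
Qed.

Lemma size_vertices S s G gs : size (vertices S s G gs) = (size gs).+1.
Proof. by elim: gs G => //= g gs IH G; rewrite IH. Qed.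

(** The equations [G] enter Helly's theorem as one convex set [None], so that the basis consists of
    inequalities. *)
Lemma cell_lexmin_basis S s G x : Bx \subset S -> (forall i, i \in Bx -> s i = false) ->
  cell S s G x -> exists B : {set I}, [/\ B \subset S, (#|B| <= m)%N &
   forall S', B \subset S' -> S' \subset S ->
     lexmin (cell S' s G) = lexmin (cell S s G)].
Proof.
move=> BS sB xC; have [vC vmin] := lexmin_cell BS sB xC; set v := lexmin _ in vC vmin *.
pose K (o : option I) : set 'rV[R]_m := if o is Some i
  then [set y | 0 <= sgnd (s i) (affv i y)]%classic
  else [set y | forall i, i \in G -> affv i y = 0]%classic.
pose A := None |: (Some @: S).
have sA i : (Some i \in A) = (i \in S) by rewrite !inE/= mem_imset// => ? ? [].
have KC y : (forall o, o \in A -> K o y) -> cell S s G y.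
  move=> H; split=> [i iS|]; first by apply: (H (Some i)); rewrite sA.
  by apply: (H None); rewrite !inE.
have [|||B [BA Bm Bmin]] := @lexmin_basis _ m _ A K v.
- move=> o _ y z t t01 yK zK; have E i : affv i (t *: y + (1 - t) *: z) =
    t * affv i y + (1 - t) * affv i z by rewrite /affv dotDr !dotZr; ring.
  move: yK zK; case: o => [i|] /= yK zK; last first.
    by move=> i iG; rewrite E yK// zK// !mulr0 addr0.
  by case/andP: t01 => t0 t1; rewrite E sgndD !sgndM addr_ge0// mulr_ge0// subr_ge0.
- by case=> [i|] iA; [apply: vC.1; rewrite -sA|exact: vC.2].
- by move=> z /KC; apply: vmin.
exists [set i | Some i \in B]; split.
- by apply/subsetP => i; rewrite inE -sA => /(subsetP BA).
- apply: leq_trans Bm; have Sinj : injective (@Some I) by move=> ? ? [].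
  rewrite -(card_imset _ Sinj); apply/subset_leq_card/subsetP => _ /imsetP[i + ->].
  by rewrite inE.
- move=> S' BS' S'S; apply: lexminE; split.
    by split=> [i /(subsetP S'S)|]; [exact: vC.1|exact: vC.2].
  move=> z [zS zG]; apply: Bmin => -[i iB|_]; last exact: zG.
  by apply: zS; apply: (subsetP BS'); rewrite inE.
Qed.

(** Each of the [k + 1] stages depends on at most [m] faces fixing the minimum and on one gate,
    which keeps the least exit time when other faces are deleted. *)
Lemma gates_basis k S s G x : Bx \subset S -> (forall i, i \in Bx -> s i = false) ->
  cell S s G x -> exists B : {set I}, [/\ B \subset S, (#|B| <= k.+1 * m.+1)%N &
   forall S', B \subset S' -> S' \subset S ->
     gates k S' s G x = gates k S s G x /\
     vertices S' s G (gates k S s G x) = vertices S s G (gates k S s G x)].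
Proof.
move=> BS sB; elim: k G x => [|k IH] G x xC; have [Bv [BvS Bvm BvE]] := cell_lexmin_basis BS sB xC.
  exists Bv; split=> //; first by rewrite mul1n ltnW.
  by move=> S' BS' S'S; rewrite /= BvE.
set v := lexmin (cell S s G) in BvE; rewrite /= -/v.
case: eqVneq => [xv|xv].
  exists Bv; split=> //; first by apply: (leq_trans Bvm); rewrite mulSn; lia.
  by move=> S' BS' S'S; rewrite /= BvE// xv eqxx.
have [g gE] := exit_gate_exists BS sB xC xv.
have [gS gv gx x'C] := exit_point_cell BS sB xC gE.
rewrite gE; have [B [BS1 Bm BE]] := IH _ _ x'C.
exists (Bv :|: (g |: B)); split.
- by rewrite !subUset BvS BS1 sub1set gS.
- rewrite [X in (_ <= X)%N]mulSn; apply: (leq_trans (leq_card_setU _ _)).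
  by rewrite addSn -addnS leq_add//; apply: (leq_trans (leq_card_setU _ _)); rewrite cards1 add1n ltnS.
move=> S'; rewrite !subUset sub1set => /and3P[BvS' gS' BS'] S'S.
have [E1 E2] := BE S' BS' S'S.
rewrite BvE//= -/v (negPf xv).
have -> : exit_gate S' s v x = Some g.
  move: gE; rewrite /exit_gate => gE; have Pg := gE.
  have {Pg} /and3P[_ dg /forallP gmin] : [&& g \in S, decr s v x g &
      [forall j, (j \in S) && decr s v x j ==> (exit_time v x g <= exit_time v x j)]].
    by move: gE; case: pickP => // g' Pg' [<-].
  apply: pick_sub gE _ => [y /and3P[yS' dy /forallP ymin]|].
    rewrite (subsetP S'S)// dy/=; apply/forallP => j; apply/implyP => hj.
    apply: (@le_trans _ _ (exit_time v x g)); last by have := gmin j; rewrite hj.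
    by have := ymin g; rewrite gS' dg.
  rewrite gS' dg/=; apply/forallP => j; apply/implyP => /andP[jS' dj].
  by have := gmin j; rewrite dj (subsetP S'S).
by rewrite E1; split=> //; rewrite E2 BvE.
Qed.

Lemma gates_end k S s G x : Bx \subset S -> (forall i, i \in Bx -> s i = false) ->
  G \subset S -> cell S s G x -> exists y, cell S s (G :|: [set i in gates k S s G x]) y /\
    {subset gates k S s G x <= S}.
Proof.
move=> BS sB; elim: k G x => [|k IH] G x GS xC.
  by exists x; split=> //; rewrite (_ : [set i in _] = set0) ?setU0//; apply/setP => i; rewrite !inE.
rewrite /=; case: eqVneq => [xv|xv].
  by exists x; split=> //; rewrite (_ : [set i in _] = set0) ?setU0//; apply/setP => i; rewrite !inE.
have [g gE] := exit_gate_exists BS sB xC xv.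
have [gS gv gx x'C] := exit_point_cell BS sB xC gE.
rewrite gE; have [|y [yC sub]] := IH _ _ _ x'C.
  by rewrite subUset sub1set gS.
exists y; split.
  rewrite (_ : _ :|: _ = g |: G :|: [set i in gates k S s (g |: G) (exit_point (lexmin (cell S s G)) x g)])//.
  by apply/setP => i; rewrite !inE; do !case: (_ == _); do !case: (i \in _).
by move=> i; rewrite inE => /predU1P[->//|/sub].
Qed.

Lemma gates_uniq k S s G x : Bx \subset S -> (forall i, i \in Bx -> s i = false) ->
  cell S s G x -> uniq (gates k S s G x) /\
    forall g, g \in gates k S s G x -> g \notin G.
Proof.
move=> BS sB; elim: k G x => [|k IH] G x xC //=.
case: eqVneq => [//|xv].
have [g gE] := exit_gate_exists BS sB xC xv.
have [gS gv gx x'C] := exit_point_cell BS sB xC gE.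
rewrite gE; have [un nG] := IH _ _ x'C; split=> /=.
  by rewrite un andbT; apply/negP => /nG; rewrite !inE eqxx.
move=> i; rewrite inE => /predU1P[->|/nG]; last by rewrite !inE negb_or => /andP[].
by apply: contra gv => gG; have [vC _] := lexmin_cell BS sB xC; rewrite vC.2.
Qed.

(** Otherwise small steps from [v] along [y - v] and against it both stay in the cell, and one of
    them leads to a lexicographically smaller point. *)
Lemma lexmin_unique_zero S s G v y : is_lexmin (cell S s G) v ->
  (forall i, i \in S -> affv i v = 0 -> affv i y = 0) ->
  (forall i, i \in G -> affv i y = 0) -> y = v.
Proof.
move=> [[vS vG] vmin] yS yG; apply/eqP; rewrite -subr_eq0; apply/negP => /negP u0.
set u := y - v in u0.
have uz i : affv i v = 0 -> affv i y = 0 -> dot (a i) u = 0.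
  by rewrite dotBr /affv => h1 h2; lra.
pose f i := if affv i v == 0 then 1 else `|affv i v|.
have f0 i : 0 < f i by rewrite /f; case: ifPn => // iv; rewrite normr_gt0.
have [e e0 he] := small_scale (fun i => `|dot (a i) u|) f0.
have near (t : R) : `|t| = e -> cell S s G (v + t *: u).
  move=> te; have E i : affv i (v + t *: u) = affv i v + t * dot (a i) u.
    by rewrite /affv dotDr dotZr; ring.
  split=> [i iS|i iG]; rewrite E; last by rewrite vG// uz ?vG ?yG// mulr0 addr0.
  have := vS i iS; have := he i; rewrite /f; case: eqP => [z _ _|_].
    by rewrite z (uz i z) ?yS// mulr0 addr0 /sgnd oppr0; case: (s i).
  rewrite -te -normrM; have := ler_norm (t * dot (a i) u).
  have := ler_norm (- (t * dot (a i) u)); rewrite normrN.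
  rewrite /sgnd; case: (s i) => h1 h2 h3 h4.
    have h5 : `|affv i v| = - affv i v by rewrite ler0_norm//; lra.
    by rewrite h5 in h3; lra.
  by rewrite (ger0_norm h4) in h3; lra.
have [l|l] := ltlex_opp v u0.
  by apply: (vmin (v + e *: u)); [apply: near; rewrite gtr0_norm|apply: ltlex_seg].
apply: (vmin (v + (- e) *: u)); first by apply: near; rewrite normrN gtr0_norm.
by rewrite scaleNr -scalerN; apply: ltlex_seg.
Qed.

Definition tight S v := [set i in S | affv i v == 0].

Lemma signs_determined S s s' G v v' : G \subset S ->
  is_lexmin (cell S s G) v -> is_lexmin (cell S s' G) v' ->
  tight S v = tight S v' -> (forall i, i \in tight S v -> s i = s' i) ->
  forall i, i \in S -> s i = s' i.
Proof.
move=> GS vL v'L ZE sZ.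
have vv' : v' = v.
  apply: (lexmin_unique_zero vL) => i iS.
    move=> iv; have : i \in tight S v by rewrite inE iS iv eqxx.
    by rewrite ZE inE => /andP[_ /eqP].
  by apply: v'L.1.2.
move=> i iS; have [/eqP z|nz] := boolP (affv i v == 0).
  by apply: sZ; rewrite inE iS z eqxx.
have := vL.1.1 i iS; have := v'L.1.1 i iS; rewrite vv' /sgnd.
by case: (s i); case: (s' i) => // h1 h2; exfalso; move/eqP: nz; apply; lra.
Qed.

Lemma vertices_ext S s s' G gs : (forall i, i \in S -> s i = s' i) ->
  vertices S s G gs = vertices S s' G gs.
Proof.
move=> E; have cE G' : cell S s G' = cell S s' G'.
  apply/seteqP; split=> y [yS yG]; split=> // i iS; first by rewrite -E// yS.
  by rewrite E// yS.
by elim: gs G => [|g gs IH] G /=; rewrite cE ?IH.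
Qed.

End Location.

(** * Random sampling *)

Lemma pigeonhole_fiber (T L : finType) (U : {set T}) (lab : T -> L) (A : {set L}) :
  (forall u, u \in U -> lab u \in A) -> (0 < #|U|)%N ->
  exists2 u0, u0 \in U & (#|U| <= #|A| * #|[set u in U | lab u == lab u0]|)%N.
Proof.
move=> UA U0; apply: contrapT => H.
have lt u0 : u0 \in U -> (#|A| * #|[set u in U | lab u == lab u0]| < #|U|)%N.
  by move=> u0U; rewrite ltnNge; apply/negP => h; apply: H; exists u0.
have : (#|A| * #|U| < #|A| * #|U|)%N.
  rewrite {1}[X in (_ * X < _)%N](_ : _ = \sum_(l in A) #|[set u in U | lab u == l]|)%N; last first.
    rewrite -sum1_card (partition_big lab (mem A))//=; apply: eq_bigr => l _.
    by rewrite -sum1_card; apply: eq_bigl => u; rewrite inE.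
  have A0 : (0 < #|A|)%N.
    by case/card_gt0P: U0 => u uU; apply/card_gt0P; exists (lab u); apply: UA.
  rewrite big_distrr/= -sum_nat_const.
  have [l0 l0A] : exists l0, l0 \in A by apply/card_gt0P.
  have le l : l \in A -> (#|A| * #|[set u in U | lab u == l]| < #|U|)%N.
    move=> lA; have [E|/card_gt0P[u]] := posnP #|[set u in U | lab u == l]|.
      by rewrite E muln0.
    by rewrite inE => /andP[uU /eqP ul]; have := lt u uU; rewrite ul.
  rewrite (bigD1 l0)//= [X in (_ < X)%N](bigD1 l0)//=.
  by rewrite -addSn leq_add ?le//; apply: leq_sum => l /andP[/le/ltnW].
by rewrite ltnn.
Qed.

Lemma pmap_nth_Some (T : Type) (l : seq T) m : (size l <= m)%N ->
  pmap id (mkseq (fun k => nth None (map Some l) k) m) = l.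
Proof.
elim: l m => [|x l IH] [|m]//=.
  by move=> _; rewrite /mkseq; elim: (iota _ _) => //= k s ->; rewrite nth_nil.
rewrite ltnS => /IH {2}<-; congr cons; rewrite /mkseq -[in iota 1 m]addn1 addnC iotaDl.
by rewrite -map_comp.
Qed.

Lemma leq_exp_base m n e : (m <= n)%N -> (m ^ e <= n ^ e)%N.
Proof. by case: e => [//|e] mn; rewrite leq_exp2r. Qed.

Section Sampling.
Context (R : realType) (m : nat) (H : finType) (a : H -> 'rV[R]_m) (b : H -> R) (M : R).
Hypothesis M0 : 0 <= M.

Definition boxed (y : 'rV[R]_m) := forall j, `|y 0 j| <= M.

Definition faceidx : finType := (H + 'I_m * bool)%type.

Definition fnormal (i : faceidx) : 'rV[R]_m := match i with
  | inl h => a h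
  | inr (j, e) => if e then delta_mx 0 j else - delta_mx 0 j end.

Definition foffset (i : faceidx) : R := if i is inl h then b h else M.

Definition boxfaces : {set faceidx} := [set i | if i is inr _ then true else false].

Definition faces (Q : {set H}) : {set faceidx} :=
  [set i : faceidx | if i is inl h then h \in Q else true].

Notation aff := (affv fnormal foffset).

Definition affh h y := dot (a h) y + b h.

Lemma aff_box j e y : aff (inr (j, e)) y = (if e then y 0 j else - y 0 j) + M.
Proof. by rewrite /affv /= dotC; case: e; rewrite ?dotNr dot_delta. Qed.

Lemma boxedP y : boxed y <-> (forall i, i \in boxfaces -> 0 <= aff i y).
Proof.
split=> [yB [h|[j e]]|H0 j].
- by rewrite inE.
- by move=> _; rewrite aff_box; have := yB j; rewrite ler_norml; case: e; lra.
- have := H0 (inr (j, true)); have := H0 (inr (j, false)); rewrite !inE !aff_box ler_norml.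
  by move=> /(_ isT) h1 /(_ isT) h2; lra.
Qed.

Let box y : (forall i, i \in boxfaces -> 0 <= aff i y) -> forall j, `|y 0 j| <= M.
Proof. by move/boxedP. Qed.

Lemma boxfaces_sub Q : boxfaces \subset faces Q.
Proof. by apply/subsetP => -[h|z]; rewrite !inE. Qed.

Definition sgnv y i := aff i y < 0.

Lemma sgnv_box y : boxed y -> forall i, i \in boxfaces -> sgnv y i = false.
Proof. by move=> /boxedP H0 i /H0; rewrite /sgnv leNgt => /negbTE. Qed.

Lemma sgnv_cell y S : cell fnormal foffset S (sgnv y) set0 y.
Proof.
split=> i; last by rewrite inE.
by move=> _; rewrite /sgnd /sgnv; case: ltP => // h; rewrite oppr_ge0 ltW.
Qed.

Definition gatesv (Q : {set H}) y := gates fnormal foffset m (faces Q) (sgnv y) set0 y.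

(* The simplex of the bottom-vertex triangulation of the arrangement of [Q] that contains [y]. *)
Definition simplexv Q y := vertices fnormal foffset (faces Q) (sgnv y) set0 (gatesv Q y).

Definition crossv h (vs : seq 'rV[R]_m) :=
  has (fun v => 0 < affh h v) vs && has (fun v => affh h v < 0) vs.

Lemma size_simplexv Q y : (size (simplexv Q y) <= m.+1)%N.
Proof. by rewrite size_vertices ltnS size_gates. Qed.

Lemma simplexv_hull Q y (P : set 'rV[R]_m) : boxed y -> cvx P ->
  (forall v, v \in simplexv Q y -> P v) -> P y.
Proof.
move=> yB cP PV.
apply: (gates_hull M0 box (boxfaces_sub Q) (sgnv_box yB) (sgnv_cell y _)) cP PV.
exact: leq_addr.
Qed.

Lemma simplexv_uncrossed (Q : {set H}) y h : boxed y -> h \in Q -> ~~ crossv h (simplexv Q y).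
Proof.
move=> yB hQ; have H0 := vertices_cell M0 box (boxfaces_sub Q) (sgnv_box yB) (sgnv_cell y _).
apply/negP => /andP[/hasP[v vV v0] /hasP[v' v'V v'0]].
have hS : inl h \in faces Q by rewrite inE.
have := H0 _ _ vV _ hS; have := H0 _ _ v'V _ hS; rewrite /sgnd.
rewrite /affv/= -/(affh h v) -/(affh h v'); case: sgnv; lra.
Qed.

Lemma simplexv_basis (Q : {set H}) y : boxed y -> exists B : {set H},
  [/\ B \subset Q, (#|B| <= m.+1 * m.+1)%N &
    forall Q' : {set H}, B \subset Q' -> Q' \subset Q -> simplexv Q' y = simplexv Q y].
Proof.
move=> yB.
have [B [BS Bm BE]] := gates_basis M0 box m (boxfaces_sub Q) (sgnv_box yB) (sgnv_cell y _).
exists [set h | inl h \in B]; split.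
- by apply/subsetP => h; rewrite inE => /(subsetP BS); rewrite inE.
- apply: leq_trans Bm; have inj : injective (@inl H ('I_m * bool)) by move=> ? ? [].
  rewrite -(card_imset _ inj); apply/subset_leq_card/subsetP => _ /imsetP[h + ->].
  by rewrite inE.
move=> Q' BQ' Q'Q; have [||E1 E2] := BE (faces Q').
- apply/subsetP => -[h|z] iB; rewrite inE//.
  by apply: (subsetP BQ'); rewrite inE.
- by apply/subsetP => -[h|z]; rewrite !inE//; apply: (subsetP Q'Q).
by rewrite /simplexv /gatesv E1 E2.
Qed.

(** A critical [f i] lies in the basis of the simplex of the full sample: otherwise deleting [i]
    keeps that simplex, which no member of the sample crosses. Its value also occurs only once in
    the sequence, so critical indices inject into the basis. *)
Lemma critical_count n (f : {ffun 'I_n -> H}) y : boxed y ->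
  (#|[set i | crossv (f i) (simplexv (f @: [set~ i]) y)]| <= m.+1 * m.+1)%N.
Proof.
move=> yB; have [B [BQ Bm BE]] := simplexv_basis (f @: [set: 'I_n]) yB.
apply: leq_trans Bm.
set C := [set i | _].
have key i : i \in C -> f i \in B /\ f i \notin f @: [set~ i].
  rewrite inE => cr.
  have sub : f @: [set~ i] \subset f @: [set: 'I_n] by apply: imsetS.
  have /subsetPn[h hB hi] : ~~ (B \subset f @: [set~ i]).
    apply/negP => Bi; move: cr; rewrite BE//; apply/negP.
    by apply: simplexv_uncrossed => //; rewrite imset_f.
  have /imsetP[j _ hj] := subsetP BQ _ hB.
  have [ji|ji] := eqVneq j i; first by subst j; rewrite -hj.
  by move/negP: hi; case; rewrite hj; apply: imset_f; rewrite !inE.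
rewrite -(card_in_imset (f := f)); last first.
  move=> i j /key[_ fi] jC E; apply/eqP; apply: contraNT fi => ij.
  by rewrite E; apply: imset_f; rewrite !inE eq_sym.
by apply/subset_leq_card/subsetP => _ /imsetP[i /key[? _] ->].
Qed.

Context (J : finType) (x : J -> 'rV[R]_m).
Hypothesis xB : forall u, boxed (x u).

Definition cross_set h (U : {set J}) :=
  [exists u in U, 0 < affh h (x u)] && [exists u in U, affh h (x u) < 0].

Lemma cross_simplex Q h (U : {set J}) vs : (forall u, u \in U -> simplexv Q (x u) = vs) ->
  cross_set h U -> crossv h vs.
Proof.
have cv (c : R) : cvx [set y | 0 <= c * affh h y]%classic.
  move=> y z t /andP[t0 t1] /= h1 h2.
  have -> : c * affh h (t *: y + (1 - t) *: z) = t * (c * affh h y) + (1 - t) * (c * affh h z).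
    by rewrite /affh dotDr !dotZr; ring.
  by rewrite addr_ge0// mulr_ge0// subr_ge0.
move=> UE /andP[/existsP[u /andP[uU pu]] /existsP[u' /andP[u'U pu']]].
apply/andP; split; apply: contraT => /hasPn nh.
  have := @simplexv_hull Q (x u) _ (xB u) (cv (-1)); rewrite (UE u uU)/= => /(_ _)/wrap[].
    by move=> v /nh; rewrite -leNgt; lra.
  by lra.
have := @simplexv_hull Q (x u') _ (xB u') (cv 1); rewrite (UE u' u'U)/= => /(_ _)/wrap[].
  by move=> v /nh; rewrite -leNgt; lra.
by lra.
Qed.

Context (w : H -> R).
Hypothesis w0 : forall h, 0 <= w h.
Hypothesis W0 : 0 < \sum_h w h.

Let W := \sum_h w h.
Let D := (m.+1 * m.+1)%N.
Definition crossweight (Q : {set H}) y := \sum_h w h * (crossv h (simplexv Q y))%:R.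

(* Clarkson: crossing the simplex of a random sample of size [t] is as likely as being critical in a
   random sequence of length [t + 1], and few members of a sequence are critical. *)
Lemma sample_exists t (U : {set J}) : (0 < #|U|)%N -> exists2 Q : {set H}, (#|Q| <= t)%N &
  t.+1%:R * \sum_(u in U) crossweight Q (x u) <= (2 * D * #|U|)%:R * W.
Proof.
move=> U0; apply: contrapT => nQ.
pose q (f : {ffun 'I_t.+1 -> H}) i h : R :=
  \sum_(u in U) (crossv h (simplexv (f @: [set~ i]) (x u)))%:R.
(* The claimed bound is twice what averaging gives; the excess makes the final contradiction
   strict. *)
pose c := (2 * D * #|U|)%:R * W / t.+1%:R.
have big_q f i : c <= \sum_h w h * q f i h.
  rewrite /c ler_pdivrMr ?ltr0n// leNgt; apply/negP => lt; apply: nQ.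
  exists (f @: [set~ i]).
    by apply: leq_trans (leq_imset_card _ _) _; rewrite cardsC1 card_ord.
  apply: ltW; apply: le_lt_trans lt; rewrite mulrC.
  rewrite ler_wpM2r// /crossweight exchange_big/=; apply: ler_sum => h _.
  by rewrite mulr_sumr.
have c0 : 0 <= c by rewrite /c divr_ge0// mulr_ge0// ltW.
have [h0 _] : exists h0 : H, true.
  have [h0|Hn] := pickP (fun _ : H => true); first by exists h0.
  by exfalso; move: W0; rewrite big1 ?ltxx// => h; have := Hn h.
have low i : W ^+ t * c <= \sum_(f : {ffun 'I_t.+1 -> H}) (\prod_i w (f i)) * q f i (f i).
  have := @product_weight_ge R 'I_t.+1 H w [set i] h0 (fun f h => q f i h) _ w0 c c0 _.
  rewrite cardsC1 card_ord cards1 expr1 => /(_ _ _)/wrap[].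
  - move=> f f' ff'; apply/funext => h; rewrite /q.
    suff -> : f @: [set~ i] = f' @: [set~ i] by [].
    by apply: eq_in_imset => j; rewrite !inE => ji; apply: ff'; rewrite inE.
  - by move=> f; apply: big_q.
  - by move/le_trans; apply; apply: ler_sum => f _; rewrite big_set1.
have up (f : {ffun 'I_t.+1 -> H}) : \sum_i q f i (f i) <= (D * #|U|)%:R.
  rewrite /q exchange_big/= natrM mulr_natr -sumr_const; apply: ler_sum => u _.
  apply: le_trans (_ : #|[set i | crossv (f i) (simplexv (f @: [set~ i]) (x u))]|%:R <= _).
    by rewrite -natr_sum ler_nat -sum1_card big_mkcond/= [leqRHS]big_mkcond/=; apply: leq_sum => i _; rewrite inE; case: crossv.
  by rewrite ler_nat; apply: critical_count.
have : t.+1%:R * (W ^+ t * c) <= W ^+ t.+1 * (D * #|U|)%:R.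
  apply: (@le_trans _ _ (\sum_(i < t.+1) \sum_(f : {ffun 'I_t.+1 -> H}) (\prod_i w (f i)) * q f i (f i))).
    rewrite -[X in X%:R](card_ord t.+1) mulr_natl -sumr_const; apply: ler_sum => i _; exact: low.
  rewrite exchange_big/= -[X in W ^+ X](card_ord t.+1) -product_weight_total mulr_suml.
  apply: ler_sum => f _; rewrite -mulr_sumr; apply: ler_wpM2l (up f).
  exact: prodr_ge0.
have t0 : 0 < t.+1%:R :> R by rewrite ltr0n.
have z0 : 0 < W * W ^+ t * (D * #|U|)%:R.
  by rewrite !mulr_gt0 ?exprn_gt0// ltr0n muln_gt0 /D/= U0.
have -> : t.+1%:R * (W ^+ t * c) = 2 * (W * W ^+ t * (D * #|U|)%:R).
  rewrite /c -mulnA natrM; move: (t.+1%:R) t0 => s s0.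
  by field; rewrite gt_eqF.
by rewrite exprS; lra.
Qed.

Hypothesis generic : forall Z : {set faceidx},
  (exists y, forall i, i \in Z -> aff i y = 0) -> (#|Z| <= m)%N.

(* In a generic arrangement at most [m] hyperplanes pass through the last vertex; these and the signs
   of [y] on them determine the simplex of [y]. *)
Definition flagv (Q : {set H}) y := let gs := gatesv Q y in
  gs ++ [seq i <- enum (tight fnormal foffset (faces Q)
     (lexmin (cell fnormal foffset (faces Q) (sgnv y) [set i in gs]))) | i \notin gs].

Definition labelcode : finType :=
  ({ffun 'I_m -> option faceidx} * 'I_m.+1 * {ffun 'I_m -> bool})%type.

Definition flagcode Q y : labelcode :=
  ([ffun k : 'I_m => nth None (map Some (flagv Q y)) k], inord (size (gatesv Q y)),
   [ffun k : 'I_m => if nth None (map Some (flagv Q y)) k is Some i then sgnv y i else false]).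

Lemma flagv_facts Q y : boxed y -> let gs := gatesv Q y in
  let v := lexmin (cell fnormal foffset (faces Q) (sgnv y) [set i in gs]) in
  [/\ is_lexmin (cell fnormal foffset (faces Q) (sgnv y) [set i in gs]) v,
      [set i in gs] \subset faces Q, flagv Q y =i tight fnormal foffset (faces Q) v &
      (size (flagv Q y) <= m)%N].
Proof.
move=> yB gs v.
have [z []] := gates_end M0 box m (boxfaces_sub Q) (sgnv_box yB) (sub0set _) (sgnv_cell y _).
rewrite set0U -/(gatesv Q y) -/gs => zC gsS.
have [un _] := gates_uniq M0 box m (boxfaces_sub Q) (sgnv_box yB) (sgnv_cell y (faces Q)).
have vL := lexmin_cell M0 box (boxfaces_sub Q) (sgnv_box yB) zC.
have gsZ i : i \in gs -> i \in tight fnormal foffset (faces Q) v.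
  move=> ig; rewrite inE gsS//=; apply/eqP; apply: vL.1.2; by rewrite inE.
have lZ : flagv Q y =i tight fnormal foffset (faces Q) v.
  move=> i; rewrite mem_cat mem_filter mem_enum -/gs -/v.
  by case: (boolP (i \in gs)) => [/gsZ->|] //=.
split=> //; first by apply/subsetP => i; rewrite inE => /gsS.
have ul : uniq (flagv Q y).
  rewrite cat_uniq un filter_uniq ?enum_uniq// andbT/=.
  by apply/hasPn => i; rewrite mem_filter => /andP[].
rewrite -(card_uniqP ul) (eq_card lZ); apply: generic; exists v => i.
by rewrite inE => /andP[_ /eqP].
Qed.

Lemma flagcode_simplex Q y z : boxed y -> boxed z -> flagcode Q y = flagcode Q z ->
  simplexv Q y = simplexv Q z.
Proof.
move=> yB zB [] /ffunP fE gE /ffunP sE.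
have [yL gyS lyZ lym] := flagv_facts Q yB; have [zL gzS lzZ lzm] := flagv_facts Q zB.
have lE : flagv Q y = flagv Q z.
  rewrite -(pmap_nth_Some lym) -(pmap_nth_Some lzm); congr pmap.
  apply/(eq_from_nth (x0 := None)); rewrite !size_mkseq// => k km.
  by rewrite !nth_mkseq//; have := fE (Ordinal km); rewrite !ffunE.
have gsE : gatesv Q y = gatesv Q z.
  have : size (gatesv Q y) = size (gatesv Q z).
    by have := congr1 (@nat_of_ord _) gE; rewrite !inordK// ltnS size_gates.
  move: lE; rewrite /flagv => lE sz.
  by have := congr1 (take (size (gatesv Q y))) lE; rewrite take_size_cat// sz take_size_cat.
rewrite /simplexv gsE; apply: vertices_ext.
rewrite -gsE in zL gzS lzZ.
have ZE : tight fnormal foffset (faces Q) (lexmin (cell fnormal foffset (faces Q) (sgnv y) [set i in gatesv Q y]))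
   = tight fnormal foffset (faces Q) (lexmin (cell fnormal foffset (faces Q) (sgnv z) [set i in gatesv Q y])).
  by apply/setP => i; rewrite -lyZ -lzZ lE.
apply: (signs_determined gyS yL zL ZE) => i; rewrite -lyZ => il.
have km : (index i (flagv Q y) < m)%N by apply: leq_trans lym; rewrite index_mem.
have := sE (Ordinal km); rewrite !ffunE /= -lE.
by rewrite (nth_map i) ?index_mem// nth_index.
Qed.

(** [m] places for a face or nothing, the number of gates, and [m] signs. The degree [m] in [t] is
    what permits samples of size proportional to an [m]-th root when classes are formed. *)
Definition label_bound t := ((t + 2 * m).+1 ^ m * (m.+1 * 2 ^ m))%N.

Lemma flagcode_card (Q : {set H}) t : (#|Q| <= t)%N -> exists2 A : {set labelcode},
  (#|A| <= label_bound t)%N & forall y, boxed y -> flagcode Q y \in A.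
Proof.
move=> Qt; pose A0 : {set option faceidx} := None |: Some @: faces Q.
exists (setX (setX [set f : {ffun 'I_m -> option faceidx} in ffun_on (mem A0)] setT) setT).
  rewrite !cardsX !cardsT card_ffun card_bool !card_ord -mulnA leq_mul//.
  rewrite cardsE card_ffun_on card_ord; apply: leq_exp_base.
  rewrite cardsU1 (leq_trans (leq_add (leq_b1 _) (leq_imset_card _ _)))// add1n ltnS.
  have sub : faces Q \subset (inl @: Q) :|: boxfaces.
    apply/subsetP => -[h|z]; rewrite !inE ?orbT// => hQ.
    by rewrite imset_f.
  apply: leq_trans (subset_leq_card sub) _; apply: leq_trans (leq_card_setU _ _) _.
  rewrite leq_add ?(leq_trans (leq_imset_card _ _))//.
  have sub2 : boxfaces \subset inr @: [set: 'I_m * bool].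
    by apply/subsetP => -[h|z]; rewrite !inE// => _; rewrite imset_f ?inE.
  apply: leq_trans (subset_leq_card sub2) _; apply: leq_trans (leq_imset_card _ _) _.
  by rewrite cardsT card_prod card_ord card_bool mulnC.
move=> y yB; rewrite !inE !andbT; apply/ffun_onP => k; rewrite ffunE.
have [_ _ lZ _] := flagv_facts Q yB.
have [kl|kl] := ltnP k (size (flagv Q y)); last by rewrite nth_default ?size_map// !inE.
have i0 : faceidx by move: kl; case: (flagv Q y).
rewrite (nth_map i0)// !inE mem_imset/=; last by move=> ? ? [].
by have := mem_nth i0 kl; rewrite lZ inE => /andP[].
Qed.

(** By Markov's inequality at least half of [U] has at most twice the average crossing weight. By
    pigeonhole many of these points lie in one simplex, which every hyperplane crossing [U'] must
    cross. *)
Lemma cluster t (U : {set J}) : exists U' : {set J}, [/\ U' \subset U,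
  (#|U| <= 2 * label_bound t * #|U'|)%N &
  t.+1%:R * \sum_h w h * (cross_set h U')%:R <= (4 * D)%:R * W].
Proof.
have [U0|U0] := posnP #|U|.
  exists set0; rewrite sub0set cards0 U0; split=> //.
  rewrite big1 ?mulr0 ?mulr_ge0//; first exact: ltW.
  move=> h _; suff -> : cross_set h set0 = false by rewrite mulr0.
  by apply/negP => /andP[/existsP[u]]; rewrite inE.
have t0 : 0 < t.+1%:R :> R by rewrite ltr0n.
have [Q Qt QW] := sample_exists t U0.
pose Ug := [set u in U | t.+1%:R * crossweight Q (x u) <= (4 * D)%:R * W].
have UgU : Ug \subset U by apply/subsetP => u; rewrite inE => /andP[].
have UgE : (#|U| <= 2 * #|Ug|)%N.
  have D0 : 0 < (4 * D)%:R * W by rewrite mulr_gt0// ltr0n muln_gt0.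
  have : #|U :\: Ug|%:R * ((4 * D)%:R * W) <= t.+1%:R * \sum_(u in U) crossweight Q (x u).
    rewrite [leLHS]mulr_natl -sumr_const [leRHS]mulr_sumr [leRHS](bigID (mem Ug))/= addrC.
    rewrite (eq_bigl (fun u => (u \in U) && (u \notin Ug))); last by move=> u; rewrite !inE andbC.
    rewrite -[leLHS]addr0 lerD//.
      apply: ler_sum => u /andP[uU]; rewrite inE uU/= -ltNge; exact: ltW.
    apply: sumr_ge0 => u _; rewrite mulr_ge0//; apply: sumr_ge0 => h _; exact: mulr_ge0.
  have E4 : (4 * D)%:R = 4 * D%:R :> R by rewrite natrM.
  have E2 : (2 * D * #|U|)%:R = 2 * D%:R * #|U|%:R :> R by rewrite 2!natrM.
  move=> /le_trans/(_ QW); rewrite E4 E2 => h.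
  have : (#|U :\: Ug| * 2 <= #|U|)%N.
    have D1 : 0 < D%:R * W by rewrite mulr_gt0// ltr0n muln_gt0.
    rewrite -(ler_nat R) natrM -(ler_pM2r D1).
    by move: h; move: (D%:R) (#|U|%:R) (#|U :\: Ug|%:R) W; move=> D' n' p' W' h; lra.
  by rewrite cardsD (setIidPr UgU); have := subset_leq_card UgU; lia.
have Ug0 : (0 < #|Ug|)%N by lia.
have [A Ab AP] := flagcode_card Qt.
have [u0 u0U hU] := @pigeonhole_fiber _ _ Ug (fun u => flagcode Q (x u)) A (fun u _ => AP _ (xB u)) Ug0.
exists [set u in Ug | flagcode Q (x u) == flagcode Q (x u0)]; split.
- by apply: subset_trans UgU; apply/subsetP => u; rewrite inE => /andP[].
- apply: (leq_trans UgE); rewrite -mulnA leq_mul2l/=; apply: leq_trans hU _.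
  by rewrite leq_mul2r Ab orbT.
- have : t.+1%:R * crossweight Q (x u0) <= (4 * D)%:R * W by move: u0U; rewrite inE => /andP[].
  apply: le_trans; rewrite ler_wpM2l//; apply: ler_sum => h _.
  rewrite ler_wpM2l//; have [cr|//] := boolP (cross_set h _).
  rewrite (@cross_simplex Q h _ (simplexv Q (x u0)) _ cr)// => u.
  by rewrite inE => /andP[_ /eqP]; apply: flagcode_simplex.
Qed.

End Sampling.

(** Signs on [t] hyperplanes times sequences of at most [m] gates. The count holds for arbitrary
    hyperplanes, such as the duals of points; being exponential in [t] is affordable where only its
    logarithm matters. *)
Definition simplex_bound m t := (2 ^ t * (t + 2 * m).+1 ^ m)%N.

Section Enumeration.
Context (R : realType) (m : nat) (H : finType) (a : H -> 'rV[R]_m) (b : H -> R) (M : R).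
Hypothesis M0 : 0 <= M.

Notation simplexv := (simplexv a b M).
Notation gatesv := (gatesv a b M).
Notation sgnv := (sgnv a b M).
Notation boxed := (boxed M).

Definition signcode (Q : {set H}) y : {set H} * {ffun 'I_m -> option (faceidx m H)} :=
  ([set h in Q | sgnv y (inl h)],
   [ffun k : 'I_m => nth None (map Some (gatesv Q y)) k]).

Lemma gatesv_sub (Q : {set H}) y : boxed y -> {subset gatesv Q y <= faces m Q}.
Proof.
move=> yB.
by have [z []] := gates_end M0 (fun y => (boxedP a b M y).2) m (boxfaces_sub m Q) (sgnv_box a b yB)
  (sub0set _) (sgnv_cell a b M y _).
Qed.

Lemma signcode_simplex Q y z : boxed y -> boxed z -> signcode Q y = signcode Q z ->
  simplexv Q y = simplexv Q z.
Proof.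
move=> yB zB [] /setP sE /ffunP gE.
have gsE : gatesv Q y = gatesv Q z.
  have sz x : (size (gatesv Q x) <= m)%N by apply: size_gates.
  rewrite -[LHS](pmap_nth_Some (sz y)) -[RHS](pmap_nth_Some (sz z)); congr pmap.
  apply/(eq_from_nth (x0 := None)); rewrite !size_mkseq// => k km.
  by rewrite !nth_mkseq//; have := gE (Ordinal km); rewrite !ffunE.
rewrite /simplexv gsE; apply: vertices_ext => -[h|e] iQ.
  by have := sE h; rewrite inE in iQ; rewrite !inE iQ.
by rewrite !sgnv_box// inE.
Qed.

Lemma card_faces (Q : {set H}) : (#|faces m Q| <= #|Q| + 2 * m)%N.
Proof.
have sub : faces m Q \subset (inl @: Q) :|: (inr @: [set: 'I_m * bool]).
  apply/subsetP => -[h|z]; rewrite !inE => hQ; apply/orP; [left|right];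
  by rewrite imset_f ?inE.
apply: leq_trans (subset_leq_card sub) _; apply: leq_trans (leq_card_setU _ _) _.
rewrite leq_add ?(leq_trans (leq_imset_card _ _))//.
by rewrite cardsT card_prod card_ord card_bool mulnC.
Qed.

(** Each simplex is represented by a point with property [P] lying in it; [P] will be the condition
    of avoiding the given points. Codes that do not occur get a dummy point. *)
Lemma simplex_enum (P : 'rV[R]_m -> Prop) t : exists rep : {set H} -> 'I_(simplex_bound m t) -> 'rV[R]_m,
  forall Q : {set H}, (#|Q| <= t)%N -> forall y, boxed y -> P y ->
  exists c, [/\ boxed (rep Q c), P (rep Q c) & simplexv Q y = simplexv Q (rep Q c)].
Proof.
suff key (Q : {set H}) : exists rep : 'I_(simplex_bound m t) -> 'rV[R]_m,
    (#|Q| <= t)%N -> forall y, boxed y -> P y ->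
    exists c, [/\ boxed (rep c), P (rep c) & simplexv Q y = simplexv Q (rep c)].
  by have [rep repP] := choice key; exists rep.
have [Qt|Qt] := leqP #|Q| t; last by exists (fun=> 0).
pose A0 : {set option (faceidx m H)} := None |: Some @: faces m Q.
pose A := setX (powerset Q) [set f : {ffun 'I_m -> option (faceidx m H)} in ffun_on (mem A0)].
have cA : (#|A| <= simplex_bound m t)%N.
  rewrite cardsX card_powerset leq_mul ?leq_exp2l//.
  rewrite cardsE card_ffun_on card_ord; apply: leq_exp_base.
  rewrite cardsU1 (leq_trans (leq_add (leq_b1 _) (leq_imset_card _ _)))// add1n ltnS.
  by apply: (leq_trans (card_faces Q)); rewrite leq_add2r.
have inA y : boxed y -> signcode Q y \in A.
  move=> yB; rewrite !inE; apply/andP; split.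
    by apply/subsetP => h; rewrite inE => /andP[].
  apply/ffun_onP => k; rewrite ffunE.
  have [kl|kl] := ltnP k (size (gatesv Q y)); last by rewrite nth_default ?size_map// !inE.
  have i0 : faceidx m H by move: kl; case: (gatesv Q y).
  rewrite (nth_map i0)// !inE mem_imset/=; last by move=> ? ? [].
  by have := gatesv_sub yB (mem_nth i0 kl); rewrite inE.
have ex (c : {set H} * {ffun 'I_m -> option (faceidx m H)}) : exists y, (exists z, [/\ boxed z, P z & signcode Q z = c]) ->
    [/\ boxed y, P y & signcode Q y = c].
  have [[z zP]|nz] := pselect (exists z, [/\ boxed z, P z & signcode Q z = c]).
    by exists z.
  by exists 0 => /nz.
have [dec decP] := choice ex.
exists (fun c => dec (nth (set0, [ffun=> None]) (enum A) c)) => _ y yB Py.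
have cy := inA y yB.
have lt : (index (signcode Q y) (enum A) < simplex_bound m t)%N.
  by apply: leq_trans cA; rewrite cardE index_mem mem_enum.
exists (Ordinal lt) => /=; rewrite nth_index ?mem_enum//.
have [|zB Pz zE] := decP (signcode Q y); first by exists y.
by split=> //; apply: signcode_simplex.
Qed.

Let D := (m.+1 * m.+1)%N.

Definition zone (vs : seq 'rV[R]_m) := [set h : H | crossv a b h vs].

(* A union bound over the simplices spanned by [D] members of the sample. *)
Lemma small_zones k l : let s := (k * l + D)%N in (0 < k)%N -> (0 < #|H|)%N ->
  (s ^ D * simplex_bound m D < 2 ^ l)%N ->
  exists2 Q : {set H}, (#|Q| <= s)%N &
    forall y, boxed y -> (#|zone (simplexv Q y)| * k <= #|H|)%N.
Proof.
move=> s k0 H0 hl; apply: contrapT => nQ.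
have [rep repP] := simplex_enum (fun=> True) D.
pose n : R := #|H|%:R; have n0 : 0 < n by rewrite ltr0n.
(* The event that the [c]-th simplex of the subsample named by [e] has too large a zone and that [t]
   misses it. Only the values of [f] on the range of [e] matter, so the other draws are independent
   of the simplex. *)
pose Q (e : {ffun 'I_D -> 'I_s}) (c : 'I_(simplex_bound m D)) (f : {ffun 'I_s -> H}) (t : H) : R :=
  let vs := simplexv (f @: (e @: [set: 'I_D])) (rep (f @: (e @: [set: 'I_D])) c) in
  ((#|H| < #|zone vs| * k)%N && (t \notin zone vs))%:R.
have bad (f : {ffun 'I_s -> H}) : 1 <= \sum_(e : {ffun 'I_D -> 'I_s}) \sum_c \prod_(i in ~: (e @: [set: 'I_D])) Q e c f (f i).
  have [y yB ybad] : exists2 y, boxed y & (#|H| < #|zone (simplexv (f @: [set: 'I_s]) y)| * k)%N.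
    apply: contrapT => ny; apply: nQ; exists (f @: [set: 'I_s]).
      by apply: leq_trans (leq_imset_card _ _) _; rewrite cardsT card_ord.
    move=> y yB; rewrite leqNgt; apply/negP => h; apply: ny; by exists y.
  have [B [BQ BD BE]] := simplexv_basis a b M0 (f @: [set: 'I_s]) yB.
  have s0 : (0 < s)%N by rewrite /s /D; lia.
  have gex h : exists i : 'I_s, h \in B -> f i = h.
    have [hB|_] := boolP (h \in B); last by exists (Ordinal s0).
    by have /imsetP[i _ ->] := subsetP BQ _ hB; exists i.
  have [g gP] := choice gex.
  have [h0 _] : exists h0 : H, true by case/card_gt0P: H0 => h0 _; exists h0.
  pose e := [ffun k : 'I_D => g (nth h0 (enum B) k)].
  have BN : B \subset f @: (e @: [set: 'I_D]).
    apply/subsetP => h hB; rewrite -(gP h hB); apply: imset_f.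
    have lt : (index h (enum B) < D)%N by apply: leq_trans BD; rewrite cardE index_mem mem_enum.
    apply/imsetP; exists (Ordinal lt) => //; by rewrite ffunE /= nth_index// mem_enum.
  have NQ : f @: (e @: [set: 'I_D]) \subset f @: [set: 'I_s] by apply: imsetS.
  have sE := BE _ BN NQ.
  have [|c [_ _ cE]] := repP (f @: (e @: [set: 'I_D])) _ y yB I.
    by apply: leq_trans (leq_imset_card _ _) (leq_trans (leq_imset_card _ _) _); rewrite cardsT card_ord.
  have Q0 (e' : {ffun 'I_D -> 'I_s}) c' : 0 <= \prod_(i in ~: (e' @: [set: 'I_D])) Q e' c' f (f i).
    by apply: prodr_ge0 => i _.
  rewrite (bigD1 e)//= (bigD1 c)//= big1; last first.
    move=> i _; rewrite /Q -cE sE ybad/= inE.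
    by rewrite simplexv_uncrossed// imset_f.
  by rewrite -[leLHS]addr0 -addrA lerD// addr_ge0// sumr_ge0// => e' _; apply: sumr_ge0.
(* At least [k l] draws lie outside the range of [e], and each misses a zone of more than [1/k] of
   the hyperplanes with probability at most [beta]. As [beta ^+ k <= 1/2], one bad event has
   probability at most [2^(-l)]. *)
pose beta : R := 1 - k%:R^-1.
have k0R : 0 < k%:R :> R by rewrite ltr0n.
have beta0 : 0 <= beta by rewrite subr_ge0 invf_le1// ler1n.
have beta1 : beta <= 1 by rewrite gerBl invr_ge0 ltW.
have each (e : {ffun 'I_D -> 'I_s}) c : \sum_(f : {ffun 'I_s -> H}) \prod_(i in ~: (e @: [set: 'I_D])) Q e c f (f i)
    <= n ^+ s * beta ^+ (k * l).
  have [h0 _] : exists h0 : H, true by case/card_gt0P: H0 => h0 _; exists h0.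
  have := @product_weight_le R 'I_s H (fun=> 1) (~: (e @: [set: 'I_D])) h0 (Q e c) _ (fun=> ler01) (n * beta) _ _.
  move=> /(_ _ _ _)/wrap[].
  - move=> f f' ff'; have E : f @: (e @: [set: 'I_D]) = f' @: (e @: [set: 'I_D]).
      by apply: eq_in_imset => i iN; apply: ff'; rewrite !inE negbK.
    by apply/funext => t; rewrite /Q E.
  - by move=> f t.
  - move=> f; under eq_bigr do rewrite mul1r.
    rewrite /Q; set vs := simplexv _ _; have [lt|_] := ltnP #|H| _; last first.
      by rewrite big1 ?mulr_ge0// ltW.
    rewrite (eq_bigr (fun t => if t \in ~: zone vs then 1 else 0 : R)); last first.
      by move=> t _; rewrite [t \in ~: _]inE; case: (t \in zone vs).
    rewrite -big_mkcond/= sumr_const.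
    have Ez : #|zone vs|%:R + #|~: zone vs|%:R = n by rewrite -natrD cardsC.
    have lt2 : n < #|zone vs|%:R * k%:R by rewrite -natrM ltr_nat.
    rewrite /beta mulrBr mulr1; have : n / k%:R < #|zone vs|%:R by rewrite ltr_pdivrMr.
    lra.
  rewrite setCK.
  move=> H1; apply: (le_trans _ (le_trans H1 _)).
    by apply: ler_sum => f _; rewrite [X in _ <= X * _]big1 ?mul1r.
  rewrite sumr_const cardT -cardE exprMn mulrA -exprD cardsC card_ord -/n.
  rewrite ler_wpM2l ?exprn_ge0 ?(ltW n0)//.
  apply: (@le_trans _ _ (beta ^+ (s - D))); last by rewrite /s addnK.
  apply: ler_wiXn2l => //; rewrite leq_subLR.
  have E := cardsC (e @: [set: 'I_D]); rewrite card_ord in E.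
  rewrite -[X in (X <= _)%N]E leq_add2r.
  by apply: leq_trans (leq_imset_card _ _) _; rewrite cardsT card_ord.
have tot : n ^+ s <= (s ^ D * simplex_bound m D)%:R * (n ^+ s * beta ^+ (k * l)).
  apply: (@le_trans _ _ (\sum_(f : {ffun 'I_s -> H}) \sum_(e : {ffun 'I_D -> 'I_s}) \sum_c
      \prod_(i in ~: (e @: [set: 'I_D])) Q e c f (f i))).
    rewrite -[leLHS]mulr1; apply: le_trans (_ : \sum_(f : {ffun 'I_s -> H}) 1 <= _).
      by rewrite sumr_const card_ffun card_ord natrX mulr1.
    by apply: ler_sum => f _; apply: bad.
  rewrite exchange_big/= natrM -mulrA.
  rewrite (_ : (s ^ D)%:R = #|{ffun 'I_D -> 'I_s}|%:R); last by rewrite card_ffun !card_ord.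
  rewrite [leRHS]mulr_natl -sumr_const; apply: ler_sum => e _.
  rewrite exchange_big/= -[X in X%:R * _](card_ord (simplex_bound m D)) mulr_natl -sumr_const.
  by apply: ler_sum => c _; apply: each.
have ns0 : 0 < n ^+ s by rewrite exprn_gt0.
have : (2 ^ l)%:R <= (s ^ D * simplex_bound m D)%:R :> R.
  rewrite mulrCA -[leLHS]mulr1 ler_pM2l// in tot.
  have : beta ^+ (k * l) <= 2^-1 ^+ l.
    by rewrite exprM lerXn2r ?nnegrE ?exprn_ge0 ?invr_ge0//; apply: one_sub_inv_exp.
  move=> b2; have := le_trans tot (ler_wpM2l (ler0n _ _) b2).
  by rewrite exprVn ler_pdivlMr ?exprn_gt0// mul1r natrX.
by rewrite ler_nat leqNgt hl.
Qed.

End Enumeration.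

(** * Test hyperplanes *)

Definition crossing (R : realFieldType) d (J : finType) (X : J -> 'rV[R]_d) (h : 'rV[R]_(1 + d))
    (U : {set J}) :=
  [exists u in U, 0 < dot h (hom (X u))] && [exists u in U, dot h (hom (X u)) < 0].

Definition avoids (R : realFieldType) d (J : finType) (X : J -> 'rV[R]_d) (h : 'rV[R]_(1 + d)) :=
  forall u, dot h (hom (X u)) != 0.

(** Only nonzero signs are kept, so that zeros can be perturbed away. *)
Definition same_signs (R : realFieldType) m (W : seq 'rV[R]_m) (g g' : 'rV[R]_m) :=
  forall w, w \in W -> (0 < dot w g -> 0 < dot w g') /\ (dot w g < 0 -> dot w g' < 0).

Lemma nudge (R : realFieldType) m (g u : 'rV[R]_m) W : u != 0 ->
  exists2 g', same_signs W g g' & dot u g' != 0.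
Proof.
move=> u0; have [ug|ug] := eqVneq (dot u g) 0; last by exists g.
pose f (i : 'I_(size W)) := let w := nth 0 W i in
  if dot w g == 0 then 1 else `|dot w g| / 2.
have f0 i : 0 < f i.
  by rewrite /f; case: ifPn => // wg; rewrite divr_gt0// normr_gt0.
have [e e0 he] := small_scale (fun i : 'I_(size W) => `|dot (nth 0 W i) u|) f0.
exists (g + e *: u); last first.
  by rewrite dotDr ug add0r dotZr mulf_neq0 ?gt_eqF// lt_def dotvv_eq0 u0 dotvv_ge0.
move=> w wW; have iW : (index w W < size W)%N by rewrite index_mem.
have := he (Ordinal iW); rewrite /f /= nth_index// dotDr dotZr => h.
have h1 := ler_norm (e * dot w u); have h2 := ler_norm (- (e * dot w u)).
rewrite normrN in h2; rewrite normrM (gtr0_norm e0) in h1 h2.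
split=> wg; move: h.
  by rewrite (gt_eqF wg) (gtr0_norm wg); lra.
by rewrite (lt_eqF wg) (ltr0_norm wg); lra.
Qed.

Lemma avoid_hyperplanes (R : realFieldType) m (g : 'rV[R]_m) W (us : seq 'rV[R]_m) :
  {in us, forall u, u != 0} ->
  exists2 g', same_signs W g g' & {in us, forall u, dot u g' != 0}.
Proof.
elim: us => [|u us IH] us0; first by exists g => // w _.
have [|g1 s1 a1] := IH; first by move=> v vus; apply: us0; rewrite inE vus orbT.
have [|g2 s2 a2] := @nudge _ _ g1 u (W ++ us); first by apply: us0; rewrite inE eqxx.
exists g2.
  move=> w wW; have [p1 n1] := s1 w wW; have [|p2 n2] := s2 w.
    by rewrite mem_cat wW.
  by split=> h; [apply/p2/p1|apply/n2/n1].
move=> v; rewrite inE => /predU1P[->//|vus].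
have [|p2 n2] := s2 v; first by rewrite mem_cat vus orbT.
by have := a1 v vus; rewrite !neq_lt => /orP[/n2 ->//|/p2 ->]; rewrite orbT.
Qed.

Lemma exists_orthogonal (R : fieldType) m (I : finType) (Z : {set I}) (g : I -> 'rV[R]_m) :
  (#|Z| < m)%N -> exists2 u, u != 0 & forall i, i \in Z -> dot u (g i) = 0.
Proof.
move=> Zm; pose p (j : 'I_m) : 'rV[R]_#|Z| := \row_k g (enum_val k) 0 j.
have [|l [j _ lj] lp] := @lin_dep _ _ 'I_m [set: 'I_m] p; first by rewrite cardsT card_ord.
exists (\row_j l j).
  by apply: contraNneq lj => /rowP/(_ j); rewrite !mxE => ->.
move=> i iZ; have := congr1 (fun v : 'rV_#|Z| => v 0 (enum_rank_in iZ i)) lp.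
rewrite summxE mxE => E; rewrite -[RHS]E; apply: eq_big => [k|k _]; first by rewrite inE.
by rewrite !mxE enum_rankK_in.
Qed.

(** * General position of the tests *)

Section GenericPerturbation.
Context (R : realType) (d : nat) (H : finType) (M : R).
Hypothesis M0 : 0 < M.

Let a (q : H -> 'rV[R]_(1 + d)) h := rsubmx (q h).
Let b (q : H -> 'rV[R]_(1 + d)) h := lsubmx (q h) 0 0.

(** Independence of the normals, stronger than the bound on their number, is the invariant kept
    while hyperplanes are perturbed one at a time. *)
Let free (n : faceidx d H -> 'rV[R]_d) (Z : {set faceidx d H}) :=
  forall l, \sum_(i in Z) l i *: n i = 0 -> forall i, i \in Z -> l i = 0.

Lemma free_card n Z : free n Z -> (#|Z| <= d)%N.
Proof.
move=> fZ; rewrite leqNgt; apply/negP => /(lin_dep n)[l [i iZ /eqP li]] lE.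
by apply: li; apply: fZ iZ.
Qed.

Let hfun (q : H -> 'rV[R]_(1 + d)) (i : faceidx d H) : 'rV[R]_(1 + d) :=
  row_mx (foffset (m := d) (b q) M i)%:M (fnormal (a q) i).

Let aff q := affv (fnormal (a q)) (foffset (m := d) (b q) M).

Lemma hfun_inl q h : hfun q (inl h) = q h.
Proof.
rewrite /hfun/= -[RHS]hsubmxK; congr row_mx.
by apply/matrixP => i j; rewrite !ord1 [LHS]mxE eqxx.
Qed.

Lemma lsub_hfun q i : lsubmx (hfun q i) 0 0 = foffset (m := d) (b q) M i.
Proof. by rewrite row_mxKl mxE eqxx. Qed.

(** For every set [Z] of at most [d] faces, some [u Z] is orthogonal to all of them, and the new
    vector is chosen not orthogonal to [u Z]. If its normal depended on those of [Z] and all these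
    faces had a common point, the offsets would satisfy the same relation and the new vector would
    be orthogonal to [u Z]. *)
Lemma generic_step (q : H -> 'rV[R]_(1 + d)) (A : {set H}) h (W : seq 'rV[R]_(1 + d)) :
  (forall Z : {set faceidx d H}, Z \subset faces d A -> (exists y, forall i, i \in Z -> aff q i y = 0) ->
      free (fnormal (a q)) Z) ->
  h \notin A ->
  exists2 g, same_signs W (q h) g & let q' := fun h' => if h' == h then g else q h' in
    forall Z : {set faceidx d H}, Z \subset faces d (h |: A) -> (exists y, forall i, i \in Z -> aff q' i y = 0) ->
      free (fnormal (a q')) Z.
Proof.
move=> gA hA.
have ex (Z : {set faceidx d H}) : exists u, (#|Z| <= d)%N -> u != 0 /\ forall i, i \in Z -> dot u (hfun q i) = 0.
  have [Zd|_] := leqP #|Z| d; last by exists 0.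
  by have [u u0 uZ] := exists_orthogonal (hfun q) (Zd : (#|Z| < 1 + d)%N); exists u.
have [u uP] := choice ex.
pose us := [seq u Z | Z <- enum [set Z : {set faceidx d H} | (#|Z| <= d)%N]].
have [|g gW gus] := @avoid_hyperplanes _ _ (q h) W us.
  by move=> v /mapP[Z]; rewrite mem_enum inE => /uP[uZ0 _] ->.
exists g => // q' Z ZA [y yZ].
have q'E i : i != inl h -> hfun q' i = hfun q i.
  move=> ih; rewrite /hfun; case: i ih => [h'|[j e]]//= ih.
  have {}ih : h' != h by apply: contraNneq ih => ->.
  by rewrite /a /b /q' (negPf ih).
have affE i : i != inl h -> aff q' i =1 aff q i.
  move=> ih z; rewrite /aff /affv; case: i ih => [h'|[j e]]//= ih.
  have {}ih : h' != h by apply: contraNneq ih => ->.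
  by rewrite /a /b /q' (negPf ih).
have nE i : i != inl h -> fnormal (a q') i = fnormal (a q) i.
  move=> ih; case: i ih => [h'|[j e]]//= ih.
  have {}ih : h' != h by apply: contraNneq ih => ->.
  by rewrite /a /q' (negPf ih).
pose Z0 := Z :\ inl h.
have fZ0 : free (fnormal (a q)) Z0.
  apply: gA.
    apply/subsetP => i; rewrite !inE => /andP[ih /(subsetP ZA)].
    by rewrite inE; case: i ih => [h'|]//= ih; rewrite !inE => /predU1P[E|//]; rewrite E eqxx in ih.
  exists y => i; rewrite !inE => /andP[ih iZ]; by rewrite -affE// yZ.
move=> l lE i iZ.
have [hZ|hZ] := boolP (inl h \in Z); last first.
  apply: fZ0; last by rewrite !inE iZ andbT; apply: contraNneq hZ => <-.
  rewrite -[RHS]lE; apply: eq_big => [j|j].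
    by rewrite !inE; case: eqVneq => [->|//]; rewrite (negPf hZ).
  by rewrite !inE => /andP[jh _]; rewrite nE.
rewrite (bigD1 (inl h))//= in lE.
have lE2 : \sum_(i in Z0) l i *: fnormal (a q) i = - (l (inl h) *: a q' h).
  apply/eqP; rewrite -addr_eq0 addrC; apply/eqP; rewrite -[RHS]lE; congr (_ + _).
  apply: eq_big => [j|j]; first by rewrite !inE andbC.
  by rewrite !inE => /andP[jh _]; rewrite nE.
have lh : l (inl h) = 0.
  apply/eqP; apply: contraT => lh.
  have Zd := free_card fZ0.
  have /(_ (u Z0)) := gus; rewrite map_f ?mem_enum ?inE// => /(_ isT)/eqP; case.
  have [_ uZ] := uP Z0 Zd.
  suff -> : g = \sum_(i in Z0) (- (l (inl h))^-1 * l i) *: hfun q i.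
    by rewrite dot_sumr big1// => j jZ; rewrite dotZr uZ// mulr0.
  have -> : g = hfun q' (inl h) by rewrite hfun_inl /q' eqxx.
  under eq_bigr do rewrite -scalerA; rewrite -scaler_sumr.
  have qz j : j \in Z -> foffset (m := d) (b q') M j = - dot (fnormal (a q') j) y.
    by move=> /yZ; rewrite /aff /affv => E; lra.
  have -> : \sum_(i in Z0) l i *: hfun q i = - l (inl h) *: hfun q' (inl h).
    rewrite -[LHS]hsubmxK -[RHS]hsubmxK; congr row_mx; last first.
      rewrite (linear_sum rsubmx) linearZ/= row_mxKr scaleNr -lE2.
      by apply: eq_bigr => j _; rewrite linearZ/= row_mxKr.
    apply/matrixP => i' j'; rewrite !ord1 (linear_sum lsubmx) summxE.
    have -> : lsubmx (- l (inl h) *: hfun q' (inl h)) 0 0 = dot (l (inl h) *: a q' h) y.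
      by rewrite linearZ mxE lsub_hfun (qz (inl h))// dotZl mulrNN.
    rewrite -[_ *: _]opprK -lE2 dotNl dot_suml -sumrN.
    apply: eq_bigr => j jZ0; rewrite linearZ mxE lsub_hfun dotZl.
    move: jZ0; rewrite !inE => /andP[jh jZ].
    have := qz j jZ; rewrite nE// => E.
    have <- : foffset (m := d) (b q') M j = foffset (m := d) (b q) M j.
      by rewrite -!lsub_hfun q'E.
    by rewrite E mulrN.
  by rewrite scalerA mulrNN mulVf// scale1r.
have [->//|ih] := eqVneq i (inl h).
apply: fZ0; last by rewrite !inE ih iZ.
by rewrite lE2 lh scale0r oppr0.
Qed.

Lemma generic_perturbation (q : H -> 'rV[R]_(1 + d)) (W : seq 'rV[R]_(1 + d)) :
  exists2 q', forall h, same_signs W (q h) (q' h) &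
    forall Z : {set faceidx d H}, (exists y, forall i, i \in Z -> aff q' i y = 0) ->
      (#|Z| <= d)%N.
Proof.
suff [q' q'W q'P] : exists2 q', forall h, same_signs W (q h) (q' h) &
    forall Z : {set faceidx d H}, Z \subset faces d [set: H] ->
      (exists y, forall i, i \in Z -> aff q' i y = 0) -> free (fnormal (a q')) Z.
  exists q' => // Z yZ; apply: (@free_card (fnormal (a q'))); apply: q'P => //.
  by apply/subsetP => -[h|e] _; rewrite !inE.
have [n] := ubnP #|[set: H]|; move: [set: H] => A; elim: n A => // n IH A An.
have [->|/set0Pn[h hA]] := eqVneq A set0.
  (* Only box facets are left. Opposite ones have no common point because [M > 0], so the normals
     are distinct coordinate vectors up to sign. *)
  exists q => [h w _//|Z ZA [y yZ] l lE i iZ].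
  have : i \in faces d set0 by apply: (subsetP ZA).
  rewrite inE; case: i iZ => [h|[j e]] iZ; first by rewrite inE.
  move=> _; have := congr1 (fun v : 'rV_d => v 0 j) lE.
  rewrite summxE mxE (bigD1 (inr (j, e)))//= big1 ?addr0.
    by rewrite mxE; case: e {iZ} => /=; rewrite !mxE !eqxx/= ?mulrN mulr1// => /eqP; rewrite ?oppr_eq0 => /eqP.
  move=> i' /andP[i'Z ne]; have : i' \in faces d set0 by apply: (subsetP ZA).
  rewrite inE; case: i' i'Z ne => [h|[j' e']] i'Z ne; first by rewrite inE.
  move=> _; rewrite mxE; have [jj|jj] := eqVneq j' j.
    exfalso; subst j'; have := yZ _ iZ; have := yZ _ i'Z; rewrite /aff !aff_box.
    by case: e' e ne {iZ i'Z} => -[] //=; rewrite ?eqxx//; move: M0; lra.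
  by case: e' {ne i'Z}; rewrite /= !mxE eq_sym (negPf jj) andbF ?oppr0 mulr0.
have [|q1 q1W q1P] := IH (A :\ h).
  by move: An; rewrite (cardsD1 h) hA.
have [|g gW gP] := @generic_step q1 (A :\ h) h W q1P; first by rewrite !inE eqxx.
exists (fun h' => if h' == h then g else q1 h').
  move=> h'; case: eqVneq => [->|_]; last exact: q1W.
  move=> w wW; have [p1 n1] := q1W h w wW; have [p2 n2] := gW w wW.
  by split=> ?; [apply/p2/p1|apply/n2/n1].
by rewrite -[X in faces d X](setD1K hA).
Qed.

End GenericPerturbation.

Lemma crossing_pscale (R : realFieldType) d (J : finType) (X : J -> 'rV[R]_d) h c U :
  0 < c -> crossing X (c *: h) U = crossing X h U.
Proof.
move=> c0; rewrite /crossing; congr (_ && _); apply: eq_existsb => u;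
by rewrite dotZl ?pmulr_rgt0 ?pmulr_rlt0.
Qed.

Lemma comb_ge0 (R : realFieldType) (e x y : R) :
  0 <= e -> e <= 1 -> 0 <= x -> 0 <= y -> 0 <= (1 - e) * x + e * y.
Proof. by move=> e0 e1 x0 y0; rewrite addr_ge0 ?mulr_ge0 ?subr_ge0. Qed.

(* Points are dualized to hyperplanes, so that [h] lies in a simplex of a sample of the dual
   arrangement.  The tests are the vertices of this simplex, moved slightly towards a point of the
   simplex that avoids all the dual hyperplanes. *)
Lemma test_set (R : realType) d (J : finType) (X : J -> 'rV[R]_d) k l :
  let D := (d.+2 * d.+2)%N in let s := (k * l + D)%N in
  (0 < k)%N -> (0 < #|J|)%N -> (s ^ D * simplex_bound d.+1 D < 2 ^ l)%N ->
  exists2 q : 'I_(simplex_bound d.+1 s) -> 'I_d.+2 -> 'rV[R]_(1 + d),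
    forall c j, avoids X (q c j) &
    forall h, avoids X h -> exists c (Z : {set J}), (#|Z| * k <= #|J|)%N /\
      forall U, crossing X h U -> (exists j, crossing X (q c j) U) \/ U \subset Z.
Proof.
move=> D s k0 J0 hl.
pose a0 (u : J) : 'rV[R]_(1 + d) := hom (X u); pose b0 (u : J) : R := 0.
have [Q Qs QZ] := @small_zones R (1 + d) J a0 b0 1 ler01 k l k0 J0 hl.
have [rep repP] := @simplex_enum R (1 + d) J a0 b0 1 ler01 (avoids X) s.
pose S c := simplexv a0 b0 1 Q (rep Q c).
have affE u v : affh a0 b0 u v = dot v (hom (X u)) by rewrite /affh addr0 dotC.
(* A simplex with fewer than [d + 2] vertices is padded with its representative point. *)
pose V c (j : 'I_d.+2) := nth (rep Q c) (S c) j.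
(* A nonzero value may change by at most half of itself, so its sign survives; a zero value takes
   the sign at [rep Q c]. *)
pose f (i : 'I_(simplex_bound d.+1 s) * 'I_d.+2 * J) : R :=
  if dot (V i.1.1 i.1.2) (hom (X i.2)) == 0 then 1 else `|dot (V i.1.1 i.1.2) (hom (X i.2))| / 2.
have f0 i : 0 < f i by rewrite /f; case: ifPn => // h; rewrite divr_gt0// normr_gt0.
have [e0 e00 he0] := small_scale (fun i => `|dot (rep Q i.1.1 - V i.1.1 i.1.2) (hom (X i.2))|) f0.
pose e := Num.min e0 2^-1.
have e_gt0 : 0 < e by rewrite lt_min e00 invr_gt0 ltr0n.
have e_lt1 : e < 1 by rewrite gt_min; apply/orP; right; lra.
have ee0 : e <= e0 by rewrite ge_min lexx.
pose t : 'rV[R]_(1 + d) := row_mx 1%:M 0.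
have tE u : dot t (hom (X u)) = 1.
  by rewrite dot_hom row_mxKl row_mxKr dot0l mxE eqxx addr0.
pose good c := `[< avoids X (rep Q c) >].
(* Codes without a good representative receive the constant functional 1, which avoids all
   points. *)
pose q c j := if good c then V c j + e *: (rep Q c - V c j) else t.
have qE c j u : good c -> dot (q c j) (hom (X u)) =
    (1 - e) * dot (V c j) (hom (X u)) + e * dot (rep Q c) (hom (X u)).
  by move=> gc; rewrite /q gc dotDl dotZl dotBl; ring.
have small c j u : dot (V c j) (hom (X u)) != 0 ->
    `|e * (dot (rep Q c) (hom (X u)) - dot (V c j) (hom (X u)))| <= `|dot (V c j) (hom (X u))| / 2.
  move=> nz; have := he0 (c, j, u); rewrite /f/= (negPf nz) dotBl.
  apply: le_trans; rewrite normrM (gtr0_norm e_gt0) ler_wpM2r//.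
have qpos c j u : good c -> 0 < dot (V c j) (hom (X u)) -> 0 < dot (q c j) (hom (X u)).
  move=> gc vp; rewrite qE//; have := small c j u; rewrite gt_eqF// => /(_ isT).
  rewrite (gtr0_norm vp) ler_norml => /andP[h1 h2]; lra.
have qneg c j u : good c -> dot (V c j) (hom (X u)) < 0 -> dot (q c j) (hom (X u)) < 0.
  move=> gc vp; rewrite qE//; have := small c j u; rewrite lt_eqF// => /(_ isT).
  rewrite (ltr0_norm vp) ler_norml => /andP[h1 h2]; lra.
have qav c j : avoids X (q c j).
  move=> u; have [gc|ngc] := boolP (good c); last by rewrite /q (negPf ngc) tE oner_eq0.
  have [vp|vn|vz] := ltgtP (dot (V c j) (hom (X u))) 0.
  - by rewrite lt_eqF// qneg.
  - by rewrite gt_eqF// qpos.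
  - have /asboolP/(_ u) av := gc.
    by rewrite qE// vz mulr0 add0r mulf_neq0 ?(gt_eqF e_gt0).
exists q => // h hav.
(* [h] is scaled into the box of half-width 1; a positive factor does not affect crossings. *)
pose c1 := 1 + \sum_i `|h 0 i|; pose c0 := c1^-1.
have c10 : 0 < c1 by rewrite ltr_pwDl// sumr_ge0.
have c00 : 0 < c0 by rewrite invr_gt0.
have hB : boxed 1 (c0 *: h).
  move=> j; rewrite mxE normrM (gtr0_norm c00) mulrC ler_pdivrMr// mul1r.
  by rewrite /c1 (bigD1 j)//= addrCA lerDl addr_ge0// sumr_ge0.
have hav' : avoids X (c0 *: h) by move=> u; rewrite dotZl mulf_neq0 ?(gt_eqF c00)//; apply: hav.
have [c [cB cav cE]] := repP Q Qs _ hB hav'.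
have gc : good c by apply/asboolP.
exists c, (zone a0 b0 (S c)); split; first exact: QZ.
move=> U; rewrite -(crossing_pscale X h U c00) => cr.
have [hj|nj] := pselect (exists j, crossing X (q c j) U); [by left|right].
have cv r u : cvx [set y | 0 <= r * dot y (hom (X u))]%classic.
  move=> y z w /andP[w0 w1] /= h1 h2.
  have -> : r * dot (w *: y + (1 - w) *: z) (hom (X u)) =
     w * (r * dot y (hom (X u))) + (1 - w) * (r * dot z (hom (X u))).
    by rewrite dotDl !dotZl; ring.
  by rewrite addr_ge0// mulr_ge0// subr_ge0.
have inV v : v \in S c -> exists j, V c j = v.
  move=> vS; have lt : (index v (S c) < d.+2)%N.
    by apply: (@leq_trans (size (S c))); [rewrite index_mem|exact: size_simplexv].
  by exists (Ordinal lt); rewrite /V /= nth_index.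
have [/existsP[u1 /andP[u1U h1]] /existsP[u2 /andP[u2U h2]]] := andP cr.
have [j1 j1P] : exists j, 0 < dot (V c j) (hom (X u1)).
  apply: contrapT => nj1.
  have := @simplexv_hull R (1 + d) J a0 b0 1 ler01 Q _ _ hB (cv (-1) u1); rewrite cE -/(S c) /= => /(_ _)/wrap[]; last by lra.
  move=> v /inV[j <-]; have : ~ 0 < dot (V c j) (hom (X u1)) by move=> p; apply: nj1; exists j.
  by move/negP; rewrite -leNgt; lra.
have [j2 j2P] : exists j, dot (V c j) (hom (X u2)) < 0.
  apply: contrapT => nj1.
  have := @simplexv_hull R (1 + d) J a0 b0 1 ler01 Q _ _ hB (cv 1 u2); rewrite cE -/(S c) /= => /(_ _)/wrap[]; last by lra.
  move=> v /inV[j <-]; have : ~ dot (V c j) (hom (X u2)) < 0 by move=> p; apply: nj1; exists j.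
  by move/negP; rewrite -leNgt; lra.
have side j u u' : u \in U -> u' \in U -> 0 < dot (q c j) (hom (X u)) -> 0 < dot (q c j) (hom (X u')).
  move=> uU u'U p; have := qav c j u'; rewrite neq_lt => /orP[n|//]; exfalso; apply: nj; exists j.
  by apply/andP; split; apply/existsP; [exists u; rewrite uU|exists u'; rewrite u'U].
have pos u : u \in U -> 0 < dot (q c j1) (hom (X u)).
  by move=> uU; apply: (side j1 u1) => //; apply: qpos.
have neg u : u \in U -> dot (q c j2) (hom (X u)) < 0.
  move=> uU; have := qav c j2 u; rewrite neq_lt => /orP[//|p].
  by have := side j2 u u2 uU u2U p; have := qneg c j2 u2 gc j2P; lra.
(* No test crosses [U], so one test is positive and another negative on all of [U]. Each test lies
   between a vertex and the representative of the simplex; hence the dual hyperplane of any point of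
   [U] has vertices strictly on both sides. *)
apply/subsetP => u uU; rewrite inE; apply/andP; split; apply: contraT => /hasPn nv.
  have le0 v : v \in S c -> dot v (hom (X u)) <= 0 by move=> /nv; rewrite affE -leNgt.
  have r0 : dot (rep Q c) (hom (X u)) <= 0.
    have := @simplexv_hull R (1 + d) J a0 b0 1 ler01 Q _ _ cB (cv (-1) u); rewrite -/(S c) /= => /(_ _)/wrap[]; last by rewrite mulN1r oppr_ge0.
    by move=> v /le0; rewrite mulN1r oppr_ge0.
  have v0 : dot (V c j1) (hom (X u)) <= 0.
    rewrite /V; have [js|js] := ltnP j1 (size (S c)); last by rewrite nth_default.
    by apply: le0; apply: mem_nth.
  have := pos u uU; rewrite qE// le_gtF// -oppr_ge0 opprD -!mulrN.
  by apply: comb_ge0; rewrite ?oppr_ge0 ?(ltW e_gt0) ?(ltW e_lt1).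
have le0 v : v \in S c -> 0 <= dot v (hom (X u)) by move=> /nv; rewrite affE -leNgt.
have r0 : 0 <= dot (rep Q c) (hom (X u)).
  have := @simplexv_hull R (1 + d) J a0 b0 1 ler01 Q _ _ cB (cv 1 u); rewrite -/(S c) /= => /(_ _)/wrap[]; last by lra.
  by move=> v /le0; lra.
have v0 : 0 <= dot (V c j2) (hom (X u)).
  rewrite /V; have [js|js] := ltnP j2 (size (S c)); last by rewrite nth_default.
  by apply: le0; apply: mem_nth.
have := neg u uU; rewrite qE// le_gtF//.
by apply: comb_ge0; rewrite ?(ltW e_gt0) ?(ltW e_lt1).
Qed.

(** * Partitions with few crossings *)

(** The integer part of the [d]-th root of [j]. *)
Definition froot d j := \max_(a < j.+1 | (a ^ d <= j)%N) a.

Lemma froot_exp d j : (0 < d)%N -> (froot d j ^ d <= j)%N.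
Proof.
move=> d0; rewrite /froot; elim/big_ind: _ => [|x y hx hy|//]; first by rewrite exp0n.
by rewrite /maxn; case: ifP.
Qed.

Lemma froot_ge d j i : (0 < d)%N -> (i ^ d <= j)%N -> (i <= froot d j)%N.
Proof.
move=> d0 h; have ij : (i < j.+1)%N.
  by rewrite ltnS; apply: leq_trans h; case: (i) => // i'; rewrite -[X in (X <= _)%N]expn1 leq_pexp2l.
exact: (leq_bigmax_cond (Ordinal ij)).
Qed.

Lemma expnS_sub k d : (k.+1 ^ d <= k ^ d + d * k.+1 ^ d.-1)%N.
Proof.
elim: d => [//|d IH]; rewrite /=.
have h : (d * k.+1 ^ d.-1 * k.+1 = d * k.+1 ^ d)%N by case: d {IH} => // d; rewrite -mulnA -expnSr.
have h2 : (k ^ d <= k.+1 ^ d)%N by apply: leq_exp_base.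
rewrite [X in (X <= _)%N]expnSr.
apply: (leq_trans (leq_mul IH (leqnn k.+1))); rewrite mulnDl h expnSr mulnS mulSn; lia.
Qed.

Section FrootSum.
Context (R : realFieldType).

(** The terms with [k^d <= i < (k+1)^d] are at most [1/k], and there are at most [d (k+1)^(d-1)] of
    them. *)
Lemma froot_sum_lt d k : (1 < d)%N -> (0 < k)%N ->
  \sum_(1 <= i < k ^ d) (froot d i)%:R^-1 <= (2 * d * k ^ d.-1)%:R :> R.
Proof.
move=> d1; elim: k => // k IH _; have d0 : (0 < d)%N by apply: ltnW.
have [->|k0] := posnP k; first by rewrite exp1n big_geq.
have kd1 : (1 <= k ^ d)%N by rewrite expn_gt0 k0.
have kd : (k ^ d <= k.+1 ^ d)%N by apply: leq_exp_base.
rewrite (big_cat_nat kd1 kd)/=.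
have k0R : 0 < k%:R :> R by rewrite ltr0n.
have h2 : \sum_(k ^ d <= i < k.+1 ^ d) (froot d i)%:R^-1 <= (2 * d * k.+1 ^ d.-2)%:R :> R.
  apply: (@le_trans _ _ (\sum_(k ^ d <= i < k.+1 ^ d) k%:R^-1)).
    rewrite big_nat_cond [leRHS]big_nat_cond; apply: ler_sum => i /andP[/andP[ki _] _].
    have ki' := froot_ge d0 ki.
    by rewrite lef_pV2 ?posrE ?ltr0n// ?ler_nat//; apply: leq_trans ki'.
  rewrite sumr_const_nat -[leLHS]mulr_natl ler_pdivrMr// -natrM ler_nat leq_subLR.
  apply: leq_trans (expnS_sub k d) _; rewrite leq_add2l.
  have -> : (k.+1 ^ d.-1 = k.+1 * k.+1 ^ d.-2)%N by rewrite -expnS; congr (_ ^ _)%N; lia.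
  have -> : (d * (k.+1 * k.+1 ^ d.-2) = d * k.+1 ^ d.-2 * k.+1)%N by lia.
  have -> : (2 * d * k.+1 ^ d.-2 * k = d * k.+1 ^ d.-2 * (2 * k))%N by lia.
  by rewrite leq_mul2l; apply/orP; right; lia.
apply: (le_trans (lerD (IH k0) h2)); rewrite -natrD ler_nat.
rewrite -mulnDr leq_mul2l; apply/orP; right.
have -> : d.-1 = d.-2.+1 by lia.
rewrite !expnS mulSn addnC leq_add2l leq_mul2l leq_exp_base ?orbT//.
Qed.

Lemma froot_sum d k : (1 < d)%N -> (0 < k)%N ->
  \sum_(1 <= i < (k ^ d).+1) (froot d i)%:R^-1 <= ((2 * d).+1 * k ^ d.-1)%:R :> R.
Proof.
move=> d1 k0; have kd1 : (1 <= k ^ d)%N by rewrite expn_gt0 k0.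
rewrite big_nat_recr//= mulSn natrD addrC lerD ?froot_sum_lt//.
have : (1 <= froot d (k ^ d))%N by apply: froot_ge; rewrite ?exp1n//; apply: ltnW.
move=> h; apply: (@le_trans _ _ 1); last by rewrite ler1n expn_gt0 k0.
by rewrite invf_le1 ?ler1n// ltr0n.
Qed.

End FrootSum.

Lemma crossing_sub (R : realFieldType) d (J : finType) (X : J -> 'rV[R]_d) h (U V : {set J}) :
  U \subset V -> crossing X h U -> crossing X h V.
Proof.
move=> /subsetP UV /andP[/existsP[u /andP[uU hu]] /existsP[v /andP[vU hv]]].
by apply/andP; split; apply/existsP; [exists u|exists v]; rewrite UV.
Qed.

Section Partition.
Context (R : realType) (d : nat) (J : finType) (X : J -> 'rV[R]_d) (H : finType).
Context (q : H -> 'rV[R]_(1 + d)) (M : R).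
Hypothesis d0 : (0 < d)%N.
Hypothesis M0 : 0 <= M.
Hypothesis XM : forall u, boxed M (X u).
Hypothesis generic : forall Z : {set faceidx d H},
  (exists y, forall i, i \in Z -> affv (fnormal (fun h => rsubmx (q h)))
      (foffset (m := d) (fun h => lsubmx (q h) 0 0) M) i y = 0) -> (#|Z| <= d)%N.

Let C2 := (64 * (d.+1 * d.+1))%N.

Lemma cross_setE h U :
  cross_set (fun h => rsubmx (q h)) (fun h => lsubmx (q h) 0 0) X h U = crossing X (q h) U.
Proof.
by rewrite /cross_set /crossing; congr (_ && _); apply: eq_existsb => u;
  rewrite /affh dot_hom addrC.
Qed.

Lemma round (w : H -> R) m j (U : {set J}) : (forall h, 0 <= w h) -> 0 < \sum_h w h ->
  (0 < j)%N -> #|U| = (j * m)%N -> exists U' : {set J}, [/\ U' \subset U, #|U'| = m &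
   (froot d j)%:R * \sum_h w h * (crossing X (q h) U')%:R <= C2%:R * \sum_h w h].
Proof.
move=> w0 W0 j0 Uj; set a := froot d j.
(* For such small roots [a <= C2], and any [m] points will do. *)
have [asmall|abig] := ltnP a (32 * d + 16).
  have [|U' [_ U'U U'm]] := @subset_of_card _ set0 U m (sub0set _).
    by rewrite cards0 Uj leq_pmull.
  exists U'; split=> //; apply: (@le_trans _ _ (a%:R * \sum_h w h)).
    rewrite ler_wpM2l//; apply: ler_sum => h _; rewrite -[leRHS]mulr1 ler_wpM2l//.
    by case: crossing; rewrite ?ler01 ?lexx.
  by rewrite ler_wpM2r ?(ltW W0)// ler_nat /C2; nia.
(* Then [2 * label_bound t <= (8 (t + 2 d + 1))^d <= a^d <= j], using [a >= 32 d + 16], so the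
   cluster has at least [m] points. Moreover [a <= 16 (t + 1)], and [C2] is 16 times the constant
   [4 (d+1)^2] of [cluster]. *)
pose t := (a %/ 16)%N.
have [V [VU UV Vw]] := cluster M0 XM w0 W0 generic t U.
have Vm : (m <= #|V|)%N.
  rewrite -(leq_pmul2l j0) -Uj; apply: (leq_trans UV); rewrite leq_mul2r; apply/orP; right.
  apply: leq_trans (froot_exp j d0); rewrite -/a /label_bound.
  apply: (@leq_trans ((8 * (t + 2 * d).+1) ^ d)); last by apply: leq_exp_base; rewrite /t; lia.
  rewrite expnMn mulnCA [X in (_ <= X)%N]mulnC leq_mul2l; apply/orP; right.
  have : (d.+1 <= 2 ^ d)%N by apply: ltn_expl.
  have : (2 <= 2 ^ d)%N by rewrite -[X in (X <= _)%N]expn1 leq_exp2l.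
  have -> : (8 ^ d = 2 ^ d * 2 ^ d * 2 ^ d)%N by rewrite -!expnMn.
  by move=> h1 h2; rewrite mulnA leq_mul// leq_mul.
have [|U' [_ U'V U'm]] := @subset_of_card _ set0 V m (sub0set _).
  by rewrite cards0 Vm.
exists U'; split=> //; first exact: subset_trans VU.
apply: (@le_trans _ _ (16 * (t.+1%:R * \sum_h w h * (crossing X (q h) V)%:R))).
  rewrite mulrA -natrM; apply: ler_pM => //; first by apply: sumr_ge0 => h _; rewrite mulr_ge0.
    by rewrite ler_nat /t; lia.
  apply: ler_sum => h _; rewrite ler_wpM2l// ler_nat.
  by have := @crossing_sub _ _ _ X (q h) _ _ U'V; case: crossing => // ->.
apply: le_trans (_ : 16 * ((4 * (d.+1 * d.+1))%:R * \sum_h w h) <= _).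
  rewrite ler_wpM2l//; move: Vw; under eq_bigr do rewrite cross_setE; by [].
by rewrite mulrA -natrM /C2 mulnA.
Qed.

(* The tests crossing a new class have their weight doubled. *)
Lemma rounds m j (w : H -> R) (U : {set J}) : (forall h, 0 <= w h) -> 0 < \sum_h w h ->
  #|U| = (j * m)%N -> exists cl : J -> nat, [/\ forall u, u \in U -> (cl u < j)%N,
    forall i, (i < j)%N -> #|[set u in U | cl u == i]| = m &
    \sum_h w h * 2 ^+ (\sum_(i < j) crossing X (q h) [set u in U | cl u == i])
      <= (\sum_h w h) * \prod_(1 <= i < j.+1) (1 + C2%:R / (froot d i)%:R)].
Proof.
elim: j w U => [|j IH] w U w0 W0 Uj.
  exists (fun=> 0%N); split=> // [u|].
    by have := cards0_eq Uj => ->; rewrite inE.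
  rewrite big_geq// mulr1; under eq_bigr do rewrite big_ord0 expr0 mulr1.
  by [].
have [U' [U'U U'm U'w]] := round w0 W0 (ltn0Sn j) Uj.
pose w' h := w h * 2 ^+ (crossing X (q h) U').
have w'0 h : 0 <= w' h by rewrite mulr_ge0// exprn_ge0.
have w'E h : w' h = w h + w h * (crossing X (q h) U')%:R.
  by rewrite /w'; case: crossing; rewrite /= ?expr1 ?expr0; ring.
have W'0 : 0 < \sum_h w' h.
  under eq_bigr do rewrite w'E; rewrite big_split/= ltr_wpDr// sumr_ge0// => h _.
  exact: mulr_ge0.
have a0 : 0 < (froot d j.+1)%:R :> R by rewrite ltr0n; apply: froot_ge => //; rewrite exp1n.
have W'W : \sum_h w' h <= (\sum_h w h) * (1 + C2%:R / (froot d j.+1)%:R).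
  under eq_bigr do rewrite w'E; rewrite big_split/= mulrDr mulr1 lerD2l.
  by rewrite mulrA ler_pdivlMr// mulrC [leRHS]mulrC.
have U1 : #|U :\: U'| = (j * m)%N by rewrite cardsD (setIidPr U'U) U'm Uj mulSn addKn.
have [cl' [cl'j cl'm cl'w]] := IH w' _ w'0 W'0 U1.
pose cl u := if u \in U' then j else cl' u.
have clE i : (i < j)%N -> [set u in U | cl u == i] = [set u in U :\: U' | cl' u == i].
  move=> ij; apply/setP => u; rewrite !inE /cl; case: (u \in U') => //=.
  by rewrite gtn_eqF// andbF.
have clj : [set u in U | cl u == j] = U'.
  apply/setP => u; rewrite !inE /cl; have [uU'|uU'] := boolP (u \in U').
    by rewrite eqxx (subsetP U'U).
  apply/negP => /andP[uU /eqP E]; have := cl'j u; rewrite E ltnn inE uU' uU => /(_ isT).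
  by [].
exists cl; split.
- move=> u uU; rewrite /cl; case: ifPn => // uU'; rewrite ltnS ltnW// cl'j//.
  by rewrite inE uU' uU.
- move=> i; rewrite ltnS leq_eqVlt => /predU1P[->|ij]; first by rewrite clj.
  by rewrite clE// cl'm.
- rewrite big_nat_recr//= [_ * (1 + _)]mulrC mulrA.
  apply: (@le_trans _ _ ((\sum_h w' h) * \prod_(1 <= i < j.+1) (1 + C2%:R / (froot d i)%:R))).
    apply: le_trans cl'w; apply: ler_sum => h _.
    have E : (\sum_(i < j) crossing X (q h) [set u in U | cl u == i] =
        \sum_(i < j) crossing X (q h) [set u in U :\: U' | cl' u == i])%N.
      by apply: eq_bigr => i _; rewrite clE.
    by rewrite big_ord_recr/= clj E exprD /w' [2 ^+ _ * 2 ^+ _]mulrC mulrA.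
  apply: ler_wpM2r; first by apply: prodr_ge0 => i _; rewrite addr_ge0// divr_ge0.
  exact: W'W.
Qed.

Lemma expR_half_le2 : expR 2^-1 <= 2 :> R.
Proof.
rewrite -[leLHS]invrK -expRN invf_ple ?posrE ?expR_gt0//.
by have := expR_ge1Dx (- 2^-1 : R); lra.
Qed.

(** A test crossing [N] classes ends with weight [2^N], at most the final total, which is [#|H|]
    times the exponential of the sum of the [C2 / froot d i]. Logarithms bound [N]. *)
Lemma partition_tests m k h0 : (1 < d)%N -> (0 < k)%N -> (0 < #|H|)%N -> (#|H| <= 2 ^ h0)%N ->
  #|J| = (k ^ d * m)%N -> exists cl : J -> nat, [/\ forall u, (cl u < k ^ d)%N,
    forall i, (i < k ^ d)%N -> #|[set u | cl u == i]| = m &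
    forall h, (\sum_(i < k ^ d) crossing X (q h) [set u | cl u == i]
       <= 2 * (h0 + C2 * ((2 * d).+1 * k ^ d.-1)))%N].
Proof.
move=> d1 k0 H0 Hh Jk.
have HW : \sum_(h : H) 1 = #|H|%:R :> R by rewrite sumr_const.
have [cl [clk clm clw]] : exists cl : J -> nat, [/\ forall u, u \in [set: J] -> (cl u < k ^ d)%N,
    forall i, (i < k ^ d)%N -> #|[set u in [set: J] | cl u == i]| = m &
    \sum_(h : H) 1 * 2 ^+ (\sum_(i < k ^ d) crossing X (q h) [set u in [set: J] | cl u == i])
      <= (\sum_(h : H) 1) * \prod_(1 <= i < (k ^ d).+1) (1 + C2%:R / (froot d i)%:R) :> R].
  by apply: rounds; rewrite ?HW ?ltr0n ?cardsT.
have setE i : [set u in [set: J] | cl u == i] = [set u | cl u == i] by apply/setP => u; rewrite !inE.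
exists cl; split=> [u|i ik|h]; first by apply: clk; rewrite inE.
  by rewrite -setE clm.
set N := (\sum_(i < _) _)%N.
have NE : N = (\sum_(i < k ^ d) crossing X (q h) [set u in [set: J] | cl u == i])%N.
  by apply: eq_bigr => i _; rewrite setE.
pose S : R := C2%:R * ((2 * d).+1 * k ^ d.-1)%:R.
have prodS : \prod_(1 <= i < (k ^ d).+1) (1 + C2%:R / (froot d i)%:R) <= expR S.
  apply: (@le_trans _ _ (expR (\sum_(1 <= i < (k ^ d).+1) C2%:R / (froot d i)%:R))).
    rewrite expR_sum; apply: ler_prod => i _; rewrite addr_ge0 ?divr_ge0//=.
    exact: expR_ge1Dx.
  by rewrite ler_expR -mulr_sumr ler_wpM2l// froot_sum.
have : expR (2^-1 * N%:R) <= expR (h0%:R + S).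
  apply: (@le_trans _ _ (2 ^+ N)).
    rewrite mulrC expRM_natl; apply: lerXn2r; rewrite ?nnegrE ?expR_ge0//.
    exact: expR_half_le2.
  apply: (@le_trans _ _ (#|H|%:R * expR S)).
    rewrite -HW; apply: le_trans (ler_wpM2l _ prodS); last by rewrite HW.
    apply: le_trans clw; rewrite (bigD1 h)//= mul1r -NE lerDl.
    by apply: sumr_ge0 => h' _; rewrite mul1r exprn_ge0.
  rewrite expRD ler_wpM2r ?expR_ge0//; apply: (@le_trans _ _ (2 ^+ h0)).
    by rewrite -natrX ler_nat.
  rewrite -[h0%:R]mulr1 expRM_natl; apply: lerXn2r; rewrite ?nnegrE ?expR_ge0//.
  by have := expR_ge1Dx (1 : R).
rewrite ler_expR /S -natrM -natrD => h1.
have : N%:R <= (2 * (h0 + C2 * ((2 * d).+1 * k ^ d.-1)))%:R :> R by rewrite natrM; lra.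
by rewrite ler_nat.
Qed.

End Partition.

Lemma expn_le_exp2 k e : (k ^ e <= e ^ e * 2 ^ k)%N.
Proof.
have [->|e0] := posnP e; first by rewrite !expn0 mul1n expn_gt0.
apply: (@leq_trans ((e * 2 ^ (k %/ e)) ^ e)).
  apply: leq_exp_base; apply: (@leq_trans (e * (k %/ e).+1)).
    by rewrite {1}(divn_eq k e) mulnS addnC mulnC leq_add2r ltnW ?ltn_mod.
  by rewrite leq_mul2l ltn_expl// orbT.
by rewrite expnMn -expnM leq_mul2l leq_exp2l// leq_trunc_div orbT.
Qed.

Lemma expn_lt_exp2 A e : exists k0, forall k, (k0 <= k)%N -> (A * k ^ e < 2 ^ k)%N.
Proof.
exists (A * e.+1 ^ e.+1).+1 => k kA.
have k0 : (0 < k)%N by apply: leq_ltn_trans kA.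
rewrite -(ltn_pmul2l k0); apply: (@leq_ltn_trans (A * e.+1 ^ e.+1 * 2 ^ k)).
  by rewrite mulnCA -expnS -mulnA leq_mul2l expn_le_exp2 orbT.
by rewrite ltn_pmul2r ?expn_gt0.
Qed.

(** In units of [k^(d-1)]: each of the [d + 2] tests at the vertices of a simplex crosses at most
    [2 (2 + C2 (2 d + 1))] classes, where the inner 2 comes from the logarithm [2 k^2] of the number
    of tests; the zone of the simplex contains at most one unit. *)
Definition kappa d := (2 * d.+2 * (2 + 64 * (d.+1 * d.+1) * (2 * d).+1)).+1.

Lemma partition_theorem (R : realType) d : (2 < d)%N -> exists k0, forall k, (k0 <= k)%N ->
  forall m (J : finType) (X : J -> 'rV[R]_d), (0 < m)%N -> #|J| = (k ^ d * m)%N ->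
  exists cl : J -> nat, [/\ forall u, (cl u < k ^ d)%N,
    forall i, (i < k ^ d)%N -> #|[set u | cl u == i]| = m &
    forall h, avoids X h ->
      (\sum_(i < k ^ d) crossing X h [set u | cl u == i] <= kappa d * k ^ d.-1)%N].
Proof.
move=> d2; pose D := (d.+2 * d.+2)%N.
have [k1 k1P] := expn_lt_exp2 (2 ^ D * simplex_bound d.+1 D) (2 * D).
have [k2 k2P] := expn_lt_exp2 ((2 * d + 4) ^ d.+1 * d.+2) (2 * d.+1).
exists (maxn (maxn k1 k2) D.+1) => k; rewrite !geq_max => /andP[/andP[/k1P{}k1P /k2P{}k2P] Dk].
move=> m J X m0 Jk.
have k0 : (0 < k)%N by apply: leq_ltn_trans Dk.
have J0 : (0 < #|J|)%N by rewrite Jk muln_gt0 expn_gt0 k0.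
(* This keeps [s <= k^2], while [2^l] still outgrows the polynomial in [s] required by
   [test_set]. *)
pose l := (k - D)%N; pose s := (k * l + D)%N.
have sk : (s <= k ^ 2)%N.
  rewrite /s /l mulnBr -mulnn; have : (D <= k * D)%N by rewrite leq_pmull.
  have : (k * D <= k * k)%N by rewrite leq_mul2l ltnW ?orbT.
  by lia.
have cond : (s ^ D * simplex_bound d.+1 D < 2 ^ l)%N.
  rewrite -(ltn_pmul2l (expn_gt0 2 D : (0 < 2 ^ D)%N)) -expnD subnKC ?(ltnW Dk)//.
  apply: leq_ltn_trans k1P; rewrite mulnCA mulnC leq_mul2l expnM.
  by rewrite leq_exp_base// orbT.
have [q qav qP] := test_set X k0 J0 cond.
pose H : finType := ('I_(simplex_bound d.+1 s) * 'I_d.+2)%type.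
have Hcard : (#|H| <= 2 ^ (2 * k ^ 2))%N.
  rewrite card_prod !card_ord /simplex_bound.
  have -> : (2 * k ^ 2 = k ^ 2 + k ^ 2)%N by rewrite mul2n addnn.
  rewrite expnD -mulnA; apply: leq_mul; first by rewrite leq_exp2l.
  apply: (@leq_trans (2 ^ k)); last by rewrite leq_exp2l// -{1}(expn1 k) leq_pexp2l.
  apply: leq_trans (ltnW k2P); rewrite mulnAC leq_mul2r; apply/orP; right.
  rewrite expnM -expnMn leq_exp_base//.
  have : (1 <= k ^ 2)%N by rewrite expn_gt0 k0.
  by move: sk; move: (k ^ 2)%N => K; nia.
have H0 : (0 < #|H|)%N.
  by rewrite card_prod !card_ord /simplex_bound !muln_gt0 !expn_gt0.
pose M : R := 1 + \sum_u \sum_j `|X u 0 j|.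
have M0 : 0 < M.
  by rewrite ltr_pwDl// sumr_ge0// => u _; apply: sumr_ge0.
have XM u : boxed M (X u).
  move=> j; rewrite /M (bigD1 u)//= (bigD1 j)//=.
  rewrite addrCA -!addrA lerDl !addr_ge0 ?sumr_ge0// => v _; exact: sumr_ge0.
have [q' q'W q'G] := @generic_perturbation R d H M M0 (fun i => q i.1 i.2) [seq hom (X u) | u <- enum J].
have [|cl [clk clm clq]] := @partition_tests R d J X H q' M (ltnW (ltnW d2)) (ltW M0) XM q'G m k (2 * k ^ 2) (ltnW d2) k0 H0 Hcard.
  exact: Jk.
exists cl; split=> // h hav.
have [c [Z [Zk cP]]] := qP h hav.
have qq' j U : crossing X (q c j) U -> crossing X (q' (c, j)) U.
  move=> /andP[/existsP[u /andP[uU hu]] /existsP[v /andP[vU hv]]].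
  have ss w : w \in J -> True by [].
  have sW u' := q'W (c, j) (hom (X u')) (map_f _ (mem_enum J u')).
  apply/andP; split; apply/existsP; [exists u; rewrite uU|exists v; rewrite vU].
    by rewrite dotC; apply: (sW u).1; rewrite dotC.
  by rewrite dotC; apply: (sW v).2; rewrite dotC.
(* The zone holds at most [1/k] of the points, hence at most [k^(d-1)] whole classes. *)
have Zcount : (\sum_(i < k ^ d) ([set u | cl u == i] \subset Z) <= k ^ d.-1)%N.
  rewrite -(leq_pmul2r m0) -(leq_pmul2r k0).
  have -> : (k ^ d.-1 * m * k = k ^ d * m)%N by rewrite mulnAC -expnSr prednK//; lia.
  rewrite -Jk; apply: leq_trans Zk; rewrite leq_mul2r; apply/orP; right.
  rewrite big_distrl/=.
  have -> : #|Z| = (\sum_(i < k ^ d) #|[set u in Z | cl u == i]|)%N.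
    rewrite -sum1_card (partition_big (fun u => Ordinal (clk u)) xpredT)//=.
    apply: eq_bigr => i _; rewrite -sum1_card; apply: eq_bigl => u; rewrite inE.
    by rewrite -val_eqE.
  apply: leq_sum => i _; case: (boolP (_ \subset Z)) => [sZ|_]; last by rewrite mul0n.
  rewrite mul1n -(clm i (ltn_ord i)); apply/subset_leq_card/subsetP => u uc.
  by rewrite inE (subsetP sZ)//; move: uc; rewrite inE.
have bound : (\sum_(i < k ^ d) crossing X h [set u | cl u == i] <=
    \sum_(i < k ^ d) ([set u | cl u == i] \subset Z) +
    \sum_(j < d.+2) \sum_(i < k ^ d) crossing X (q' (c, j)) [set u | cl u == i])%N.
  rewrite [X in (_ <= _ + X)%N]exchange_big/= -big_split/=; apply: leq_sum => i _.
  have [cr|//] := boolP (crossing X h _).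
  have [[j /qq' hj]|->//] := cP _ cr.
  by rewrite (bigD1 j)//= hj addnCA.
apply: (leq_trans bound).
have -> : (kappa d * k ^ d.-1 = k ^ d.-1 +
    2 * d.+2 * (2 + 64 * (d.+1 * d.+1) * (2 * d).+1) * k ^ d.-1)%N by rewrite /kappa mulSn.
apply: leq_add => //.
(* Here [d >= 3] is essential: the logarithm [2 k^2] of the number of tests has to be of order
   [k^(d-1)]. *)
have k2d : (k ^ 2 <= k ^ d.-1)%N by rewrite leq_pexp2l//; lia.
apply: (@leq_trans (\sum_(j < d.+2) 2 * ((2 + 64 * (d.+1 * d.+1) * (2 * d).+1) * k ^ d.-1))).
  apply: leq_sum => j _; apply: leq_trans (clq (c, j)) _.
  rewrite leq_mul2l/= mulnDl leq_add ?leq_mul2l//.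
  by rewrite mulnA.
by rewrite sum_nat_const card_ord mulnCA !mulnA.
Qed.

(** * Weak nets *)

Lemma set_ffun (T : finType) (A : {set T}) d : (#|A| <= d)%N ->
  exists f : {ffun 'I_d -> option T}, forall x, x \in A <-> exists k, f k = Some x.
Proof.
move=> Ad; exists [ffun k : 'I_d => nth None (map Some (enum A)) k] => x; split=> [xA|[k]].
  have lt : (index x (enum A) < d)%N by apply: leq_trans Ad; rewrite cardE index_mem mem_enum.
  by exists (Ordinal lt); rewrite ffunE (nth_map x) ?index_mem ?mem_enum// nth_index// mem_enum.
rewrite ffunE; have [ks|ks] := ltnP k (size (enum A)); last by rewrite nth_default ?size_map.
by rewrite (nth_map x)// => -[<-]; rewrite -mem_enum mem_nth.
Qed.

(** * Center points from finitely many candidates *)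

Section Center.
Context (R : realFieldType) (d : nat) (I : finType) (z : I -> 'rV[R]_d).

(* Basic solutions give a finite set of candidates: functionals vanishing at [d] of the points [z i],
   and points annihilated by [d] of these functionals. *)
Definition funidx : finType := ({ffun 'I_d -> option I} * 'I_(1 + d) * bool)%type.

Definition annih (f : {ffun 'I_d -> option I}) : 'M[R]_(1 + d) :=
  kermx (\matrix_(j < 1 + d, k < d) if f k is Some i then hom (z i) 0 j else 0).

Definition cfun (g : funidx) : 'rV[R]_(1 + d) :=
  (if g.2 then 1 else -1) *: row g.1.2 (annih g.1.1).

Definition cpoint (G : {ffun 'I_d -> option funidx}) : 'rV[R]_d :=
  xget 0 [set c | forall k g, G k = Some g -> dot (cfun g) (hom c) = 0]%classic.

Lemma annihP f g : (g <= annih f)%MS <-> forall k i, f k = Some i -> dot g (hom (z i)) = 0.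
Proof.
have E k : (g *m (\matrix_(j < 1 + d, k < d) if f k is Some i then hom (z i) 0 j else 0)) 0 k
    = if f k is Some i then dot g (hom (z i)) else 0.
  rewrite mxE; case fk: (f k) => [i|]; last by rewrite big1// => j _; rewrite mxE fk mulr0.
  by apply: eq_bigr => j _; rewrite mxE fk.
split=> [/sub_kermxP/rowP H k i fk|H].
  by have := H k; rewrite E fk mxE.
by apply/sub_kermxP/rowP => k; rewrite E mxE; case fk: (f k) => [i|//]; apply: H fk.
Qed.

(** By Helly's theorem the half-spaces of the candidate functionals negative at few points meet, and
    a basic solution moves their common point to a candidate [c]. If some [h] were negative at [c]
    and at few points, another basic solution would turn it into a candidate functional with the
    same property. *)
Lemma center (J : {set I}) : (0 < #|J|)%N -> exists G, forall h : 'rV[R]_(1 + d),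
  dot h (hom (cpoint G)) < 0 ->
  (#|J| <= d.+1 * #|[set i in J | (dot h (hom (z i)) < 0)%R]|)%N.
Proof.
move=> J0; pose bad h := [set i in J | dot h (hom (z i)) < 0].
pose V := [set g : funidx | (#|bad (cfun g)| * d.+1 < #|J|)%N].
have [|B BV Bd|x0 x0P] := @helly R d funidx (fun g => [set x | 0 <= dot (cfun g) (hom x)]%classic) V.
- move=> g _ x y t /andP[t0 t1] /=; rewrite !dot_hom dotDr !dotZr => h1 h2.
  have -> : lsubmx (cfun g) 0 0 + (t * dot (rsubmx (cfun g)) x + (1 - t) * dot (rsubmx (cfun g)) y)
    = t * (lsubmx (cfun g) 0 0 + dot (rsubmx (cfun g)) x)
      + (1 - t) * (lsubmx (cfun g) 0 0 + dot (rsubmx (cfun g)) y) by ring.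
  by rewrite addr_ge0// mulr_ge0// subr_ge0.
- have [->|/set0Pn[g0 g0B]] := eqVneq B set0; first by exists 0 => g; rewrite inE.
  have [i iJ ib] : exists2 i, i \in J & forall g, g \in B -> i \notin bad (cfun g).
    apply: contrapT => ni.
    have cov : J \subset \bigcup_(g in B) bad (cfun g).
      apply/subsetP => i iJ; apply: contraT => nb; exfalso; apply: ni; exists i => // g gB.
      by apply: contra nb => ib; apply/bigcupP; exists g.
    have : (#|J| <= \sum_(g in B) #|bad (cfun g)|)%N.
      apply: leq_trans (subset_leq_card cov) _.
      elim/big_rec2: _ => [|g s1 s2 _ IH]; first by rewrite cards0.
      by apply: leq_trans (leq_card_setU _ _) _; rewrite leq_add2l.
    rewrite leqNgt => /negP; apply; rewrite -(@ltn_pmul2r d.+1)// big_distrl/=.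
    apply: (@leq_trans (\sum_(g in B) #|J|)); last by rewrite sum_nat_const mulnC leq_mul2l Bd orbT.
    rewrite (bigD1 g0)//= [X in (_ < X)%N](bigD1 g0)//= -addSn leq_add//.
      by have := subsetP BV _ g0B; rewrite inE.
    by apply: leq_sum => g /andP[/(subsetP BV)]; rewrite inE => /ltnW.
  exists (z i) => g gB /=; have := ib g gB.
  by rewrite inE iJ/= -leNgt.
have [T [TV Td [c1 c1T] Tfeas]] := @basic_solution R d funidx V (fun g => rsubmx (cfun g))
  (fun g => - lsubmx (cfun g) 0 0) x0 (fun g gV => ltac:(by have := x0P g gV; rewrite /= dot_hom; lra)).
have [G GP] := set_ffun Td.
exists G; set c := cpoint G.
have cV g : g \in V -> 0 <= dot (cfun g) (hom c).
  have cT : forall k g, G k = Some g -> dot (cfun g) (hom c) = 0.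
    apply: (@xgetPex _ 0 [set c | forall k g, G k = Some g -> dot (cfun g) (hom c) = 0]%classic).
    exists c1 => k g' Gk /=; rewrite dot_hom c1T ?addrN//.
    by apply/GP; exists k.
  move=> gV; rewrite dot_hom -lerBlDl sub0r; apply: Tfeas gV => g' /GP[k Gk].
  by have := cT _ _ Gk; rewrite dot_hom; lra.
move=> h hc; rewrite leqNgt; apply/negP => small.
pose A : {set option I} := None |: Some @: [set i in J | 0 <= dot h (hom (z i))].
pose a (o : option I) := if o is Some i then hom (z i) else - hom c.
pose b (o : option I) : R := if o is Some i then 0 else 1.
have [|S [SA Sd [g1 g1S] Sfeas]] := @basic_solution R (1 + d) _ A a b ((- dot h (hom c))^-1 *: h).
  have p0 : 0 < - dot h (hom c) by rewrite oppr_gt0.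
  case=> [i|_] /=; last by rewrite dotZr dotNl dotC mulVf// gt_eqF.
  rewrite !inE/= mem_imset; last by move=> ? ? [].
  by rewrite inE => /andP[_ hi]; rewrite dotZr dotC mulr_ge0// invr_ge0 ltW.
(* The normalization at [c] is tight: otherwise 0 solves the equations of [S] and would be feasible.
   So at most [d] members of [S] are points. *)
have NS : None \in S.
  apply: contraT => NS; have := Sfeas 0 _ None; rewrite /= !inE dot0r => /(_ _ isT)/wrap[].
    by case=> [i iS|]; rewrite ?dot0r// (negPf NS).
  by rewrite ler10.
pose T' := [set i | Some i \in S].
have T'd : (#|T'| <= d)%N.
  have inj : injective (@Some I) by move=> ? ? [].
  rewrite -ltnS; apply: leq_trans Sd; rewrite (cardsD1 None S) NS add1n ltnS -(card_imset _ inj).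
  by apply/subset_leq_card/subsetP => _ /imsetP[i + ->]; rewrite !inE.
have [f fP] := set_ffun T'd.
have g1A : (g1 <= annih f)%MS.
  apply/annihP => k i fk; have : i \in T' by apply/fP; exists k.
  by rewrite inE => /g1S; rewrite /= dotC.
(* [g1] is a combination of rows of [annih f] and does not vanish at [c], so neither does some row.
   Suitably scaled, that row solves the equations of [S] and is feasible. *)
have [r rc] : exists r, dot (row r (annih f)) (hom c) != 0.
  apply: contrapT => nr; have := g1S _ NS; rewrite /= dotNl => /eqP.
  have /submxP[Dm ->] := g1A; rewrite mulmx_sum_row dot_sumr big1; last first.
    move=> r _; rewrite dotZr dotC; suff -> : dot (row r (annih f)) (hom c) = 0 by rewrite mulr0.
    by apply/eqP; apply: contraT => rc; case: nr; exists r.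
  by rewrite oppr0 eq_sym oner_eq0.
pose g : funidx := (f, r, dot (row r (annih f)) (hom c) < 0).
have gc : dot (cfun g) (hom c) < 0.
  rewrite dotZl /g/=; move: rc; rewrite neq_lt; case: ltP => [v0 _|_ /= v0].
    by rewrite mul1r.
  by rewrite mulN1r oppr_lt0.
have gann : (cfun g <= annih f)%MS by rewrite scalemx_sub// row_sub.
have gpos i : i \in J -> 0 <= dot h (hom (z i)) -> 0 <= dot (cfun g) (hom (z i)).
  move=> iJ hi; have p0 : 0 < - dot (cfun g) (hom c) by rewrite oppr_gt0.
  have := Sfeas ((- dot (cfun g) (hom c))^-1 *: cfun g) _ (Some i).
  move=> /(_ _ _)/wrap[].
  - case=> [j jS|_] /=; last by rewrite dotZr dotNl dotC mulVf// gt_eqF.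
    rewrite dotZr dotC; have [k fk] : exists k, f k = Some j by apply/fP; rewrite inE.
    by have /annihP/(_ k j fk) -> := gann; rewrite mulr0.
  - by rewrite !inE/= mem_imset; [rewrite inE iJ|move=> ? ? []].
  - by rewrite /= dotZr dotC pmulr_rge0// invr_gt0.
have gV : g \in V.
  rewrite inE; apply: leq_ltn_trans small; rewrite mulnC leq_mul2l/=.
  apply/subset_leq_card/subsetP => i; rewrite !inE => /andP[iJ gi].
  by rewrite iJ ltNge; apply: contraTN gi => hi; rewrite -leNgt gpos.
by have := cV g gV; rewrite leNgt gc.
Qed.

End Center.

(** Of order [k^(d^3)] in [k] when [r = k^d]. *)
Definition center_bound d r := ((r.+1 ^ d * d.+1 * 2).+1 ^ d)%N.

Lemma card_centers d (I : finType) : #|{ffun 'I_d -> option (funidx d I)}| = center_bound d #|I|.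
Proof.
by rewrite card_ffun card_option card_ord !card_prod card_ffun card_option !card_ord card_bool.
Qed.

Lemma hom_neq0 (R : realFieldType) d (x : 'rV[R]_d) : hom x != 0.
Proof.
apply/eqP => /(congr1 (fun v => lsubmx v 0 0)); rewrite row_mxKl linear0 !mxE eqxx => /eqP.
by rewrite oner_eq0.
Qed.

Lemma weak_net_gt1 (R : realType) d (e : R) : 1 < e -> weak_net d e 0.
Proof.
move=> e1 X X0; exists [::] => // C _ h; exfalso.
have n0 : 0 < (size X)%:R :> R by rewrite ltr0n.
have : (count (fun x => `[< C x >]) X)%:R <= (size X)%:R :> R by rewrite ler_nat count_size.
have : (size X)%:R < e * (size X)%:R by rewrite ltr_pMl.
lra.
Qed.

(* A convex set that is dense in no class meets many classes.  If a center of representatives of these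
   classes were outside, a separating hyperplane would cross too many classes. *)
Lemma weak_net_step (R : realType) d : (2 < d)%N -> exists k0, forall k, (k0 <= k)%N -> (0 < k)%N ->
  forall (e : R) N, 0 < e -> weak_net d (e * k%:R / (d.+1 * kappa d)%:R) N ->
  weak_net d e (k ^ d * N + center_bound d (k ^ d)).
Proof.
move=> d2; have [k0 k0P] := partition_theorem R d2; exists k0 => k kk kpos e N e0.
set e' := e * _ / _ => net X X0; pose n := size X.
(* Every point is taken [k^d] times, so that [k^d] classes of exactly [n] points exist. *)
pose J : finType := ('I_(k ^ d) * 'I_n)%type.
pose Xf (u : J) := nth 0 X u.2.
have [|cl [clk clm clc]] := k0P k kk n J Xf X0; first by rewrite card_prod !card_ord.
pose fib (i : 'I_(k ^ d)) := [set u | cl u == i].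
have fibn i : #|fib i| = n by apply: clm.
pose Xi i := [seq Xf u | u <- enum (fib i)].
have sXi i : size (Xi i) = n by rewrite size_map -cardE fibn.
have exY i : exists Y : seq 'rV[R]_d, (size Y <= N)%N /\ forall C : set 'rV[R]_d, cvx C ->
   e' * n%:R <= (count (fun x => `[< C x >]) (Xi i))%:R -> exists2 y, y \in Y & C y.
  have [|Y YN YP] := net (Xi i); first by rewrite sXi.
  by exists Y; split=> // C cC; rewrite -(sXi i); apply: YP.
have [Y YP] := choice exY.
(* The representatives are arbitrary points of the classes, chosen before [C], so that the centers
   do not depend on [C]. *)
have exz i : exists u, u \in fib i by apply/card_gt0P; rewrite fibn.
have [zi ziP] := choice exz.
pose z i := Xf (zi i).
pose Yc := [seq cpoint z G | G <- enum {: {ffun 'I_d -> option (funidx d 'I_(k ^ d))}}].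
exists (flatten [seq Y i | i <- enum 'I_(k ^ d)] ++ Yc).
  rewrite size_cat leq_add//; last by rewrite size_map -cardE card_centers card_ord.
  rewrite size_flatten /shape -map_comp sumnE big_map big_enum/=.
  apply: (@leq_trans (\sum_(i < k ^ d) N)); last by rewrite sum_nat_const card_ord.
  by apply: leq_sum => i _; case: (YP i).
move=> C cC hC.
have [[i hi]|nhi] := pselect (exists i, e' * n%:R <= (count (fun x => `[< C x >]) (Xi i))%:R).
  have [y yY Cy] := (YP i).2 C cC hi; exists y => //.
  by rewrite mem_cat; apply/orP; left; apply/flatten_mapP; exists i; rewrite ?mem_enum.
pose Jc := [set i | [exists u in fib i, `[< C (Xf u) >]]].
have yex i : exists u, i \in Jc -> u \in fib i /\ C (Xf u).
  have [|_] := boolP (i \in Jc); last by exists (zi i).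
  by rewrite inE => /existsP[u /andP[ui /asboolP Cu]]; exists u.
have [y yP] := choice yex.
have n0 : 0 < n%:R :> R by rewrite ltr0n.
have k0R : 0 < k%:R :> R by rewrite ltr0n.
have kd0 : (0 < k ^ d)%N by rewrite expn_gt0 kpos.
have C00 : 0 < (d.+1 * kappa d)%:R :> R by rewrite ltr0n.
have total : (\sum_(i < k ^ d) count (fun x => `[< C x >]) (Xi i) = k ^ d * count (fun x => `[< C x >]) X)%N.
  transitivity (\sum_(u : J) `[< C (Xf u) >])%N.
    rewrite [RHS](partition_big (fun u => Ordinal (clk u)) xpredT)//=.
    apply: eq_bigr => i _; rewrite /Xi count_map -sum1_count big_enum_cond/= -big_mkcondr/=.
    by apply: eq_big => u; rewrite ?inE -?val_eqE//.
  rewrite -(pair_bigA _ (fun (_ : 'I_(k ^ d)) (j : 'I_n) => nat_of_bool `[< C (nth 0 X j) >]))/=.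
  rewrite sum_nat_const card_ord; congr (_ * _)%N.
  rewrite -sum1_count (big_nth 0) big_mkord [RHS]big_mkcond/=.
  by rewrite -/n; apply: eq_bigr => j _; case: asbool.
(* [C] holds at least [k^d e n] points, fewer than [e' n] in each class; so it meets more than
   [k^d e / e' = (d+1) kappa k^(d-1)] classes. *)
have Jbig : (d.+1 * (kappa d * k ^ d.-1) < #|Jc|)%N.
  have lt : (k ^ d * count (fun x => `[< C x >]) X)%:R < #|Jc|%:R * (e' * n%:R).
    rewrite -total natr_sum (bigID (mem Jc))/= [X in _ + X]big1 ?addr0; last first.
      move=> i iJ; apply/eqP; rewrite pnatr_eq0 -leqn0 leqNgt -has_count; apply/negP.
      move=> /hasP[x /mapP[u]]; rewrite mem_enum => ui -> Cu; case/negP: iJ.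
      by rewrite inE; apply/existsP; exists u; rewrite ui.
    have lti i : (count (fun x => `[< C x >]) (Xi i))%:R < e' * n%:R.
      by rewrite ltNge; apply/negP => hi; apply: nhi; exists i.
    have [i0 i0J] : exists i, i \in Jc.
      apply/set0Pn; apply/eqP => J0; move: total hC; rewrite big1 => [|i _].
        move/esym/eqP; rewrite muln_eq0 => /orP[|/eqP->]; first by rewrite -leqn0 leqNgt kd0.
        by rewrite leNgt mulr_gt0.
      apply/eqP; rewrite -leqn0 leqNgt -has_count; apply/negP.
      move=> /hasP[x /mapP[u]]; rewrite mem_enum => ui -> Cu.
      suff : i \in Jc by rewrite J0 inE.
      by rewrite inE; apply/existsP; exists u; rewrite ui.
    rewrite mulr_natl -sumr_const (bigD1 i0)//= [ltRHS](bigD1 i0)//=.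
    by rewrite ltr_leD// ler_sum// => i _; apply: ltW.
  have h1 : (k ^ d)%:R * (e * n%:R) <= (k ^ d * count (fun x => `[< C x >]) X)%:R.
    by rewrite natrM ler_wpM2l.
  have := le_lt_trans h1 lt; rewrite /e'.
  have -> : (k ^ d)%:R * (e * n%:R) = (k ^ d.-1)%:R * (k%:R * (e * n%:R)) :> R.
    by rewrite [RHS]mulrA -natrM -expnSr prednK//; lia.
  have -> : #|Jc|%:R * (e * k%:R / (d.+1 * kappa d)%:R * n%:R) =
     #|Jc|%:R / (d.+1 * kappa d)%:R * (k%:R * (e * n%:R)).
    by move: C00; move: (_%:R : R) => c c0; field; rewrite gt_eqF.
  rewrite ltr_pM2r ?mulr_gt0// ltr_pdivlMr// -natrM ltr_nat.
  by rewrite mulnC -mulnA.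
have Jc0 : (0 < #|Jc|)%N by apply: leq_ltn_trans Jbig.
have [G GP] := center z Jc0.
exists (cpoint z G); first by rewrite mem_cat; apply/orP; right; apply: map_f; rewrite mem_enum.
apply: contrapT => nC.
have nh : ~ hull Jc (fun i => Xf (y i)) (cpoint z G).
  by move=> hh; apply: nC; apply: hull_cvx cC _ hh => i /yP[].
have [h hpos hneg] := separation nh.
have [|h' h'W h'av] := @avoid_hyperplanes R (1 + d) h (hom (cpoint z G) :: [seq hom (Xf u) | u <- enum J])
  [seq hom (Xf u) | u <- enum J].
  by move=> _ /mapP[u _ ->]; apply: hom_neq0.
have hav : avoids Xf h' by move=> u; rewrite dotC; apply: h'av; apply: (map_f (fun v => hom (Xf v))); rewrite mem_enum.
have hc : dot h' (hom (cpoint z G)) < 0.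
  by rewrite dotC; apply: (h'W _ (mem_head _ _)).2; rewrite dotC.
(* At least [#|Jc| / (d+1)] representatives lie on the side of the center, while the points of [C]
   in their classes lie on the other side. *)
have := GP _ hc; rewrite leqNgt => /negP; apply; apply: leq_ltn_trans Jbig.
rewrite leq_mul2l/=; apply: leq_trans (clc h' hav).
rewrite -sum1_card big_mkcond/=; apply: leq_sum => i _; rewrite inE.
case: ifP => // /andP[iJ hzi]; have [yi _] := yP i iJ.
suff -> : crossing Xf h' [set u | cl u == i] by [].
apply/andP; split; apply/existsP.
  exists (y i); rewrite yi/= dotC; apply: (h'W (hom (Xf (y i))) _).1; last by rewrite dotC hpos.
  by rewrite inE; apply/orP; right; apply: (map_f (fun v => hom (Xf v))); rewrite mem_enum.
by exists (zi i); rewrite ziP.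
Qed.

(** Iterating one fixed step gives nets of some finite size for all [e] above a threshold: the base
    case of the recursion with growing [k]. *)
Lemma weak_net_coarse (R : realType) d k c :
  (forall (e : R) N, 0 < e -> weak_net d (2 * e) N -> weak_net d e (k * N + c)) ->
  forall n, exists N, forall e : R, 1 < 2 ^+ n * e -> weak_net d e N.
Proof.
move=> step; elim=> [|n [N IH]].
  by exists 0%N => e; rewrite expr0 mul1r; exact: weak_net_gt1.
exists (k * N + c)%N => e ne; have e0 : 0 < e.
  have p0 : 0 < 2 ^+ n.+1 :> R by rewrite exprn_gt0.
  by rewrite -(pmulr_rgt0 _ p0); lra.
by apply: step => //; apply: IH; rewrite mulrA -exprSr.
Qed.

Lemma weak_net_mono (R : realType) d (e e' : R) N N' :
  e <= e' -> (N <= N')%N -> weak_net d e N -> weak_net d e' N'.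
Proof.
move=> ee NN net X X0; have [Y YN YP] := net X X0; exists Y; first exact: leq_trans NN.
by move=> C cC h; apply: YP => //; apply: le_trans h; rewrite ler_wpM2r.
Qed.

Definition logmax (R : realType) (x : R) := Num.max 1 (ln x).

(* The constant is [28 = 2 * (13 + 1)], as [(d + 1) * kappa d <= d^13] for [d >= 3]. *)
Definition wexp (R : realType) d : R := 28 * d%:R ^+ 3 * ln d%:R.

Lemma ln2_le1 (R : realType) : ln 2 <= 1 :> R.
Proof. by have := @le_ln1Dx R 1; rewrite (_ : 1 + 1 = 2 :> R); [apply; lra|ring]. Qed.

Lemma ln3_ge1 (R : realType) : 1 <= ln 3 :> R.
Proof.
rewrite -[leLHS]expRK ler_ln ?posrE ?expR_gt0//.
have h : 5 / 6 <= expR (- 6^-1 : R) by have := expR_ge1Dx (- 6^-1 : R); lra.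
have E : expR 1 = (expR (- 6^-1 : R)) ^- 6.
  by rewrite -exprVn -expRN opprK -expRM_natl; congr expR; field.
rewrite E; apply: (@le_trans _ _ ((5 / 6) ^- 6)); last by lra.
rewrite lef_pV2 ?posrE ?exprn_gt0 ?expR_gt0//; last by lra.
by apply: lerXn2r; rewrite ?nnegrE ?expR_ge0//; lra.
Qed.

Lemma ln_constant (R : realType) d : (2 < d)%N ->
  ln (d.+1 * kappa d)%:R <= 13 * ln d%:R :> R.
Proof.
move=> d2; have dR : 0 < d%:R :> R by rewrite ltr0n; lia.
have C0 : 0 < (d.+1 * kappa d)%:R :> R by rewrite ltr0n.
rewrite mulr_natl -lnXn// ler_ln ?posrE ?exprn_gt0//.
(* [d + 1 <= 2 d], [kappa d <= 3081 d^4], and [2 * 3081 <= 3^8 <= d^8]. *)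
rewrite -natrX ler_nat; apply: (@leq_trans (3 ^ 8 * d ^ 5)).
  have e1 : (d.+1 <= 2 * d)%N by lia.
  have h1 : (64 * (d.+1 * d.+1) * (2 * d).+1 <= 768 * d ^ 3)%N.
    apply: (@leq_trans (64 * (2 * d * (2 * d)) * (3 * d))); last by rewrite !expnS expn0; lia.
    by rewrite leq_mul// ?leq_mul//; lia.
  have p3 : (1 <= d ^ 3)%N by rewrite expn_gt0; lia.
  have h2 : (kappa d <= 3081 * d ^ 4)%N.
    apply: (@leq_trans (2 * (2 * d) * (770 * d ^ 3)).+1).
      rewrite ltnS leq_mul//; first by lia.
      by lia.
    by rewrite (expnS d 3); nia.
  apply: (leq_trans (leq_mul e1 h2)); rewrite (expnS d 4).
  by rewrite mulnACA leq_mul2r; apply/orP; right.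
by rewrite (_ : 13 = 8 + 5)%N// expnD leq_mul2r (@leq_exp_base 3 d 8) ?orbT.
Qed.

(** With [C = (d+1) kappa d] this gives [(1 - 1/(2 d^2))^(wexp d) <= C^(-d) / 2], by
    [ln (1 - x) <= - x]: the shrinking logarithm pays for one level and leaves half of the bound. *)
Lemma wexp_ge (R : realType) d : (2 < d)%N ->
  2 * d%:R ^+ 2 * (d%:R * ln (d.+1 * kappa d)%:R + ln 2) <= wexp R d.
Proof.
move=> d2; have h := ln_constant R d2; have d3 : 3 <= d%:R :> R by rewrite ler_nat.
have l1 : 1 <= ln d%:R :> R.
  by apply: le_trans (ln3_ge1 R) _; rewrite ler_ln ?posrE ?ltr0n//; lia.
have l2 := ln2_le1 R.
have key (c l t x : R) : c <= 13 * l -> 1 <= l -> t <= 1 -> 3 <= x ->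
    2 * x ^+ 2 * (x * c + t) <= 28 * x ^+ 3 * l.
  move=> {}h {}l1 {}l2 {}d3.
  have xx : 0 <= x ^+ 2 by rewrite exprn_ge0; lra.
  have h1 : x * c + t <= 14 * x * l.
    have : x * c <= x * (13 * l) by rewrite ler_wpM2l//; lra.
    have : 1 * 1 <= x * l by rewrite ler_pM//; lra.
    lra.
  apply: (@le_trans _ _ (2 * x ^+ 2 * (14 * x * l))); first by rewrite ler_wpM2l// mulr_ge0.
  rewrite le_eqVlt; apply/orP; left; apply/eqP; ring.
exact: key.
Qed.

Lemma center_arith x y z e : (x <= z * y)%N -> (0 < y)%N -> (0 < z)%N ->
  ((x * e.+1 * 2).+1 <= z * e.+1 * 3 * y)%N.
Proof.
move=> h y0 z0; have h1 : (x * e.+1 <= z * y * e.+1)%N by rewrite leq_mul2r h orbT.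
have h2 : (1 <= z * y * e.+1)%N by rewrite !muln_gt0 z0 y0.
have -> : (z * e.+1 * 3 * y = z * y * e.+1 * 3)%N by ring.
lia.
Qed.

(* The recursion [f(b) <= k^d f(b C / k) + O(k^(d^3))] is solved with [k ~ b^(1/d^2)]. *)
Lemma weak_net_polylog (R : realType) d : (2 < d)%N -> exists2 A : R, 0 < A &
  forall b, 1 <= b -> exists2 N, weak_net d b^-1 N &
    N%:R <= A * b ^+ d * (logmax b) `^ (wexp R d).
Proof.
move=> d2; have [k0 k0P] := @weak_net_step R d d2.
have d0 : (0 < d)%N by lia.
pose C : R := (d.+1 * kappa d)%:R.
have C1 : 1 <= C by rewrite ler1n.
have C0 : 0 < C by apply: lt_le_trans C1.
pose s := (d * d)%N; have s0 : (0 < s)%N by rewrite muln_gt0 d0.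
have s0R : 0 < s%:R :> R by rewrite ltr0n.
(* [k >= K] implies [2 C <= k], so that a recursive call at least halves [b]. *)
pose K := (maxn k0 (2 * (d.+1 * kappa d))).+1.
have K0 : (0 < K)%N by [].
have KC : 2 * C <= K%:R by rewrite /C -natrM ler_nat /K; lia.
have coarse := @weak_net_coarse R d (K ^ d) (center_bound d (K ^ d)).
have {}coarse : forall n, exists N, forall e : R, 1 < 2 ^+ n * e -> weak_net d e N.
  apply: coarse => e N e0 net; apply: k0P => //; first by rewrite /K; lia.
  apply: weak_net_mono net => //; rewrite ler_pdivlMr// -/C.
  by rewrite mulrAC mulrC ler_wpM2l// ltW.
have l2C : 0 <= ln (2 * C) by rewrite ln_ge0//; lra.
(* Above [b0], [ln (2 C)] is at most [ln b / (2 s)], and the root [k] is at least [K]. *)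
pose L0 : R := 2 * s%:R * ln (2 * C) + 2.
pose b0 : R := expR L0 + (K ^ s)%:R.
have [n0 n0b] : exists n0, b0 < 2 ^+ n0.
  exists (Num.truncn b0).+1; apply: lt_trans (Num.Theory.truncnS_gt b0) _.
  by rewrite -natrX ltr_nat ltn_expl.
have [N0 N0P] := coarse n0.
pose cd := ((2 ^ d * d.+1 * 3) ^ d)%N.
(* [N0] serves the base case, and [2 * cd] lets the centers take at most half of the bound. *)
pose A : R := N0%:R + 2 * cd%:R + 1.
have A0 : 0 < A by rewrite /A ltr_wpDl// addr_ge0// mulr_ge0.
exists A => //.
have g0 : 0 <= wexp R d.
  by rewrite /wexp !mulr_ge0// ln_ge0// ler1n.
have lm1 (x : R) : 1 <= logmax x by rewrite /logmax le_max lexx.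
have lmp (x : R) : 1 <= logmax x `^ wexp R d.
  by rewrite -[leLHS](powRr0 (logmax x)) ler_powR.
have base b : 1 <= b -> b <= b0 -> exists2 N, weak_net d b^-1 N &
    N%:R <= A * b ^+ d * (logmax b) `^ (wexp R d).
  move=> b1 bb0; have bp : 0 < b by apply: lt_le_trans b1.
  exists N0; first by apply: N0P; rewrite ltr_pdivlMr// mul1r; apply: le_lt_trans n0b.
  apply: (@le_trans _ _ (A * 1 * 1)); first by rewrite !mulr1 /A -addrA lerDl addr_ge0// mulr_ge0.
  rewrite ler_pM ?mulr_ge0 ?(ltW A0)//; rewrite ler_wpM2l ?(ltW A0)//.
  by rewrite exprn_ege1.
suff H n : forall b, 1 <= b -> b <= b0 * 2 ^+ n -> exists2 N, weak_net d b^-1 N &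
    N%:R <= A * b ^+ d * (logmax b) `^ (wexp R d).
  move=> b b1; apply: (H (Num.truncn b).+1) => //.
  have b01 : 1 <= b0.
    by rewrite /b0 ler_wpDr// -[leLHS]expR0 ler_expR /L0 addr_ge0// !mulr_ge0.
  apply: (@le_trans _ _ (1 * 2 ^+ (Num.truncn b).+1)); last by rewrite ler_wpM2r ?exprn_ge0.
  rewrite mul1r; apply: ltW; apply: lt_trans (Num.Theory.truncnS_gt b) _.
  by rewrite -natrX ltr_nat ltn_expl.
elim: n => [|n IH] b b1 bn; first by apply: base => //; move: bn; rewrite expr0 mulr1.
have [bb0|bb0] := leP b b0; first exact: base.
have bp : 0 < b by apply: lt_le_trans b1.
have [k [kb Kk bk]] : exists k, [/\ (k ^ s)%:R <= b, (K <= k)%N & b < (2 * k%:R) ^+ s].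
  exists (froot s (Num.truncn b)); have Kk : (K <= froot s (Num.truncn b))%N.
    apply: froot_ge => //; rewrite truncn_ge_nat ?(ltW bp)//; apply/ltW.
    by apply: le_lt_trans bb0; rewrite /b0 lerDr expR_ge0.
  split=> //; first by rewrite -truncn_ge_nat ?(ltW bp)//; apply: froot_exp.
  have : (Num.truncn b < (froot s (Num.truncn b)).+1 ^ s)%N.
    by rewrite ltnNge; apply/negP => /(froot_ge s0); rewrite ltnn.
  have : (0 < froot s (Num.truncn b))%N by apply: leq_trans Kk.
  move: (froot s (Num.truncn b)) => k k1.
  rewrite truncn_lt_nat ?(ltW bp)// => /lt_le_trans; apply.
  by rewrite -natrM -natrX ler_nat leq_exp_base// mul2n -addnn -addn1 leq_add2l.
have k1 : (0 < k)%N by apply: leq_trans Kk.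
have kR : 0 < k%:R :> R by rewrite ltr0n.
pose b' := b * C / k%:R.
have kleb : k%:R <= b.
  by apply: le_trans kb; rewrite ler_nat -[X in (X <= _)%N]expn1 leq_pexp2l.
have b'1 : 1 <= b'.
  rewrite /b' ler_pdivlMr// mul1r; apply: le_trans kleb _.
  by rewrite -[leLHS]mulr1 ler_wpM2l// ltW.
have b'n : b' <= b0 * 2 ^+ n.
  apply: (@le_trans _ _ (b / 2)).
    rewrite /b' ler_pdivrMr// -mulrA ler_wpM2l ?(ltW bp)//.
    have : K%:R <= k%:R :> R by rewrite ler_nat.
    by move: KC; lra.
  by move: bn; rewrite exprS; lra.
have b'p : 0 < b' by apply: lt_le_trans b'1.
have [N' net N'b] := IH b' b'1 b'n.
exists (k ^ d * N' + center_bound d (k ^ d))%N.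
  have k0k : (k0 <= k)%N by apply: leq_trans (leq_trans (leq_maxl _ _) (leqnSn _)) Kk.
  apply: (k0P k k0k k1); first by rewrite invr_gt0.
  rewrite -/C (_ : b^-1 * k%:R / C = b'^-1)//.
  by rewrite /b' !invfM invrK mulrAC.
pose L := ln b.
have L0L : L0 <= L by rewrite -[L0]expRK ler_ln ?posrE ?expR_gt0//; apply: ltW; apply: le_lt_trans bb0; rewrite lerDl.
have L2 : 2 <= L by apply: le_trans L0L; rewrite /L0 lerDr !mulr_ge0.
have lmb : logmax b = L by rewrite /logmax max_r// -/L; lra.
(* From [b < (2 k)^s], [ln k >= ln b / s - ln 2]; half of the gain [ln b / s] pays for
   [ln (2 C)]. *)
pose u : R := 1 - (2 * s%:R)^-1.
have s1 : 1 <= s%:R :> R by rewrite ler1n.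
have u12 : 2^-1 <= u.
  have : (2 * s%:R)^-1 <= 2^-1 :> R by rewrite lef_pV2 ?posrE//; lra.
  by rewrite /u; lra.
have u0 : 0 < u by lra.
have lnb' : logmax b' <= L * u.
  rewrite /logmax ge_max; apply/andP; split.
    have : 2 * 2^-1 <= L * u by rewrite ler_pM//; lra.
    by lra.
  have -> : ln b' = L + ln C - ln k%:R.
    by rewrite /b' ln_div ?posrE ?mulr_gt0// lnM ?posrE.
  have Lk : L <= s%:R * (ln 2 + ln k%:R).
    rewrite -lnM ?posrE// mulr_natl -lnXn ?mulr_gt0// ler_ln ?posrE ?exprn_gt0 ?mulr_gt0//.
    exact: ltW.
  have l2CE : ln (2 * C) = ln 2 + ln C by rewrite lnM ?posrE.
  have h1 : L / s%:R <= ln 2 + ln k%:R by rewrite ler_pdivrMr// mulrC.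
  have h2 : ln 2 + ln C <= L / (2 * s%:R).
    rewrite ler_pdivlMr ?mulr_gt0// -l2CE; move: L0L; rewrite /L0; lra.
  have h3 : L / s%:R = 2 * (L / (2 * s%:R)) by field; rewrite gt_eqF.
  by rewrite /u mulrBr mulr1; lra.
have lb'0 : 0 <= logmax b' by apply: le_trans (lm1 b').
have Lp : 0 < L by lra.
have shrink : C ^+ d * (logmax b') `^ wexp R d <= 2^-1 * L `^ wexp R d.
  apply: (@le_trans _ _ (C ^+ d * (L `^ wexp R d * u `^ wexp R d))).
    rewrite ler_wpM2l ?exprn_ge0 ?(ltW C0)// -powRM ?(ltW u0) ?(ltW Lp)//.
    by rewrite ge0_ler_powR// nnegrE// mulr_ge0 ?(ltW u0) ?(ltW Lp).
  rewrite mulrCA mulrC ler_wpM2r ?powR_ge0//.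
  have E1 : C ^+ d = expR (d%:R * ln C) by rewrite expRM_natl lnK.
  have E2 : u `^ wexp R d = expR (wexp R d * ln u) by rewrite /powR gt_eqF.
  have E3 : 2^-1 = expR (- ln 2) :> R by rewrite expRN lnK// posrE.
  rewrite E1 E2 E3 -expRD ler_expR.
  have lu : ln u <= - (2 * s%:R)^-1.
    by have := @le_ln1Dx R (- (2 * s%:R)^-1); rewrite -/u; apply; move: u12; rewrite /u; lra.
  have g1 := wexp_ge R d2; rewrite -/C in g1.
  have g2 : d%:R * ln C + ln 2 <= wexp R d * (2 * s%:R)^-1.
    rewrite ler_pdivlMr ?mulr_gt0//; move: g1; rewrite /s natrM expr2; lra.
  have : wexp R d * ln u <= wexp R d * - (2 * s%:R)^-1 by rewrite ler_wpM2l.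
  lra.
have centers : (center_bound d (k ^ d))%:R <= cd%:R * b ^+ d.
  apply: (@le_trans _ _ ((cd * (k ^ s) ^ d)%N)%:R); last first.
    by rewrite natrM ler_wpM2l// natrX lerXn2r ?nnegrE// ltW.
  rewrite ler_nat /center_bound /cd -expnMn leq_exp_base//.
  have kd1 : (0 < k ^ d)%N by rewrite expn_gt0 k1.
  have h : ((k ^ d).+1 ^ d <= 2 ^ d * k ^ s)%N.
    by rewrite /s expnM -expnMn leq_exp_base// mul2n -addnn -addn1 leq_add2l.
  by apply: center_arith h _ _; rewrite expn_gt0 ?k1.
rewrite natrD natrM lmb.
have bd0 : 0 <= b ^+ d by rewrite exprn_ge0// ltW.
have main : (k ^ d)%:R * N'%:R <= A * b ^+ d * (2^-1 * L `^ wexp R d).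
  apply: (@le_trans _ _ ((k ^ d)%:R * (A * b' ^+ d * logmax b' `^ wexp R d))).
    by rewrite ler_wpM2l.
  have -> : (k ^ d)%:R * (A * b' ^+ d * logmax b' `^ wexp R d) =
      A * b ^+ d * (C ^+ d * logmax b' `^ wexp R d).
    rewrite /b' natrX !exprMn exprVn; move: (k%:R ^+ d) (exprn_gt0 d kR) => y y0.
    by field; rewrite gt_eqF.
  by rewrite ler_wpM2l// mulr_ge0// ltW.
have Lg1 : 1 <= L `^ wexp R d by rewrite -lmb.
have cA : cd%:R <= 2^-1 * A by rewrite /A; have := ler0n R N0; lra.
have : cd%:R * b ^+ d <= (2^-1 * A) * b ^+ d by rewrite ler_wpM2r.
have : (2^-1 * A) * b ^+ d * 1 <= (2^-1 * A) * b ^+ d * L `^ wexp R d.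
  by rewrite ler_wpM2l// !mulr_ge0 ?(ltW A0) ?invr_ge0.
lra.
Qed.

(** * Weak nets in the plane *)

(** The net takes every [t']-th point in sorted order, with [t'] the ceiling of [e] times the number
    of points. *)
Lemma interval_net (R : realType) (V : seq R) (e : R) : (0 < size V)%N -> 0 < e ->
  exists2 T : seq R, (size T)%:R <= e^-1 + 1 &
    forall C : set R, (forall x y z, C x -> C z -> x <= y <= z -> C y) ->
      e * (size V)%:R <= (count (fun x => `[< C x >]) V)%:R -> exists2 y, y \in T & C y.
Proof.
move=> V0 e0; pose s := sort <=%R V; pose N := size V.
have sN : size s = N by rewrite size_sort.
have sS : sorted <=%R s by apply: sort_sorted => x y; apply: le_total.
have NR : 0 < N%:R :> R by rewrite ltr0n.
have eN : 0 < e * N%:R by rewrite mulr_gt0.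
pose t := (Num.truncn (e * N%:R)).+1.
pose t' := if (Num.truncn (e * N%:R))%:R == e * N%:R then Num.truncn (e * N%:R) else t.
have [t'0 t'e t'min] : [/\ (0 < t')%N, e * N%:R <= t'%:R & forall c : nat, e * N%:R <= c%:R -> (t' <= c)%N].
  rewrite /t'; case: eqP => [E|nE].
    by split; rewrite ?E// -?(ltr_nat R) ?E// => c; rewrite -(ler_nat R) E.
  split=> [//||c hc]; first by apply/ltW/Num.Theory.truncnS_gt.
  rewrite /t -(ltr_nat R); apply: lt_le_trans hc.
  by rewrite lt_neqAle; apply/andP; split; [apply/eqP|rewrite truncn_le ltW].
clearbody t'; clear t.
exists [seq nth 0 s (j * t') | j <- iota 0 (N.-1 %/ t').+1].
  rewrite size_map size_iota -natr1 lerD2r -[e^-1]mul1r ler_pdivlMr//.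
  have : ((N.-1 %/ t') * t' <= N)%N by apply: leq_trans (leq_trunc_div _ _) (leq_pred _).
  rewrite -(ler_nat R) natrM => h.
  rewrite -(ler_pM2r NR) mul1r -mulrA; apply: le_trans h.
  by rewrite ler_wpM2l.
move=> C cC hC.
pose I := [set k : 'I_N | `[< C (nth 0 s k) >]].
have IC : #|I| = count (fun x => `[< C x >]) V.
  have /permP-> : perm_eq V s by rewrite perm_sym perm_sort.
  rewrite -sum1_count (big_nth 0) big_mkord sN -sum1_card.
  by apply: eq_bigl => k; rewrite inE.
have tI : (t' <= #|I|)%N by rewrite IC; apply: t'min.
have /card_gt0P[k0 k0I] : (0 < #|I|)%N by apply: leq_trans tI.
case: (@arg_minnP _ k0 (mem I) (@nat_of_ord N) k0I) => i iI imin.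
case: (@arg_maxnP _ k0 (mem I) (@nat_of_ord N) k0I) => l lI lmax.
have card : (#|I| <= l.+1 - i)%N.
  have -> : #|I| = size [seq nat_of_ord k | k <- enum I] by rewrite size_map cardE.
  rewrite -(size_iota i (l.+1 - i)); apply: uniq_leq_size.
    by rewrite map_inj_uniq ?enum_uniq//; apply: val_inj.
  move=> k /mapP[k']; rewrite mem_enum => k'I ->; rewrite mem_iota.
  have ik := imin _ k'I; have kl := lmax _ k'I.
  by rewrite ik subnKC ?ltnS// ltnW// ltnS (leq_trans ik kl).
(* [j * t'] is the least multiple of [t'] from [i] on; the range from [i] to [l] has at least [t']
   indices and so contains it. *)
pose j := ((i + t'.-1) %/ t')%N.
have ij : (i <= j * t')%N.
  have := divn_eq (i + t'.-1) t'; rewrite -/j; have := ltn_pmod (i + t'.-1) t'0; lia.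
have jl : (j * t' <= l)%N.
  have : (j * t' <= i + t'.-1)%N by apply: leq_trunc_div.
  have := leq_trans tI card; lia.
exists (nth 0 s (j * t')).
  apply: (map_f (fun j => nth 0 s (j * t'))); rewrite mem_iota add0n ltnS leq_divRL//.
  by apply: leq_trans jl _; have := ltn_ord l; lia.
move: iI lI; rewrite !inE => /asboolP Ci /asboolP Cl.
apply: cC Ci Cl _; apply/andP; split.
  by apply: (sorted_leq_nth le_trans le_refl 0 sS) => //; rewrite inE sN; have := ltn_ord l; lia.
by apply: (sorted_leq_nth le_trans le_refl 0 sS) => //; rewrite inE sN; have := ltn_ord l; lia.
Qed.

Lemma count_allpairs (S T U : Type) (P : pred U) (f : S -> T -> U) (a : pred S) (b : pred T) s t :
  (forall x y, a x -> b y -> P (f x y)) ->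
  (count a s * count b t <= count P (allpairs f s t))%N.
Proof.
move=> H; elim: s => //= x s IH; rewrite count_cat mulnDl leq_add//.
case: (boolP (a x)) => [ax|_]; last by rewrite mul0n.
by rewrite mul1n count_map; apply: sub_count => y; apply: H.
Qed.

Lemma ord2_neq0 (j : 'I_2) : j <> 0 -> j = 1.
Proof. by case: j => [[|[|//]] j2] j0; [case: j0|]; apply: val_inj. Qed.

(* A vertical line halves the points.  A convex set with many points on both sides cuts the line in an
   interval containing many of the crossings of the line with segments between the two sides. *)
Lemma planar_step (R : realType) (e : R) N : 0 < e -> weak_net 2 (3 / 2 * e) N ->
  exists2 N', weak_net 2 e N' & N'%:R <= 2 * N%:R + 4 / e ^+ 2 + 1.
Proof.
move=> e0 net.
exists (N + N + Num.truncn (4 / e ^+ 2 + 1))%N; last first.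
  rewrite !natrD; have : (Num.truncn (4 / e ^+ 2 + 1))%:R <= 4 / e ^+ 2 + 1.
    by rewrite truncn_le addr_ge0// divr_ge0// exprn_ge0// ltW.
  lra.
move=> X X0; pose n := size X.
pose le1 (p q : 'rV[R]_2) := p 0 0 <= q 0 0.
(* Doubling [X] makes both halves exactly as long as [X]. *)
pose s := sort le1 (X ++ X).
have sn : size s = (n + n)%N by rewrite size_sort size_cat.
have le1T : total le1 by move=> p q; apply: le_total.
have le1tr : transitive le1 by move=> p q r; apply: le_trans.
have le1r : reflexive le1 by move=> p; apply: lexx.
have sS : sorted le1 s by apply: sort_sorted.
pose l := take n s; pose r := drop n s.
have ln : size l = n by rewrite size_takel// sn leq_addr.
have rn : size r = n by rewrite size_drop sn addnK.
have [Yl YlN YlP] := net l (ltac:(by rewrite ln)).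
have [Yr YrN YrP] := net r (ltac:(by rewrite rn)).
pose a := (nth 0 s n) 0 0.
have la p : p \in l -> p 0 0 <= a.
  move=> /(nthP 0)[i]; rewrite ln => iN <-; rewrite nth_take//.
  by apply: (sorted_leq_nth le1tr le1r 0 sS); rewrite ?inE ?sn; lia.
have ra p : p \in r -> a <= p 0 0.
  move=> /(nthP 0)[i]; rewrite rn => iN <-; rewrite nth_drop.
  by apply: (sorted_leq_nth le1tr le1r 0 sS); rewrite ?inE ?sn; lia.
pose tau (p q : 'rV[R]_2) := (a - p 0 0) / (q 0 0 - p 0 0).
pose cr (p q : 'rV[R]_2) := p 0 1 + tau p q * (q 0 1 - p 0 1).
pose pt (v : R) : 'rV[R]_2 := \row_j if j == 0 then a else v.
pose V := allpairs cr l r.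
have Vn : size V = (n * n)%N by rewrite size_allpairs ln rn.
(* Of the [n^2] pairs at least [(e n / 2)^2] will have both points in [C]. *)
have [||T Tsz TP] := @interval_net R V (e ^+ 2 / 4).
- by rewrite Vn muln_gt0 X0.
- by rewrite divr_gt0// exprn_gt0.
exists (Yl ++ Yr ++ map pt T).
  rewrite !size_cat size_map -addnA !leq_add//.
  rewrite truncn_ge_nat; last by rewrite addr_ge0// divr_ge0// exprn_ge0// ltW.
  by move: Tsz; rewrite invf_div.
move=> C cC hC.
have count_s : (count (fun x => `[< C x >]) l + count (fun x => `[< C x >]) r =
    2 * count (fun x => `[< C x >]) X)%N.
  rewrite -count_cat cat_take_drop.
  have /permP-> : perm_eq s (X ++ X) by rewrite perm_sort.
  by rewrite count_cat mul2n addnn.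
have [hl|hl] := leP (3 / 2 * e * n%:R) (count (fun x => `[< C x >]) l)%:R.
  have [y yY Cy] := YlP C cC (ltac:(by rewrite ln)).
  by exists y => //; rewrite mem_cat yY.
have [hr|hr] := leP (3 / 2 * e * n%:R) (count (fun x => `[< C x >]) r)%:R.
  have [y yY Cy] := YrP C cC (ltac:(by rewrite rn)).
  by exists y => //; rewrite !mem_cat yY orbT.
have tot : (count (fun x => `[< C x >]) l)%:R + (count (fun x => `[< C x >]) r)%:R =
   2 * (count (fun x => `[< C x >]) X)%:R :> R by rewrite -natrD count_s natrM.
(* The two counts sum to at least [2 e n], and each is below [3/2 e n]. *)
have l2 : e * n%:R / 2 <= (count (fun x => `[< C x >]) l)%:R by rewrite -/n in hC; lra.
have r2 : e * n%:R / 2 <= (count (fun x => `[< C x >]) r)%:R by rewrite -/n in hC; lra.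
have [||v vT Cv] := TP [set v | C (pt v)]%classic.
- move=> x y z Cx Cz /andP[xy yz]; rewrite /= in Cx Cz *.
  have [xz|xz] := eqVneq x z; first by have -> : y = x by lra.
  have xz0 : 0 < z - x by rewrite subr_gt0 lt_neqAle xz (le_trans xy).
  have -> : pt y = ((z - y) / (z - x)) *: pt x + (1 - (z - y) / (z - x)) *: pt z.
    apply/rowP => j; rewrite !mxE; case: eqP => _; first by ring.
    by field; rewrite gt_eqF.
  by apply: cC => //; rewrite divr_ge0 ?ler_pdivrMr//= ?mul1r; lra.
- rewrite Vn; apply: (@le_trans _ _ (e * n%:R / 2 * (e * n%:R / 2))).
    by rewrite natrM; rewrite le_eqVlt; apply/orP; left; apply/eqP; field.
  have en0 : 0 <= e * n%:R / 2 by rewrite divr_ge0// mulr_ge0// ltW.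
  apply: (le_trans (ler_pM en0 en0 l2 r2)); rewrite -natrM ler_nat.
  have -> : count (fun x => `[< C x >]) l = count (fun x => (x \in l) && `[< C x >]) l.
    by apply: eq_in_count => x ->.
  have -> : count (fun x => `[< C x >]) r = count (fun x => (x \in r) && `[< C x >]) r.
    by apply: eq_in_count => x ->.
  apply: count_allpairs => p q /andP[/la pl /asboolP Cp] /andP[/ra qr /asboolP Cq].
  apply/asboolP => /=.
  (* Both points then lie on the dividing line, and division by zero makes their crossing equal to
     [p]. *)
  have [pq|pq] := eqVneq (p 0 0) (q 0 0).
    suff -> : pt (cr p q) = p by [].
    apply/rowP => j; rewrite mxE /cr /tau pq subrr invr0 mulr0 mul0r addr0.
    case: eqP => [->|j0]; first by lra.
    by rewrite (ord2_neq0 j0).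
  have d0 : 0 < q 0 0 - p 0 0 by rewrite subr_gt0 lt_neqAle pq (le_trans pl qr).
  have -> : pt (cr p q) = (1 - tau p q) *: p + (1 - (1 - tau p q)) *: q.
    apply/rowP => j; rewrite !mxE; case: eqP => [->|j0].
      by rewrite /tau; field; rewrite gt_eqF.
    rewrite (ord2_neq0 j0).
    by rewrite /cr; ring.
  apply: cC => //; have t0 : 0 <= tau p q by apply: divr_ge0; lra.
  have t1 : tau p q <= 1 by rewrite /tau ler_pdivrMr// mul1r; lra.
  by lra.
by exists (pt v) => //; rewrite !mem_cat map_f ?orbT.
Qed.

(** [45] solves [2 A (2/3)^2 + 4 + 1 = A]. *)
Lemma weak_net_plane (R : realType) (b : R) : 1 <= b -> exists2 N, weak_net 2 b^-1 N & N%:R <= 45 * b ^+ 2.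
Proof.
suff H n : forall b : R, 0 < b -> b <= (3 / 2) ^+ n -> exists2 N, weak_net 2 b^-1 N & N%:R <= 45 * b ^+ 2.
  move=> b1; have b0 : 0 < b by lra.
  apply: (H (2 * (Num.truncn b).+1)%N) => //.
  rewrite exprM; apply: (@le_trans _ _ (2 ^+ (Num.truncn b).+1)); last first.
    by apply: lerXn2r; rewrite ?nnegrE//; lra.
  apply: ltW; apply: lt_trans (Num.Theory.truncnS_gt b) _.
  by rewrite -natrX ltr_nat ltn_expl.
have small (c : R) : 0 < c -> c < 1 -> exists2 N, weak_net 2 c^-1 N & N%:R <= 45 * c ^+ 2.
  move=> c0 c1; exists 0%N; first by apply: weak_net_gt1; rewrite invf_gt1.
  by rewrite mulr_ge0// exprn_ge0// ltW.
elim: n => [|n IH] c c0 cn.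
  have [c1|c1] := ltP c 1; first exact: small.
  have {c1 cn c0} -> : c = 1 by apply/le_anti; rewrite c1 -(expr0 (3 / 2 : R)) cn.
  rewrite invr1; have [|N' n1 n2] := @planar_step R 1 0 ltr01.
    by apply: weak_net_gt1; lra.
  exists N' => //; apply: (le_trans n2); lra.
have [c1|c1] := ltP c 1; first exact: small.
have [||N net Nb] := IH (2 / 3 * c); [by lra|by move: cn; rewrite exprS; lra|].
have [||N' n1 n2] := @planar_step R c^-1 N; first by rewrite invr_gt0.
  have -> : 3 / 2 * c^-1 = (2 / 3 * c)^-1 by field; rewrite gt_eqF.
  exact: net.
exists N' => //; apply: (le_trans n2).
have -> : 4 / c^-1 ^+ 2 = 4 * c ^+ 2 by rewrite exprVn invrK.
have : 1 <= c ^+ 2 by rewrite exprn_ege1.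
move: Nb; rewrite exprMn; lra.
Qed.

(** * Finite families *)

Lemma bin_le_exp2 n m : ('C(n, m) <= 2 ^ n)%N.
Proof.
elim: n m => [|n IH] [|m] //; first by rewrite bin0 expn_gt0.
by rewrite binS expnS mul2n -addnn leq_add.
Qed.

Lemma ffact_le_exp n m : (n ^_ m <= n ^ m)%N.
Proof. by elim: m => // m IH; rewrite ffactnSr expnSr leq_mul// leq_subr. Qed.

Lemma exp_le_ffact n m : (n ^ m <= (n + m) ^_ m)%N.
Proof.
elim: m => // m IH; rewrite addnS ffactSS expnS leq_mul//.
by rewrite ltnW// ltnS leq_addr.
Qed.

(** [n^n] is at most [(n+1) ... (2n) = C(2n,n) n!]. *)
Lemma self_exp_le_fact n : (n ^ n <= 4 ^ n * n`!)%N.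
Proof.
apply: leq_trans (exp_le_ffact n n) _; rewrite -bin_ffact leq_mul//.
by rewrite addnn -mul2n; apply: leq_trans (bin_le_exp2 _ _) _; rewrite expnM.
Qed.

(** [C(2P,q) <= (2P)^q / q!] and [C(q,d) <= 2^q]. One factor [P] is set aside to cancel in the
    fractional Helly inequality; the others are below [q p], and [q^q / q!] costs a second [4^q]. *)
Lemma bin_product_bound p q d : (1 < q)%N -> (q <= p)%N ->
  ('C((q.-1 * p.-1).+1.*2, q) * 'C(q, d) < (q.-1 * p.-1).+1 * (16 ^ q * p ^ q.-1))%N.
Proof.
move=> q1 qp; set P := (q.-1 * p.-1).+1.
have Ppos : (0 < P)%N by [].
have Ple : (P <= q.-1 * p)%N.
  rewrite /P; case: p qp {P Ppos} => [|p] qp; first by lia.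
  by rewrite /= mulnS; case: q q1 {qp} => [//|[//|q]] _ /=; rewrite addSn ltnS leq_addl.
rewrite -(ltn_pmul2r (fact_gt0 q)) mulnAC bin_ffact.
apply: (@leq_ltn_trans (P * (4 ^ q * P ^ q.-1))%N).
  apply: (leq_trans (leq_mul (ffact_le_exp _ _) (bin_le_exp2 _ _))).
  rewrite -mul2n expnMn mulnAC -expnMn; rewrite (_ : (2 * 2 = 4)%N)//.
  by rewrite mulnCA -expnS prednK// ltnW.
have -> : (P * (16 ^ q * p ^ q.-1) * q`! = P * (4 ^ q * (4 ^ q * q`! * p ^ q.-1)))%N.
  by rewrite (_ : 16 = 4 * 4)%N// expnMn; ring.
rewrite ltn_pmul2l// ltn_pmul2l ?expn_gt0//.
apply: (@leq_ltn_trans ((q.-1 * p) ^ q.-1)%N); first by rewrite leq_exp2r//; lia.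
rewrite expnMn ltn_pmul2r ?expn_gt0; last by rewrite (leq_trans _ qp)// ltnW.
apply: leq_trans (self_exp_le_fact q).
apply: (@leq_ltn_trans (q ^ q.-1)%N); first by rewrite leq_exp2r ?leq_pred//; lia.
by rewrite ltn_exp2l//; lia.
Qed.

Section FiniteFamilies.
Context (R : realType) (d : nat).

(** The condition on [A] is vacuous below [p] members; the pigeonhole on sequences with repetitions
    covers that case. *)
Definition pq_piercing (p q N : nat) := forall (T : finType) (K : T -> set 'rV[R]_d),
  (forall t, compact (K t)) -> (forall t, cvx (K t)) -> (forall t, (K t !=set0)%classic) ->
  (forall A : {set T}, #|A| = p -> exists B : {set T},
     [/\ B \subset A, #|B| = q & exists x, forall t, t \in B -> K t x]) ->
  exists2 Y : seq 'rV[R]_d, (size Y <= N)%N & forall t, exists2 y, y \in Y & K t y.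

Lemma piercing_of_weak_net p q B N : (0 < B)%N -> (d < q)%N -> (q <= p)%N ->
  (16 ^ q * p ^ q.-1 <= B ^ (q - d))%N ->
  weak_net d ((4 * B)%:R^-1 : R) N -> (1 < q)%N -> pq_piercing p q N.
Proof.
move=> B0 dq qp hB net q1 T K Kcompact Kcvx K0 pq.
have Kclosed t : topology_structure.closed (K t).
  by apply: compact_closed; [exact: norm_hausdorff|exact: Kcompact].
apply: (finite_transversal B0 _ net Kcvx) => w w0 wpos.
apply: contrapT => /forallNP light.
have BR : 0 < B%:R :> R by rewrite ltr0n.
have := @fractional_helly R d T K p q Kcompact Kclosed Kcvx K0 dq qp pq w w0 wpos B%:R^-1.
rewrite invr_ge0 ler0n => /(_ isT) H.
have /H : forall x, \sum_t w t * (`[< K t x >])%:R <= B%:R^-1 * \sum_t w t.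
  move=> x; rewrite ler_pdivlMl// ltW// ltNge; apply/negP; exact: light.
apply/negP; rewrite -ltNge exprVn ltr_pdivrMr ?exprn_gt0// -natrX -natrM ltr_nat.
by apply: leq_trans (bin_product_bound d q1 qp) _; rewrite leq_mul2l hB orbT.
Qed.

End FiniteFamilies.

(** * Choice of the scale [B] *)

Section Asymptotics.
Context (R : realType).

Definition piercing_exponent (d q : nat) : R := (q%:R - 1) / (q%:R - d%:R).

Lemma piercing_exponent_ge1 d q : (0 < d)%N -> (d < q)%N -> 1 <= piercing_exponent d q.
Proof.
rewrite -(ler_nat R) -(ltr_nat R) => d0 dq; rewrite ler_pdivlMr ?subr_gt0//; lra.
Qed.

(** Being uniform in [q], this keeps [ln B] of order [ln p]. *)
Lemma piercing_exponent_le d q : (0 < d)%N -> (d < q)%N -> piercing_exponent d q <= d%:R.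
Proof.
move=> d0 dq; rewrite ler_pdivrMr ?subr_gt0 ?ltr_nat//.
move: dq d0; rewrite -(ler_nat R) -(ler_nat R) -natr1.
move: d%:R q%:R => a b h1 h2; have : 0 <= (a - 1) * (b - a - 1) by apply: mulr_ge0; lra.
lra.
Qed.

(** [q <= (d+1)(q-d)] turns [16^q] into at most the [(q-d)]-th power of [16^(d+1)]; the factor 2
    pays for rounding up. *)
Lemma piercing_scale d p q : (0 < d)%N -> (d < q)%N -> (q <= p)%N ->
  exists B : nat, [/\ (0 < B)%N, (16 ^ q * p ^ q.-1 <= B ^ (q - d))%N &
    (B%:R : R) <= 2 * 16 ^+ d.+1 * p%:R `^ piercing_exponent d q].
Proof.
move=> d0 dq qp; set x := p%:R `^ _.
have p1 : 1 <= p%:R :> R by rewrite ler1n; lia.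
have x1 : 1 <= x.
  rewrite -(powRr0 p%:R) ler_powR//; apply: le_trans ler01 _.
  exact: piercing_exponent_ge1.
have C1 : 1 <= 16 ^+ d.+1 :> R by rewrite exprn_ege1// ler1n.
have Cx1 : 1 <= 16 ^+ d.+1 * x by rewrite -[leLHS]mulr1 ler_pM.
exists (Num.truncn (16 ^+ d.+1 * x)).+1; split=> //; last first.
  rewrite -natr1; have : (Num.truncn (16 ^+ d.+1 * x))%:R <= 16 ^+ d.+1 * x.
    by rewrite truncn_le; lra.
  lra.
rewrite -(ler_nat R) [leRHS]natrX.
have h : 16 ^+ d.+1 * x <= (Num.truncn (16 ^+ d.+1 * x)).+1%:R.
  exact/ltW/Num.Theory.truncnS_gt.
apply: (@le_trans _ _ ((16 ^+ d.+1 * x) ^+ (q - d))); last by rewrite lerXn2r// nnegrE//; lra.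
rewrite exprMn -exprM natrM natrX; apply: ler_pM; [exact: exprn_ge0|by []| |].
  by rewrite ler_eXn2l ?ltr1n//; nia.
rewrite -powR_mulrn; last by rewrite powR_ge0.
rewrite -powRrM /piercing_exponent natrB; last exact: ltnW.
rewrite divfK; last by rewrite subr_eq0 eqr_nat; apply/eqP; lia.
by rewrite natrX -powR_mulrn// -subn1 natrB//; lia.
Qed.

End Asymptotics.

Lemma weak_net_scale_le (R : realType) d q (p : nat) (B : nat) : (0 < d)%N -> (d < q)%N ->
  (B%:R : R) <= 2 * 16 ^+ d.+1 * p%:R `^ piercing_exponent R d q ->
  (4 * B)%:R ^+ d <= (8 * 16 ^+ d.+1) ^+ d * p%:R `^ (d%:R * piercing_exponent R d q).
Proof.
move=> d0 dq hB; rewrite [d%:R * _]mulrC powRrM powR_mulrn ?powR_ge0//.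
rewrite -exprMn lerXn2r ?nnegrE//.
  by rewrite mulr_ge0 ?powR_ge0// mulr_ge0 ?exprn_ge0.
rewrite natrM; lra.
Qed.

Lemma pq_piercing_plane (R : realType) p q : (2 < q)%N -> (q <= p)%N -> exists2 N,
  pq_piercing R 2 p q N &
  N%:R <= 45 * (8 * 16 ^+ 3) ^+ 2 * p%:R `^ (2 * piercing_exponent R 2 q).
Proof.
move=> q2 qp; have [B [B0 hB1 hB2]] := @piercing_scale R 2 p q isT q2 qp.
have b1 : 1 <= (4 * B)%:R :> R by rewrite ler1n; lia.
have [N net hN] := weak_net_plane b1.
exists N; first by apply: piercing_of_weak_net net _ => //; lia.
apply: le_trans hN _; rewrite -mulrA ler_wpM2l//.
exact: weak_net_scale_le.
Qed.

Lemma pq_piercing_polylog (R : realType) d : (2 < d)%N -> exists2 A : R, 0 < A &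
  forall p q, (d < q)%N -> (q <= p)%N -> exists2 N, pq_piercing R d p q N &
  N%:R <= A * p%:R `^ (d%:R * piercing_exponent R d q) * logmax p%:R `^ wexp R d.
Proof.
move=> d2; have d0 : (0 < d)%N by lia.
have [A A0 hA] := @weak_net_polylog R d d2.
pose D : R := 8 * 16 ^+ d.+1.
have D1 : 1 <= D.
  have : 1 <= 16 ^+ d.+1 :> R by rewrite exprn_ege1// ler1n.
  by rewrite /D; lra.
(* [logmax (4 B) <= E * logmax p], as the exponent of [p] is at most [d]; the power of [E] joins the
   constant. *)
pose E : R := ln D + d%:R.
have E0 : 0 < E by rewrite ltr_wpDl ?ln_ge0 ?ltr0n.
exists (A * D ^+ d * E `^ wexp R d); first by rewrite !mulr_gt0 ?powR_gt0 ?exprn_gt0//; lra.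
move=> p q dq qp; have [B [B0 hB1 hB2]] := @piercing_scale R d p q d0 dq qp.
have b1 : 1 <= (4 * B)%:R :> R by rewrite ler1n; lia.
have [N net hN] := hA _ b1.
exists N; first by apply: piercing_of_weak_net net _ => //; lia.
apply: le_trans hN _.
have p1 : 1 <= p%:R :> R by rewrite ler1n; lia.
have g0 : 0 <= wexp R d by rewrite /wexp !mulr_ge0// ln_ge0// ler1n.
have L1 : 1 <= logmax p%:R :> R by rewrite /logmax le_max lexx.
have hL : logmax (4 * B)%:R <= E * logmax (p%:R : R).
  have e1 : 1 <= E * 1 by rewrite mulr1 /E ler_wpDl ?ln_ge0// ler1n.
  rewrite {1}/logmax ge_max; apply/andP; split.
    by apply: le_trans e1 _; rewrite ler_wpM2l// ltW.
  have x0 : 0 < p%:R `^ piercing_exponent R d q by rewrite powR_gt0//; lra.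
  apply: (@le_trans _ _ (ln (D * p%:R `^ piercing_exponent R d q))).
    rewrite ler_ln ?posrE; first by rewrite natrM /D; lra.
      by lra.
    by rewrite mulr_gt0//; lra.
  rewrite lnM ?posrE//; last by lra.
  rewrite ln_powR /E mulrDl lerD//.
    by rewrite -[leLHS]mulr1 ler_wpM2l ?ln_ge0.
  have := piercing_exponent_ge1 R d0 dq; have := piercing_exponent_le R d0 dq.
  move=> h1 h2; apply: ler_pM => //; [by lra|exact: ln_ge0|].
  by rewrite /logmax le_max lexx orbT.
have -> : A * D ^+ d * E `^ wexp R d * p%:R `^ (d%:R * piercing_exponent R d q)
     * logmax p%:R `^ wexp R d
   = (A * (D ^+ d * p%:R `^ (d%:R * piercing_exponent R d q))) * (E `^ wexp R d * logmax p%:R `^ wexp R d).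
  ring.
rewrite -powRM; [|lra..].
apply: ler_pM.
- by rewrite mulr_ge0 ?exprn_ge0// ltW.
- exact: powR_ge0.
- by rewrite ler_wpM2l ?(ltW A0)//; exact: weak_net_scale_le.
- rewrite ge0_ler_powR// nnegrE; first by rewrite /logmax le_max ler01.
  by rewrite mulr_ge0//; lra.
Qed.

(** * Infinite families *)

Lemma fmap_ultra_filter (S V : Type) (f : S -> V) (U : set_system S) :
  UltraFilter U -> UltraFilter (f @ U)%classic.
Proof.
move=> UU; split; first exact: fmap_proper_filter.
move=> G GF sub; apply/seteqP; split=> [A GA|]; last exact: sub.
have [//|nA] := in_ultra_setVsetC (f @^-1` A)%classic UU.
have /filter_ex[v []] : G (A `&` ~` A)%classic by apply: filterI => //; apply: sub.
by [].
Qed.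

Lemma ultra_finite_cover (S : Type) (U : set_system S) (N : nat) (P : nat -> set S) :
  UltraFilter U -> U (fun s => exists2 j, (j < N)%N & P j s) -> exists2 j, (j < N)%N & U (P j).
Proof.
move=> UU; elim: N => [|N IH] UN.
  by have [s [j]] := filter_ex UN.
have [UP|UP] := in_ultra_setVsetC (P N) UU; first by exists N.
have [|j jN Uj] := IH; last by exists j => //; apply: ltnW.
apply: filterS (filterI UN UP) => s [[j]] /= jN Pj nP.
by exists j => //; move: jN; rewrite ltnS leq_eqVlt => /orP[/eqP jN|//]; case: nP; rewrite -jN.
Qed.

(* Along an ultrafilter on the finite subfamilies, every member contains the [j]-th piercing point of
   almost all subfamilies for some [j], hence also its limit. *)
Lemma piercing_compactness (R : realType) d (N : nat) (F : set (set 'rV[R]_d)) :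
  (forall K, F K -> compact K) ->
  (forall s : seq (set 'rV[R]_d), (forall K, K \in s -> F K) ->
    exists2 Y : seq 'rV[R]_d, (size Y <= N)%N & forall K, K \in s -> exists2 y, y \in Y & K y) ->
  exists2 Y : seq 'rV[R]_d, (size Y <= N)%N & forall K, F K -> exists2 y, y \in Y & K y.
Proof.
move=> Kc H; pose good (s : seq (set 'rV[R]_d)) := forall K, K \in s -> F K.
have [x xP] : exists x : seq (set 'rV[R]_d) -> nat -> 'rV[R]_d, forall s, good s ->
    forall K, K \in s -> exists2 j, (j < N)%N & K (x s j).
  suff /choice[x xP] : forall s, exists x : nat -> 'rV[R]_d, good s ->
    forall K, K \in s -> exists2 j, (j < N)%N & K (x j) by exists x.
  move=> s; have [gs|] := pselect (good s); last by exists (fun=> 0).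
  have [Y YN hY] := H s gs; exists (nth 0 Y) => _ K Ks.
  have [y yY Ky] := hY K Ks; exists (index y Y); last by rewrite nth_index.
  by apply: leq_trans YN; rewrite index_mem.
(* Tails of the finite subfamilies, directed by inclusion. *)
pose G : set_system (seq (set 'rV[R]_d)) := fun A =>
  exists2 s, good s & forall s', good s' -> {subset s <= s'} -> A s'.
have GF : ProperFilter G.
  split; first by move=> [s gs /(_ s gs)]; apply.
  split; first by exists [::].
    move=> A B [s gs hA] [t gt hB]; exists (s ++ t).
      by move=> K; rewrite mem_cat => /orP[]; [apply: gs|apply: gt].
    move=> s' gs' sub; split; [apply: hA|apply: hB] => // K Ks; apply: sub; rewrite mem_cat Ks ?orbT//.
  by move=> A B AB [s gs hA]; exists s => // s' gs' sub; apply/AB/hA.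
have [U [UU GU]] := ultraFilterLemma GF.
exists [seq lim ((fun s => x s j) @ U)%classic | j <- iota 0 N]; first by rewrite size_map size_iota.
move=> K FK; have [j jN Uj] : exists2 j, (j < N)%N & U (fun s => K (x s j)).
  apply: ultra_finite_cover; apply: GU; exists [:: K].
    by move=> K'; rewrite inE => /eqP ->.
  by move=> s gs sub; apply: xP => //; apply: sub; rewrite mem_head.
exists (lim ((fun s => x s j) @ U)%classic).
  by apply: (map_f (fun j => lim ((fun s => x s j) @ U)%classic)); rewrite mem_iota.
have := Kc K FK; rewrite compact_ultra => /(_ _ (fmap_ultra_filter (fun s => x s j) UU) Uj)[y [Ky cy]].
by rewrite (cvg_lim _ cy)//; exact: norm_hausdorff.
Qed.

(** * Transfer to functions on Fin.t *)

Local Notation R := Rdefinitions.R.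

Section Coordinates.
Context (d : nat).

Definition ord_of_fin (i : Fin.t d) : 'I_d :=
  Ordinal (introT ssrnat.ltP (proj2_sig (Fin.to_nat i))).
Definition fin_of_ord (j : 'I_d) : Fin.t d := Fin.of_nat_lt (elimT ssrnat.ltP (ltn_ord j)).

Lemma fin_of_ordK : cancel fin_of_ord ord_of_fin.
Proof. by move=> j; apply: val_inj; rewrite /= Fin.to_nat_of_nat. Qed.

Lemma ord_of_finK : cancel ord_of_fin fin_of_ord.
Proof.
move=> i; rewrite -[RHS]Fin.of_nat_to_nat_inv /fin_of_ord /=.
exact: Fin.of_nat_ext.
Qed.

Definition pt_of_row (v : 'rV[R]_d) : pt d := fun i => v 0 (ord_of_fin i).
Definition row_of_pt (x : pt d) : 'rV[R]_d := \row_j x (fin_of_ord j).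

Lemma pt_of_rowK : cancel pt_of_row row_of_pt.
Proof. by move=> v; apply/rowP => j; rewrite mxE /pt_of_row fin_of_ordK. Qed.

Lemma row_of_ptK : cancel row_of_pt pt_of_row.
Proof. by move=> x; apply/funext => i; rewrite /pt_of_row mxE ord_of_finK. Qed.

Definition rows (K : rset d) : set 'rV[R]_d := fun v => K (pt_of_row v).
Definition pts (K : set 'rV[R]_d) : rset d := fun x => K (row_of_pt x).

Lemma rowsK : cancel rows pts.
Proof. by move=> K; apply/funext => x; rewrite /pts /rows /= row_of_ptK. Qed.

Lemma ptsK : cancel pts rows.
Proof. by move=> K; apply/funext => x; rewrite /pts /rows /= pt_of_rowK. Qed.

Lemma rows_cvx K : Defs.convex K -> cvx (rows K).
Proof.
move=> cK x y t /andP[/RleP t0 /RleP t1] Kx Ky; have := cK _ _ Kx Ky t (conj t0 t1).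
rewrite /rows /=; congr (K _); apply/funext => i.
by rewrite /pt_of_row !mxE.
Qed.

Lemma row_entry_le (v : 'rV[R]_d) j : `|v 0 j| <= `|v|.
Proof. by rewrite [leRHS]mx_normrE (le_bigmax _ (fun ij => `|v ij.1 ij.2|) (0, j)). Qed.

Lemma rows_compact K : Defs.compact K -> compact (rows K).
Proof.
move=> [Kc [M hM]]; apply: bounded_closed_compact.
  exists `|M|; split; first exact: num_real.
  move=> M' MM' v Kv; rewrite /= [leLHS]mx_normrE; apply/bigmax_leP; split.
    by apply: le_trans (normr_ge0 M) (ltW MM').
  move=> [i j] _ /=; have /RleP := hM _ Kv (fin_of_ord j).
  rewrite RabsE /pt_of_row fin_of_ordK [i]ord1 => /le_trans; apply.
  by apply: le_trans (ler_norm M) (ltW MM').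
rewrite -[rows K]classical_sets.setCK; apply: open_closedC; rewrite openE => v nKv.
have [e [/RltP e0 he]] := Kc (pt_of_row v) nKv.
apply/nbhs_ballP; exists e => // w; rewrite -ball_normE /= => vw.
apply: he => i; apply/RltP; rewrite RabsE RminusE distrC.
apply: le_lt_trans vw; have := row_entry_le (v - w) (ord_of_fin i).
by rewrite !mxE.
Qed.

End Coordinates.

Lemma InP (T : eqType) (x : T) s : reflect (List.In x s) (x \in s).
Proof.
elim: s => [|y s IH] /=; first by right.
rewrite inE eq_sym; apply: (iffP orP).
  by move=> [/eqP ->|/IH]; [left|right].
by move=> [->|/IH]; [left|right].
Qed.

Lemma nth_errorE (T : Type) (x0 : T) s i x :
  List.nth_error s i = Some x -> (i < size s)%N /\ nth x0 s i = x.
Proof. by elim: s i => [|y s IH] [|i] //=; [move=> [->]|apply: IH]. Qed.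

Lemma nth_error_nth (T : Type) (x0 : T) s i : (i < size s)%N ->
  List.nth_error s i = Some (nth x0 s i).
Proof. by elim: s i => [|y s IH] [|i] //=; apply: IH. Qed.

Lemma same_setP d (A B : rset d) : same_set A B <-> A = B.
Proof. by split=> [AB|->//]; apply/funext => x; apply/propext. Qed.

Lemma membersP d (F : Defs.family d) k (s : seq (set (pt d))) :
  members F k s <-> [/\ size s = k, uniq s & forall K, K \in s -> F K].
Proof.
split=> [[sk [ds Fs]]|[sk us Fs]].
  split=> //; last by move=> K /InP; move/List.Forall_forall: Fs; apply.
  apply/(uniqP classical_sets.set0) => i j; rewrite !inE => si sj ij; apply: contrapT => nij.
  have := ds i j (elimT ssrnat.ltP si) (elimT ssrnat.ltP sj) nij _ _
    (nth_error_nth classical_sets.set0 si) (nth_error_nth classical_sets.set0 sj).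
  by apply; apply/same_setP.
split=> //; split; last by apply/List.Forall_forall => K /InP; apply: Fs.
move=> i j _ _ nij A B /(nth_errorE classical_sets.set0)[si Ai] /(nth_errorE classical_sets.set0)[sj Bj] /same_setP AB.
by apply: nij; apply: (uniqP classical_sets.set0 us); rewrite ?inE// Ai Bj.
Qed.

Lemma HD_le_of_piercing d p q N (s : R) : pq_piercing R d p q N -> N%:R <= s -> HD_le d p q s.
Proof.
move=> pierce Ns F FK [_ [F0 Fpq]].
have [||Y YN YP] := @piercing_compactness R d N [set K | F (pts K)]%classic.
- by move=> K /= /FK[Kc _]; rewrite -(ptsK K); apply: rows_compact.
(* Duplicates are removed because the [(p,q)]-property speaks of distinct members. *)
- move=> s' gs; pose u := undup s'; pose K (i : 'I_(size u)) := nth classical_sets.set0 u i.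
  have FKi i : F (pts (K i)) by apply: gs; rewrite -mem_undup mem_nth.
  have Kinj : injective (fun i => pts (K i)).
    move=> i j /(can_inj (@ptsK d)) ij; apply/val_inj/eqP.
    by rewrite -(nth_uniq classical_sets.set0 (ltn_ord i) (ltn_ord j) (undup_uniq s')) ; apply/eqP.
  have [|||A Ap|Y YN YP] := pierce _ K.
  + by move=> i; rewrite -[K i]ptsK; apply: rows_compact; case: (FK _ (FKi i)).
  + by move=> i; rewrite -[K i]ptsK; apply: rows_cvx; case: (FK _ (FKi i)).
  + by move=> i; have [x Kx] := F0 _ (FKi i); exists (row_of_pt x).
  + have [|S' [/membersP[S'q uS' FS'] [sub [x hx]]]] := Fpq [seq pts (K i) | i <- enum A].
      apply/membersP; split; first by rewrite size_map -cardE.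
        by rewrite map_inj_uniq ?enum_uniq.
      by move=> _ /mapP[i _ ->].
    pose B := [set i in A | pts (K i) \in (S' : seq (set (pt d)))].
    exists B; split.
    * by apply/subsetP => i; rewrite inE => /andP[].
    * rewrite cardE -(size_map (fun i => pts (K i))) -S'q; apply/perm_size/uniq_perm => //.
        by rewrite map_inj_uniq ?enum_uniq.
      move=> P; apply/mapP/idP => [[i]|PS'].
        by rewrite mem_enum inE => /andP[_ iS'] ->.
      have /InP/mapP[i] := sub _ (elimT (InP _ _) PS').
      rewrite mem_enum => iA PE; exists i => //.
      by rewrite mem_enum inE iA -PE.
    * exists (row_of_pt x) => i; rewrite inE => /andP[_ /InP].
      by move/List.Forall_forall: hx; apply.
  exists Y => // K' K's.
  have K'u : K' \in u by rewrite mem_undup.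
  have := YP (Ordinal (introT idP (etrans (index_mem K' u) K'u))).
  by rewrite /K /= nth_index.
exists [seq pt_of_row y | y <- Y]; split.
  move=> K FK'; have [|y yY Ky] := YP (rows K); first by rewrite /= rowsK.
  by exists (pt_of_row y); split=> //; apply: List.in_map; apply/InP.
apply/RleP; rewrite INRE; apply: le_trans Ns; rewrite ler_nat.
by rewrite [X in (X <= _)%N](size_map (@pt_of_row d)).
Qed.

Lemma RpowerE (x y : R) : 0 < x -> Rpower x y = x `^ y.
Proof. by move=> x0; rewrite /Rpower /powR gt_eqF// RexpE RlnE. Qed.

Lemma logmE (x : R) : logm x = logmax x.
Proof. by rewrite /logm RmaxE RlnE. Qed.

Local Open Scope R_scope.

Lemma HD_le_plane p q : (2 < q)%coq_nat -> (q <= p)%coq_nat ->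
  HD_le 2 p q ((45 * (8 * 16 ^ 3) ^ 2) * Rpower (INR p) (2 * (INR q - 1) / (INR q - 2))).
Proof.
move=> /ssrnat.ltP q2 /ssrnat.leP qp; have [N hN bN] := @pq_piercing_plane R p q q2 qp.
apply: HD_le_of_piercing hN _; apply: le_trans bN _.
rewrite RpowerE; last by rewrite INRE ltr0n; lia.
rewrite !RealsE /piercing_exponent -[X in (_ <= _ * _ `^ X)%R]mulrA; exact: lexx.
Qed.

Lemma HD_le_polylog : exists A : nat -> R, forall d, (3 <= d)%coq_nat -> 0 < A d /\
  forall p q, (d < q)%coq_nat -> (q <= p)%coq_nat ->
  HD_le d p q (A d * Rpower (INR p) (INR d * (INR q - 1) / (INR q - INR d))
    * Rpower (logm (INR p)) (28 * INR d ^ 3 * logm (INR d))).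
Proof.
suff H d : exists A, (3 <= d)%coq_nat -> 0 < A /\
    forall p q, (d < q)%coq_nat -> (q <= p)%coq_nat ->
    HD_le d p q (A * Rpower (INR p) (INR d * (INR q - 1) / (INR q - INR d))
      * Rpower (logm (INR p)) (28 * INR d ^ 3 * logm (INR d))).
  by have [A hA] := choice H; exists A.
have [d2|d2] := leqP 3 d; last by exists 0 => /ssrnat.leP; rewrite leqNgt d2.
have [A A0 hA] := @pq_piercing_polylog R d d2.
exists A => _; split; first exact/RltP.
move=> p q /ssrnat.ltP dq /ssrnat.leP qp; have [N hN bN] := hA p q dq qp.
apply: HD_le_of_piercing hN _; apply: le_trans bN _.
have p0 : (0 < p%:R :> R)%R by rewrite ltr0n; lia.
have lm1 (x : R) : (1 <= logmax x)%R by rewrite /logmax le_max lexx.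
rewrite !logmE !RpowerE ?INRE//; last exact: lt_le_trans (lm1 _).
rewrite !RealsE /piercing_exponent mulrA ler_pM ?mulr_ge0 ?powR_ge0 ?(ltW A0)//.
(* Replacing [ln d] by [logm d] can only enlarge the exponent, and the base is at least 1. *)
rewrite ler_powR// /wexp ler_wpM2l//; first by rewrite mulr_ge0// exprn_ge0.
by rewrite /logmax le_max lexx orbT.
Qed.

End Piercing.

Theorem theorem1p3 :
  exists c : R, 0 < c /\
  exists C : nat -> R, (forall d : nat, (2 <= d)%nat -> 0 < C d) /\
  forall d p q : nat, (2 <= d)%nat -> (q <= p)%nat -> (d < q)%nat ->
    ((3 <= d)%nat ->
       HD_le d p q
         (C d * Rpower (INR p) (INR d * (INR q - 1) / (INR q - INR d))
              * Rpower (logm (INR p)) (c * INR d ^ 3 * logm (INR d)))) /\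
    (d = 2%nat ->
       HD_le d p q (C d * Rpower (INR p) (2 * (INR q - 1) / (INR q - 2)))).
Proof.
destruct Piercing.HD_le_polylog as [A HA].
exists 28; split; [lra|].
exists (fun d => if Nat.eq_dec d 2 then 45 * (8 * 16 ^ 3) ^ 2 else A d); split.
- intros d d2; destruct (Nat.eq_dec d 2) as [E|E]; [lra|].
  apply HA; lia.
- intros d p q d2 qp dq; split.
  + intros d3; destruct (Nat.eq_dec d 2) as [E|E]; [lia|].
    apply HA; assumption.
  + intros E; subst d; simpl Nat.eq_dec; cbv iota.
    apply Piercing.HD_le_plane; assumption.
Qed.
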